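(* Let $\epsilon_d\in(0,1)$, $0<p<q<\tfrac12$, and $r<\frac{t(q,\epsilon_d)}{\rho^{*}}C_{\mathrm{BAC}}(p,q)$. There exists a sequence of codes $\{\mathcal{C}_n\}$ of blocklength $n$, relative throughput $r$, and shared-key length $\Delta(n)=c\sqrt n\log(n)$ for some constant $c>0$, such that for large enough $n$, 1. $\mathcal{C}_n$ is $(1-\epsilon_d)$-covert; 2. $\mathcal{C}_n$ ensures the probability of error $P_{\mathrm{err}}\le\epsilon_n$, where $\limsup_{n\to\infty}\epsilon_n=0$; 3. $\mathcal{C}_n$ can be encoded and decoded with $\mathrm{poly}(n)$ complexity.
   Context: All logarithms are binary; $\mathrm{wt}_H$ is Hamming weight; $\oplus$ is addition modulo 2; $Q(x)=\frac{1}{\sqrt{2\pi}}\int_x^\infty e^{-u^2/2}du$. Model. A code of blocklength $n$ with $N$ messages and $\Delta(n)$ bits of shared key consists of an encoder and a decoder. The encoder $\Psi(T,M,K)$ takes the transmission status $T\in\{0,1\}$, a message $M$ (uniform on $\{1,\dots,N\}$ if $T=1$; $M=0$ if $T=0$) and a shared key $K$ uniform on $\{0,1\}^{\Delta(n)}$, independent of $M$. If $T=0$ the output is $\mathbf{X}=\mathbf{0}\in\{0,1\}^n$; if $T=1$ the output $\mathbf{X}=\Psi(1,M,K)\in\{0,1\}^n$ is arbitrary. The codebook $\mathcal{C}$ (collection of outputs of $\Psi(1,\cdot,\cdot)$), encoder and decoder are known to everyone; $K$ is unknown to the adversary, as are $T,M$. The relative throughput is $r=(\log N)/\sqrt n$.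 The adversary observes $\mathbf{Z}=\mathbf{X}\oplus\bar{\mathbf{S}}$ with $\bar{\mathbf{S}}$ having i.i.d. Bern$(q)$ coordinates. An estimator is a map $\Phi:\{0,1\}^n\to\{0,1\}$, $\widehat T=\Phi(\mathbf{Z})$, with $P_{\mathrm{FA}}(\Phi)=\mathbb{P}(\widehat T=1\mid T=0)$, $P_{\mathrm{MD}}(\Phi)=\mathbb{P}(\widehat T=0\mid T=1)$. The codes are $(1-\epsilon_d)$-covert if $\liminf_{n\to\infty}\min_\Phi\{P_{\mathrm{FA}}(\Phi)+P_{\mathrm{MD}}(\Phi)\}\ge1-\epsilon_d$. A jamming strategy is a conditional distribution $W_{\mathbf{S}|\mathbf{Z},\mathcal{C}}$ producing $\mathbf{S}\in\{0,1\}^n$ with $\mathrm{wt}_H(\mathbf{S})\le pn$ from $\mathbf{Z}$ and knowledge of the code (no computational restriction on the adversary). The receiver observes $\mathbf{Y}=\mathbf{X}\oplus\mathbf{S}$ and outputs $\widehat M=\Gamma(\mathbf{Y},K)\in\{0,1,\dots,N\}$. The probability of error is $$P_{\mathrm{err}}=\max_{W_{\mathbf{S}|\mathbf{Z},\mathcal{C}}}\Big(\mathbb{P}(\widehat M\ne0\mid T=0)+\mathbb{P}(\widehat M\ne M\mid T=1)\Big).$$ Quantities: $t(q,\epsilon_d)=\frac{2\sqrt{q(1-q)}}{1-2q}\,Q^{-1}\!\left(\frac{1-\epsilon_d}{2}\right)$. Consider the binary asymmetric channel with input $X\in\{0,1\}$, output $Y\in\{0,1\}$ and flip probabilities $W_{Y|X}(1|0)=p$,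 $W_{Y|X}(0|1)=\frac{(1-q)p}{q}$. $C_{\mathrm{BAC}}(p,q)=\max_{P_X}I(X;Y)$ is its capacity, and Bern$(\rho^{*})$ is the input distribution attaining the maximum. *)

(* Defs.v *)
From HB Require Import structures.
From mathcomp Require Import all_boot all_order all_algebra.
From mathcomp Require Import all_classical all_reals all_analysis.
Set Implicit Arguments.
Unset Strict Implicit.
Unset Printing Implicit Defensive.
Import Order.TTheory GRing.Theory Num.Theory.
Import numFieldNormedType.Exports.
Local Open Scope classical_set_scope.
Local Open Scope ring_scope.

Notation bits n := {ffun 'I_n -> bool}.

Definition xorb_bits n (x y : bits n) : bits n := [ffun i => x i (+) y i].

Definition hamming_weight n (x : bits n) : nat := #|[pred i | x i]|.

Definition log2 (R : realType) (x : R) : R := ln x / ln 2.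

Definition gaussianQ (R : realType) (x : R) : R :=
  (Num.sqrt (2 * pi))^-1 *
  \int[@lebesgue_measure R]_(u in `[x, +oo[) expR (- (u ^+ 2 / 2)).

(* The inverse is only meaningful on ]0, 1[, the range of gaussianQ. *)
Definition gaussianQinv (R : realType) (y : R) : R :=
  xget 0 [set x | gaussianQ x = y].

Definition covert_weight (R : realType) (q eps_d : R) : R :=
  2 * Num.sqrt (q * (1 - q)) / (1 - 2 * q) * gaussianQinv ((1 - eps_d) / 2).

(* The terms with P x * W x y = 0 vanish, as required by 0 log 0 = 0. *)
Definition mutual_info (R : realType) (P : bool -> R) (W : bool -> bool -> R)
    : R :=
  \sum_(x : bool) \sum_(y : bool)
    P x * W x y * log2 (W x y / \sum_(x' : bool) P x' * W x' y).

(* [bac p q x y] is the probability of output y given input x. *)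
Definition bac (R : realType) (p q : R) (x y : bool) : R :=
  if x then bernoulli_pmf (1 - (1 - q) * p / q) y else bernoulli_pmf p y.

Definition bac_capacity (R : realType) (p q : R) : R :=
  sup [set mutual_info (bernoulli_pmf rho) (bac p q) | rho in `[0, 1]].

(* Messages are 1, ..., N; the value 0 stands for "no message". The first
   argument of the encoder is the transmission status T. *)
Record jam_code (n N Delta : nat) := Code {
  encode : bool -> 'I_N.+1 -> bits Delta -> bits n;
  decode : bits n -> bits Delta -> 'I_N.+1;
  encode_off : forall m k, encode false m k = [ffun=> false] }.

Section Probabilities.
Variable R : realType.

(* Law of M given T = t. *)
Definition message_law N (t : bool) (m : 'I_N.+1) : R :=
  if t then (m != ord0)%:R / N%:R else (m == ord0)%:R.

Definition noise_law n (q : R) (e : bits n) : R :=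
  \prod_i bernoulli_pmf q (e i).

(* Given T = t, the expectation of f M K Z, where Z = X + noise is what the
   adversary observes. *)
Definition expect n N Delta (C : jam_code n N Delta) (q : R) (t : bool)
    (f : 'I_N.+1 -> bits Delta -> bits n -> R) : R :=
  \sum_(m : 'I_N.+1) \sum_(k : bits Delta) \sum_(e : bits n)
    message_law t m * (2 ^+ Delta)^-1 * noise_law q e *
    f m k (xorb_bits (encode C t m k) e).

Definition false_alarm n N Delta (C : jam_code n N Delta) (q : R)
    (Phi : bits n -> bool) : R :=
  expect C q false (fun _ _ z => (Phi z == true)%:R).

Definition missed_detection n N Delta (C : jam_code n N Delta) (q : R)
    (Phi : bits n -> bool) : R :=
  expect C q true (fun _ _ z => (Phi z == false)%:R).

Definition detection_error n N Delta (C : jam_code n N Delta) (q : R) : R :=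
  inf (range (fun Phi : bits n -> bool =>
    false_alarm C q Phi + missed_detection C q Phi)).

Definition covert (N Delta : nat -> nat)
    (C : forall n : nat, jam_code n (N n) (Delta n)) (q eps_d : R) : Prop :=
  ((1 - eps_d)%:E <= limn_einf (fun n => (detection_error (C n) q)%:E))%E.

(* [W z s] is the conditional probability of the jamming vector s given the
   observation z. *)
Definition jamming_strategy n (p : R) (W : bits n -> bits n -> R) : Prop :=
  [/\ forall z s, 0 <= W z s,
      forall z, \sum_s W z s = 1 &
      forall z s, W z s != 0 -> (hamming_weight s)%:R <= p * n%:R].

(* Probability that the decoded message differs from M, given T = t; recall
   that M = 0 when T = 0. *)
Definition decoding_error n N Delta (C : jam_code n N Delta) (q : R)
    (W : bits n -> bits n -> R) (t : bool) : R :=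
  expect C q t (fun m k z => \sum_(s : bits n)
    W z s * (decode C (xorb_bits (encode C t m k) s) k != m)%:R).

(* W may depend on C, since the supremum is taken for each code separately. *)
Definition error_probability n N Delta (C : jam_code n N Delta) (p q : R) : R :=
  sup [set decoding_error C q W false + decoding_error C q W true
      | W in jamming_strategy (n := n) p].

(* Delta(n) = c sqrt(n) log(n), rounded up to an integer. *)
Definition key_length (c : R) (n : nat) : nat :=
  `|Num.ceil (c * Num.sqrt n%:R * log2 (n%:R : R))|%N.

(* log N_n = r sqrt(n), rounded up by less than one bit (exact equality is
   impossible in general as N_n is an integer). *)
Definition has_throughput (r : R) (N : nat -> nat) : Prop :=
  forall n, (0 < N n)%N /\
    r * Num.sqrt n%:R <= log2 ((N n)%:R : R) < r * Num.sqrt n%:R + 1.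

End Probabilities.

(* Boolean circuits of fan-in two: wires are numbered from the inputs on, each
   gate adds one wire, and a wire that is not yet defined carries false. *)
Record gate := Gate {
  gate_op : bool -> bool -> bool; gate_left : nat; gate_right : nat }.

Record circuit := Circuit { gates : seq gate; outputs : seq nat }.

Definition circuit_size (c : circuit) : nat :=
  size (gates c) + size (outputs c).

Definition run_gate (ws : seq bool) (g : gate) : seq bool :=
  rcons ws (gate_op g (nth false ws (gate_left g)) (nth false ws (gate_right g))).

Definition run_circuit (c : circuit) (input : seq bool) : seq bool :=
  let ws := foldl run_gate input (gates c) in
  [seq nth false ws i | i <- outputs c].

(* Binary notation of m in {0, ..., N}, least significant bit first, on the
   least number of bits that suffices for N. *)
Definition message_bits N (m : 'I_N.+1) : seq bool :=
  mkseq (fun i => odd (m %/ 2 ^ i)) (up_log 2 N.+1).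

Definition computes_encoder n N Delta (c : circuit) (C : jam_code n N Delta) : Prop :=
  forall t m (k : bits Delta),
    run_circuit c (t :: message_bits m ++ codom k) = codom (encode C t m k).

Definition computes_decoder n N Delta (c : circuit) (C : jam_code n N Delta) : Prop :=
  forall (y : bits n) (k : bits Delta),
    run_circuit c (codom y ++ codom k) = message_bits (decode C y k).

(* Complexity is circuit size: the codes are a non-uniform family, so that their
   description (including the real parameters they depend on) is available to
   the encoder and to the decoder for free, up to its polynomial length. *)
Definition poly_complexity (N Delta : nat -> nat)
    (C : forall n : nat, jam_code n (N n) (Delta n)) : Prop :=
  exists P : {poly nat}, \forall n \near \oo, exists cenc cdec : circuit,
    [/\ computes_encoder cenc (C n), computes_decoder cdec (C n),
        (circuit_size cenc <= P.[n])%N & (circuit_size cdec <= P.[n])%N].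

(* Main.v *)
From HB Require Import structures.
Require Import Defs.
From mathcomp Require Import all_boot all_order all_algebra.
From mathcomp Require Import all_classical all_reals all_analysis.
From mathcomp Require Import ring lra zify.
Set Implicit Arguments.
Unset Strict Implicit.
Unset Printing Implicit Defensive.
Import Order.TTheory GRing.Theory Num.Theory.
Import numFieldNormedType.Exports.
Local Open Scope ring_scope.

(** A short dense code is hidden at secret places of a long silent word. The message is cut into [B]
    blocks of [b] bits, every block is encoded by the same codebook [C] of length [l], with [b] and
    [l] of order log n, and the [B * l] = O(sqrt n) code bits are written at distinct positions read
    off the key; all other coordinates carry 0. If b / l is slightly below the capacity I and the
    words of [C] have weight about rho l, the total weight is about r (rho / I) sqrt n, which is
    below t sqrt n precisely because r < t I / rho.

    Covertness ([covert_test]). For uniformly random positions the likelihood ratio of the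
    observation against pure noise is symmetric and increasing in the coordinates, so the best test
    compares a Hamming weight with a threshold. The weight tail for an input of weight at most w0 is
    dominated, up to a small shortfall probability, by the tail for an i.i.d. Bern(theta) input with
    theta slightly above w0 / n. The adversary is thus left with telling Bin(n, q + theta (1 - 2q))
    from Bin(n, q). A binomial tail is a Beta distribution function of its success probability
    ([is_derive_bernoulli_tail]), and [beta_shift] bounds its increment by a Gaussian mass 1 - 2
    Q(x) < eps_d.

    Reliability ([jam_bound]). Fix the observation z and the jamming vector s. By Bayes' rule the
    position of a code bit 0 is uniform given z, that of a code bit 1 is weighted by the likelihood
    ratio of z there, and apart from distinctness the positions are independent. The decoder
    therefore faces a memoryless channel which, for typical z, is hardly worse than the asymmetric
    channel of the theorem: the best jamming spends all its flips on ones of z, where the weight is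
    (1 - q) / q. Forgetting distinctness costs a bounded factor ([falling_ratio]), normalization a
    polynomial one. The channel depends on three counts in 0..n only, so one codebook has to cope
    with (n + 1)^3 channels; random coding with expurgation ([codebook_exists],
    [jam_resistant_codebook]) has error exp(- E l), and a long enough logarithmic [l] beats every
    polynomial factor and the union bound over blocks. If nothing is sent, the received block is
    independent of the codebook and is rejected.

    Key and complexity. Every code bit uses about 3 log n key bits as a digit of a Lehmer code,
    which makes the positions nearly uniform ([key_position_avg_le]). Codebook, block decoder and
    digits depend on O(log n) bits and are truth tables of polynomial size. [codes_exist] puts the
    pieces together. *)

(** * Sums over function spaces as product measures *)

Lemma prod_indicator (R : comNzRingType) (I : finType) (P : pred I) :
  \prod_i (P i)%:R = [forall i, P i]%:R :> R.
Proof.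
case: forallP => [H|H]; first by rewrite big1// => i _; rewrite H.
have [i /negbTE Pi] : exists i, ~~ P i.
  by apply/existsP; rewrite -negb_forall; apply/negP => /forallP.
by rewrite (bigD1 i)//= Pi mul0r.
Qed.

Lemma sum_ffun_prod (R : comNzRingType) (J A : finType) (g : J -> A -> R) :
  \sum_(f : {ffun J -> A}) \prod_j g j (f j) = \prod_j \sum_a g j a.
Proof. by rewrite bigA_distr_bigA. Qed.

(** Marginalization of a product measure that need not be normalized: the coordinates outside the
    image of [iota] contribute their total masses. As [iota] is injective, fixing the observed
    values constrains each coordinate separately, so the sum still factors. It serves both to split
    the key into chunks and to isolate one code block. *)
Lemma sum_prod_marginal (R : comNzRingType) (J I A B : finType) (iota : I -> J)
    (g : J -> A -> R) (h : I -> A -> B) (phi : {ffun I -> B} -> R) :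
  injective iota ->
  \sum_(f : {ffun J -> A}) (\prod_j g j (f j)) * phi [ffun i => h i (f (iota i))]
  = (\prod_(j | j \notin codom iota) \sum_a g j a) *
    \sum_(y : {ffun I -> B}) phi y *
      \prod_i \sum_(a | h i a == y i) g (iota i) a.
Proof.
move=> iotaI.
pose H (f : {ffun J -> A}) := [ffun i => h i (f (iota i))].
rewrite (partition_big H xpredT)//= mulr_sumr; apply: eq_bigr => y _.
transitivity (phi y * \sum_(f : {ffun J -> A})
    \prod_j (g j (f j) * \prod_(i | iota i == j) (h i (f j) == y i)%:R)).
  rewrite mulr_sumr big_mkcond/=; apply: eq_bigr => f _.
  rewrite big_split/=.
  have -> : \prod_j \prod_(i | iota i == j) (h i (f j) == y i)%:R
      = (H f == y)%:R :> R.
    rewrite (exchange_big_dep xpredT)//=.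
    transitivity (\prod_i ((h i (f (iota i)) == y i)%:R : R)).
      apply: eq_bigr => i _.
      by under eq_bigl do rewrite eq_sym; rewrite big_pred1_eq.
    rewrite prod_indicator; congr ((nat_of_bool _)%:R).
    apply/idP/idP => [/forallP E|/eqP <-].
      by apply/eqP/ffunP => i; rewrite ffunE; apply/eqP.
    by apply/forallP => i; rewrite ffunE.
  by rewrite -/(H f); case: eqP => [->|_]; rewrite ?mulr1 ?mulr0// mulrC.
rewrite (sum_ffun_prod (fun j a => g j a * \prod_(i | iota i == j) (h i a == y i)%:R)).
rewrite mulrCA; congr (_ * _).
rewrite (bigID (mem (codom iota)))/= mulrC; congr (_ * _).
  apply: eq_bigr => j jI; apply: eq_bigr => a _.
  rewrite big_pred0 ?mulr1// => i.
  by apply/negbTE; apply: contraNneq jI => <-; exact: codom_f.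
have cu : uniq (codom iota) by rewrite (map_inj_uniq iotaI) enum_uniq.
rewrite -(big_uniq _ cu) big_image; apply: eq_bigr => i _.
rewrite [RHS]big_mkcond; apply: eq_bigr => a _.
rewrite (big_pred1 i) => [|i' /=]; last by rewrite (inj_eq iotaI) eq_sym.
by case: ifP => _; rewrite ?mulr1 ?mulr0.
Qed.

(** * Exponential moment bounds *)

Section Chernoff.
Variable R : realType.
Implicit Types (I A : finType).

(** Inverting [1 - x <= expR (- x)] gives [expR x <= (1 - x)^-1], and (1 + x + 2 x^2)(1 - x) - 1 =
    x^2 (1 - 2 x), whence the bound 1/2 on x. *)
Lemma expR_le_quadratic (x : R) : x <= 1 / 2 -> expR x <= 1 + x + 2 * x ^+ 2.
Proof.
move=> x2; have e1 : 1 - x <= expR (- x) by exact: expR_ge1Dx.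
have x1 : 0 < 1 - x by lra.
rewrite expRN in e1.
have : expR x <= (1 - x)^-1.
  by rewrite -[leLHS]invrK lef_pV2 ?posrE ?invr_gt0 ?expR_gt0.
move=> /le_trans; apply.
rewrite -[leLHS]mul1r ler_pdivrMr//.
have : 0 <= x ^+ 2 * (1 - 2 * x) by rewrite mulr_ge0 ?sqr_ge0//; lra.
nra.
Qed.

Lemma chernoff_prod I A (V f : I -> A -> R) :
  (forall i a, 0 <= V i a) ->
  \sum_(v : {ffun I -> A}) (\prod_i V i (v i)) * (0 <= \sum_i f i (v i))%R%:R
  <= \prod_i \sum_a V i a * expR (f i a).
Proof.
move=> V0.
rewrite -(sum_ffun_prod (fun i a => V i a * expR (f i a))).
apply: ler_sum => v _; rewrite big_split/= ler_wpM2l ?prodr_ge0// -expR_sum.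
by case: (leP 0 (\sum_i f i (v i))) => [h|_]; [rewrite -[leLHS]/(1 : R) -(@expR0 R) ler_expR|exact: expR_ge0].
Qed.

(** The tilt eta / (4 G^2) minimizes - s eta + 2 (s G)^2, with minimum - eta^2 / (8 G^2); [eta <= G]
    keeps the exponents in the range of [expR_le_quadratic]. *)
Lemma expectation_expR_le A (V f : A -> R) (G eta : R) :
  0 < eta -> (forall a, 0 <= V a) -> \sum_a V a = 1 ->
  (forall a, `|f a| <= G) -> eta <= G -> \sum_a V a * f a <= - eta ->
  \sum_a V a * expR (eta / (4 * G ^+ 2) * f a) <= expR (- (eta ^+ 2 / (8 * G ^+ 2))).
Proof.
move=> eta0 V0 V1 fG etaG Ef; set s := eta / _.
have G0 : 0 < G by apply: lt_le_trans etaG.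
have s0 : 0 < s by rewrite divr_gt0// mulr_gt0// exprn_gt0.
have sG : s * G <= 1 / 2.
  rewrite /s.
  have -> : eta / (4 * G ^+ 2) * G = eta / G / 4 by field; rewrite gt_eqF.
  have : eta / G <= 1 by rewrite ler_pdivrMr// mul1r.
  lra.
apply: (@le_trans _ _ (\sum_a V a * (1 + s * f a + 2 * (s * G) ^+ 2))).
  apply: ler_sum => a _; rewrite ler_wpM2l//.
  have sfG : `|s * f a| <= s * G by rewrite normrM (gtr0_norm s0) ler_pM2l.
  apply: (le_trans (expR_le_quadratic _)).
    by apply: le_trans sG; apply: le_trans sfG; exact: ler_norm.
  rewrite lerD2l ler_pM2l// -(real_normK (num_real (s * f a))).
  by rewrite lerXn2r ?nnegrE// mulr_ge0 ?ltW.
have -> : \sum_a V a * (1 + s * f a + 2 * (s * G) ^+ 2)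
    = 1 + s * (\sum_a V a * f a) + 2 * (s * G) ^+ 2.
  under eq_bigr do rewrite !mulrDr mulr1 mulrCA.
  by rewrite !big_split/= V1 -mulr_sumr -mulr_suml V1 mul1r.
apply: (le_trans _ (expR_ge1Dx _)).
rewrite -addrA lerD2l.
have : s * (\sum_a V a * f a) <= s * - eta by rewrite ler_pM2l.
have -> : s * - eta = - (2 * (eta ^+ 2 / (8 * G ^+ 2))).
  by rewrite /s; field; rewrite gt_eqF.
have -> : 2 * (s * G) ^+ 2 = eta ^+ 2 / (8 * G ^+ 2).
  by rewrite /s; field; rewrite gt_eqF.
lra.
Qed.

End Chernoff.

(** * The Gaussian tail function *)

Section GaussianQ.
Local Open Scope classical_set_scope.
Local Open Scope ring_scope.
Variable R : realType.
Notation mu := (@lebesgue_measure R).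

Definition gauss_pdf (x : R) : R := (Num.sqrt (2 * pi))^-1 * expR (- (x ^+ 2 / 2)).

Lemma normal_pdf01E : normal_pdf 0 1 = gauss_pdf :> (R -> R).
Proof.
apply/funext => x; rewrite normal_pdfE ?oner_neq0//= /normal_peak /normal_fun /gauss_pdf.
by rewrite expr1n mul1r -mulr_natl subr0 mulNr.
Qed.

Lemma gauss_pdf_gt0 x : 0 < gauss_pdf x.
Proof. by rewrite mulr_gt0 ?expR_gt0// invr_gt0 sqrtr_gt0 mulr_gt0// pi_gt0. Qed.

Lemma integrable_gauss_pdf : mu.-integrable setT (EFin \o gauss_pdf).
Proof. by rewrite -normal_pdf01E; exact: integrable_normal_pdf. Qed.

Let Phi (x : R) := \int[mu]_(t in `]-oo, x]) gauss_pdf t.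

(** The identity as a random variable under the normal law: its [cdf] is [Phi], so the limits of
    distribution functions at both infinities become available. *)
Let id_mfun : measurableTypeR R -> R := idfun.
#[local] HB.instance Definition _ :=
  @isMeasurableFun.Build _ _ _ _ id_mfun (@measurable_id _ _ setT).

Let cdfE x : cdf (id_mfun : {RV (normal_prob (0 : R) (1 : R)) >-> R}) x = (Phi x)%:E.
Proof.
rewrite /cdf /distribution /pushforward/= preimage_id /normal_prob normal_pdf01E.
rewrite /Phi /Rintegral fineK//.
apply: integrable_fin_num => //.
by apply: integrableS integrable_gauss_pdf.
Qed.

Let gaussianQE x : gaussianQ x = 1 - Phi x.
Proof.
have Ig (i : interval R) : mu.-integrable [set` i] (EFin \o gauss_pdf).
  by apply: integrableS integrable_gauss_pdf.
have c0 : (Num.sqrt (2 * pi))^-1 != 0 :> R.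
  by rewrite gt_eqF// invr_gt0 sqrtr_gt0 mulr_gt0// pi_gt0.
have -> : gaussianQ x = \int[mu]_(t in `[x, +oo[) gauss_pdf t.
  rewrite /gaussianQ; apply: (mulfI (invr_neq0 c0)); rewrite mulKf//.
  rewrite -RintegralZl//; apply: eq_Rintegral => t _.
  by rewrite /gauss_pdf mulKf.
have -> : 1 = \int[mu]_(t in `]-oo, +oo[) gauss_pdf t.
  by rewrite set_itvNyy /Rintegral -normal_pdf01E integral_normal_pdf.
rewrite (@Rintegral_itvB _ gauss_pdf -oo%O +oo%O x)//.
by rewrite Rintegral_itv_obnd_cbnd.
Qed.

Lemma continuous_gauss_pdf : continuous gauss_pdf.
Proof. by rewrite -normal_pdf01E; apply: continuous_normal_pdf; exact: oner_neq0. Qed.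

Lemma is_derive_gaussianQ (x : R) : is_derive x 1 (@gaussianQ R) (- gauss_pdf x).
Proof.
have xx : x < x + 1 by rewrite ltrDl.
have [||d1 d2] := @continuous_FTC1 R gauss_pdf -oo%O x (x + 1) xx _ _ (@continuous_gauss_pdf x).
- by apply: integrableS integrable_gauss_pdf.
- by rewrite ltNyr.
have -> : @gaussianQ R = (fun y => 1 - Phi y) by apply/funext => y; exact: gaussianQE.
have dPhi : is_derive x 1 Phi (gauss_pdf x).
  have d3 : 'D_1 Phi x = gauss_pdf x by rewrite -derive1E; exact: d2.
  exact: DeriveDef d1 d3.
by have := is_deriveB (is_derive_cst (1 : R) x 1) dPhi; rewrite sub0r.
Qed.

Lemma gaussianQ_small (e : R) : 0 < e -> exists2 L, 0 < L &
  gaussianQ L < e /\ 1 - e < gaussianQ (- L).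
Proof.
move=> e0.
have cdf_eq : cdf (id_mfun : {RV (normal_prob (0 : R) (1 : R)) >-> R}) = EFin \o Phi.
  by apply/funext => x; exact: cdfE.
have := cvg_cdfy1 (id_mfun : {RV (normal_prob (0 : R) (1 : R)) >-> R}).
rewrite cdf_eq => /fine_cvgP[_] /cvgrPdist_lt /(_ _ e0) [M1 [_ HM1]].
have := cvg_cdfNy0 (id_mfun : {RV (normal_prob (0 : R) (1 : R)) >-> R}).
rewrite cdf_eq => /fine_cvgP[_] /cvgrPdist_lt /(_ _ e0) [M2 [_ HM2]].
exists (`|M1| + `|M2| + 1); first by rewrite ltr_wpDl ?addr_ge0.
have l1 : M1 < `|M1| + `|M2| + 1.
  by have := ler_norm M1; have := normr_ge0 M2; lra.
have l2 : - (`|M1| + `|M2| + 1) < M2.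
  by have := ler_norm (- M2); rewrite normrN; have := normr_ge0 M1; lra.
have := HM1 _ l1; have := HM2 _ l2; rewrite !gaussianQE /= sub0r normrN.
move=> /ltr_normlP[? ?] /ltr_normlP[? ?]; split; lra.
Qed.

Lemma gaussianQ_ge0 (x : R) : 0 <= gaussianQ x.
Proof.
by rewrite mulr_ge0 ?invr_ge0 ?sqrtr_ge0// Rintegral_ge0// => t _; exact: expR_ge0.
Qed.

Lemma gaussianQ_le1 (x : R) : gaussianQ x <= 1.
Proof.
rewrite gaussianQE lerBlDr lerDl Rintegral_ge0// => t _.
exact/ltW/gauss_pdf_gt0.
Qed.

(** The density is even, so Q(-y) + Q(y) has derivative zero; the constant is found by letting y
    grow. *)
Lemma gaussianQN (x : R) : gaussianQ (- x) = 1 - gaussianQ x.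
Proof.
pose f y := gaussianQ (- y) + @gaussianQ R y.
have df (y : R) : is_derive y 1 f 0.
  have d1 := is_derive_gaussianQ y.
  have d3 : is_derive y 1 (@gaussianQ R \o -%R) (gauss_pdf (- y)).
    have d2 := is_derive_gaussianQ (- y).
    have := is_derive1_comp d2 (is_deriveN (is_derive_id y 1)).
    by rewrite mulrN1 opprK.
  have := is_deriveD d3 d1.
  by rewrite /gauss_pdf sqrrN subrr.
apply/eqP; rewrite eq_sym subr_eq -/(f x); apply/eqP.
apply/eqP; rewrite eq_le; apply/andP; split; apply/ler_addgt0Pr => e e0;
  have [L L0 [QL QNL]] := gaussianQ_small e0;
  rewrite (is_derive_0_is_cst x L df) /f;
  have := gaussianQ_ge0 L; have := gaussianQ_le1 (- L); lra.
Qed.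

End GaussianQ.

(** * Increments of a Beta distribution function against a Gaussian *)

Section BetaShift.
Variable R : realType.

Lemma mvt_oo (F f : R -> R) (a b : R) : a < b ->
  (forall x, a <= x <= b -> is_derive x 1 F (f x)) ->
  exists2 c, a < c < b & F b - F a = f c * (b - a).
Proof.
move=> ab dF; have [||c] := @MVT R F f a b ab.
- by move=> x; rewrite in_itv/= => /andP[ax xb]; apply: dF; rewrite !ltW.
- apply: derivable_within_continuous => x; rewrite in_itv/= => xab.
  by apply: ex_derive; exact: dF.
by rewrite in_itv/=; exists c.
Qed.

(** Monotonicity of the integral in terms of antiderivatives; this way the comparisons of Beta and
    Gaussian masses below need no integration. *)
Lemma le_derive_increment (F f H h : R -> R) (a b : R) : a <= b ->
  (forall x, a <= x <= b -> is_derive x 1 F (f x)) ->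
  (forall x, a <= x <= b -> is_derive x 1 H (h x)) ->
  (forall x, a <= x <= b -> f x <= h x) -> F b - F a <= H b - H a.
Proof.
rewrite le_eqVlt => /predU1P[->|ab] dF dH fh; first by rewrite !subrr.
have [|c /andP[ac cb]] := @mvt_oo (H \- F) (h \- f) a b ab.
  by move=> x xab; apply: is_deriveB; [exact: dH|exact: dF].
rewrite /= => E.
have : 0 <= (h c - f c) * (b - a).
  by rewrite mulr_ge0 ?subr_ge0 ?fh ?ltW// ac cb.
by rewrite -E; lra.
Qed.

Lemma gaussianQ_anti (x y : R) : x <= y -> gaussianQ y <= gaussianQ x.
Proof.
move=> xy; have := @le_derive_increment (cst 0) (cst 0) (fun z => - gaussianQ z) (@gauss_pdf R) x y xy.
move=> /(_ _ _ _)/= H; rewrite -lerN2 -subr_ge0.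
rewrite [leLHS](_ : 0 = (0 : R) - 0); last by rewrite subr0.
apply: H => z _.
- by have := is_deriveN (is_derive_gaussianQ z); rewrite opprK.
- exact/ltW/gauss_pdf_gt0.
Qed.

Lemma gaussianQ_lt (x y : R) : x < y -> gaussianQ y < gaussianQ x.
Proof.
move=> xy; have [|c _ E] := @mvt_oo (@gaussianQ R) (fun z => - gauss_pdf z) x y xy.
  by move=> z _; exact: is_derive_gaussianQ.
by rewrite -subr_lt0 E mulNr oppr_lt0 mulr_gt0 ?gauss_pdf_gt0// subr_gt0.
Qed.

(* Among the intervals of length [2 h], the one centred at the origin has the
   largest Gaussian mass. *)
Lemma gaussianQ_increment (x h : R) : 0 <= h ->
  gaussianQ x - gaussianQ (x + 2 * h) <= 1 - 2 * gaussianQ h.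
Proof.
move=> h0.
suff H y : - h <= y -> gaussianQ y - gaussianQ (y + 2 * h) <= 1 - 2 * gaussianQ h.
  have [/H//|xh] := leP (- h) x.
  have hh : - h <= - (x + 2 * h) by lra.
  have := H _ hh; rewrite (_ : - (x + 2 * h) + 2 * h = - x); last by ring.
  rewrite !gaussianQN; lra.
move=> hy.
pose F z := gaussianQ z - gaussianQ (z + 2 * h).
have E : F (- h) = 1 - 2 * gaussianQ h.
  rewrite /F gaussianQN (_ : - h + 2 * h = h); last by ring.
  ring.
rewrite -E -/(F y) -subr_le0.
pose f z := gauss_pdf (z + 2 * h) - gauss_pdf z.
rewrite [leRHS](_ : 0 = (0 : R) - 0); last by rewrite subr0.
apply: (@le_derive_increment F f (cst 0) (cst 0) (- h) y hy).
- move=> z _.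
  have d1 := is_derive_gaussianQ z.
  have d2 : is_derive z 1 (@gaussianQ R \o (fun z => z + 2 * h)) (- gauss_pdf (z + 2 * h)).
    have d : is_derive z (1 : R) (fun z => z + 2 * h) 1.
      by have := is_deriveD (is_derive_id z (1 : R)) (is_derive_cst (2 * h) z 1); rewrite addr0.
    have := @is_derive1_comp R _ (fun z => z + 2 * h) z _ _ (is_derive_gaussianQ (z + 2 * h)) d.
    by rewrite mulr1.
  by apply: (is_derive_eq (is_deriveB d1 d2)); rewrite opprK [LHS]addrC.
- move=> z /andP[hz _]; rewrite /f subr_le0 ler_pM2l; last first.
    by rewrite invr_gt0 sqrtr_gt0 mulr_gt0// pi_gt0.
  rewrite ler_expR lerN2 ler_pM2r ?invr_gt0//.
  rewrite -subr_ge0 (_ : _ - _ = 4 * h * (z + h)); last by ring.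
  by rewrite mulr_ge0//; lra.
Qed.

(** Unnormalized Beta density with mode a / (a + b), called [u0] below; up to a constant it is the
    derivative of a binomial tail in its success probability. *)
Definition beta_kernel (a b : nat) (u : R) : R := u ^+ a * (1 - u) ^+ b.

Lemma beta_kernel_ge0 a b u : 0 <= u <= 1 -> 0 <= beta_kernel a b u.
Proof. by move=> /andP[u0 u1]; rewrite mulr_ge0 ?exprn_ge0// subr_ge0. Qed.

Lemma beta_kernelE a b u : 0 < u < 1 ->
  beta_kernel a b u = expR (a%:R * ln u + b%:R * ln (1 - u)).
Proof.
move=> /andP[u0 u1].
by rewrite expRD !expRM_natl !lnK ?posrE ?subr_gt0.
Qed.

(** Logarithm of the ratio between the Beta kernel and the Gaussian exp(- k (u - u0)^2 / 2). Its
    derivative factors, so the comparison is decided by k against (a + b) / (u (1 - u)) and by the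
    side of the mode. *)
Lemma is_derive_ln_beta a b (u0 k u : R) : 0 < u < 1 -> a%:R = (a + b)%:R * u0 ->
  is_derive u 1 (fun u => a%:R * ln u + b%:R * ln (1 - u) + k * (u - u0) ^+ 2 / 2)
    ((u - u0) * (k - (a + b)%:R / (u * (1 - u)))).
Proof.
move=> /andP[u_gt0 u1] au0.
have u'0 : 0 < 1 - u by rewrite subr_gt0.
have dl1 := is_derive1_ln u_gt0.
have dl2 : is_derive u 1 (@ln R \o (fun u => 1 - u)) (- (1 - u)^-1).
  have d : is_derive u (1 : R) (fun u => 1 - u) (- 1).
    by have := is_deriveB (is_derive_cst (1 : R) u 1) (is_derive_id u (1 : R)); rewrite sub0r.
  have := @is_derive1_comp R _ (fun u => 1 - u) u _ _ (is_derive1_ln u'0) d.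
  by rewrite mulrN1.
have dl3 : is_derive u 1 (fun u => (u - u0) ^+ 2) ((u - u0) *+ 2).
  have d : is_derive u (1 : R) (fun u => u - u0) 1.
    by have := is_deriveB (is_derive_id u (1 : R)) (is_derive_cst u0 u (1 : R)); rewrite subr0.
  apply: (is_derive_eq (is_deriveX 2 d)).
  by rewrite expr1 /GRing.scale/= mulr1 mulr_natl.
have := is_deriveD (is_deriveD (is_deriveZ a%:R dl1) (is_deriveZ b%:R dl2))
   (is_deriveZ (k / 2) dl3).
have -> : (a%:R \*: @ln R + b%:R \*: (@ln R \o (fun u => 1 - u)) +
   (k / 2) \*: (fun u => (u - u0) ^+ 2))%R =
   (fun u => a%:R * ln u + b%:R * ln (1 - u) + k * (u - u0) ^+ 2 / 2).
  by apply/funext => z /=; rewrite /GRing.scale/= mulrAC.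
move=> H; apply: (is_derive_eq H); rewrite /GRing.scale/=.
have bE : b%:R = (a + b)%:R * (1 - u0) by rewrite natrD in au0 *; lra.
rewrite bE au0; field.
by rewrite !gt_eqF.
Qed.

End BetaShift.

Section BetaShiftMain.
Variable R : realType.

Lemma ln_beta_le a b (u0 k u v : R) : 0 < u < 1 -> 0 < v < 1 ->
  a%:R = (a + b)%:R * u0 ->
  (forall c, u < c < v \/ v < c < u ->
    (v - u) * (c - u0) * (k - (a + b)%:R / (c * (1 - c))) <= 0) ->
  a%:R * ln v + b%:R * ln (1 - v) + k * (v - u0) ^+ 2 / 2 <=
  a%:R * ln u + b%:R * ln (1 - u) + k * (u - u0) ^+ 2 / 2.
Proof.
move=> u01 v01 au0 H.
pose psi u := a%:R * ln u + b%:R * ln (1 - u) + k * (u - u0) ^+ 2 / 2.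
rewrite -/(psi u) -/(psi v) -subr_le0.
have dpsi (w : R) : 0 < w < 1 -> is_derive w 1 psi _ := fun w01 => is_derive_ln_beta k w01 au0.
have [uv|vu|->] := ltgtP u v; last by rewrite subrr.
- have [|c cuv ->] := mvt_oo uv (F := psi) (f := fun w => (w - u0) * (k - (a + b)%:R / (w * (1 - w)))).
    by move=> w uwv; apply: dpsi; lra.
  by rewrite mulrC mulrA; apply: H; left.
- have [|c cuv E] := mvt_oo vu (F := psi) (f := fun w => (w - u0) * (k - (a + b)%:R / (w * (1 - w)))).
    by move=> w uwv; apply: dpsi; lra.
  by rewrite -opprB E -mulrN opprB mulrC mulrA; apply: H; right.
Qed.

Lemma beta_kernel_le a b (u0 k u v : R) : 0 < u < 1 -> 0 < v < 1 ->
  a%:R = (a + b)%:R * u0 ->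
  (forall c, u < c < v \/ v < c < u ->
    (v - u) * (c - u0) * (k - (a + b)%:R / (c * (1 - c))) <= 0) ->
  beta_kernel a b v * expR (k * (v - u0) ^+ 2 / 2) <=
  beta_kernel a b u * expR (k * (u - u0) ^+ 2 / 2).
Proof.
by move=> u01 v01 au0 H; rewrite !beta_kernelE// -!expRD ler_expR (ln_beta_le _ _ au0).
Qed.

(** Unimodality: the case [k = 0] of the Gaussian comparison. *)
Lemma beta_kernel_le_mode a b (u0 u v : R) : 0 < u < 1 -> 0 < v < 1 ->
  a%:R = (a + b)%:R * u0 -> v <= u <= u0 \/ u0 <= u <= v ->
  beta_kernel a b v <= beta_kernel a b u.
Proof.
move=> u01 v01 au0 H.
have := @beta_kernel_le a b u0 0 u v u01 v01 au0.
rewrite !mul0r expR0 !mulr1; apply => c cuv; rewrite sub0r mulrN oppr_le0.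
apply: mulr_ge0; first by case: H => ?; case: cuv => ?; nra.
by rewrite divr_ge0// mulr_ge0//; case: cuv => ?; lra.
Qed.

Lemma is_derive_gaussianQ_affine (k u0 u : R) :
  is_derive u 1 (fun u => - gaussianQ (k * (u - u0))) (k * gauss_pdf (k * (u - u0))).
Proof.
have d : is_derive u (1 : R) (fun u => k * (u - u0)) k.
  have := is_deriveZ k (is_deriveB (is_derive_id u (1 : R)) (is_derive_cst u0 u (1 : R))).
  by move=> H; apply: (is_derive_eq H); rewrite subr0 /GRing.scale/= mulr1.
have := is_deriveN (@is_derive1_comp R _ _ u _ _ (is_derive_gaussianQ (k * (u - u0))) d).
by move=> H; apply: (is_derive_eq H); rewrite mulNr opprK mulrC.
Qed.

(** If the mode is further than [g] from the interval, the density between interval and mode is at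
    least that on the interval; as it has mass at most 1 over a length at least [g], the density on
    the interval is at most 1 / g. *)
Lemma beta_increment_far a b (u0 K q q' g : R) (G : R -> R) :
  0 <= K -> a%:R = (a + b)%:R * u0 -> 0 < q -> q < q' -> q' < 1 -> 0 < g ->
  (forall u : R, is_derive u 1 G (K * beta_kernel a b u)) ->
  (forall u, 0 <= u <= 1 -> 0 <= G u <= 1) ->
  q' + g < u0 <= 1 \/ 0 <= u0 < q - g -> G q' - G q <= (q' - q) / g.
Proof.
move=> K0 au0 q0 qq' q'1 g0 dG G01 far.
have [c /andP[c1 c2] Ec] := mvt_oo qq' (fun u _ => dG u).
have Kb u v : 0 < u < 1 -> 0 < v < 1 -> v <= u <= u0 \/ u0 <= u <= v ->
    K * beta_kernel a b v <= K * beta_kernel a b u.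
  by move=> u01 v01 uv; rewrite ler_wpM2l// (beta_kernel_le_mode _ _ au0).
have [Kq Kq0 Kcq] : exists2 k, K * beta_kernel a b c <= k & k * g <= 1.
  case: far => [/andP[f1 f2]|/andP[f1 f2]].
  - have u0q : q' < u0 by lra.
    have [c' /andP[c3 c4] Ec'] := mvt_oo u0q (fun u _ => dG u).
    have k0 : 0 <= K * beta_kernel a b c'.
      by rewrite mulr_ge0// beta_kernel_ge0//; apply/andP; split; lra.
    exists (K * beta_kernel a b c'); first by apply: Kb; [lra|lra|left; lra].
    apply: (@le_trans _ _ (G u0 - G q')); first by rewrite Ec' ler_wpM2l//; lra.
    have /andP[h1 h2] : 0 <= G u0 <= 1 by apply: G01; lra.
    have /andP[h3 h4] : 0 <= G q' <= 1 by apply: G01; lra.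
    lra.
  - have u0q : u0 < q by lra.
    have [c' /andP[c3 c4] Ec'] := mvt_oo u0q (fun u _ => dG u).
    have k0 : 0 <= K * beta_kernel a b c'.
      by rewrite mulr_ge0// beta_kernel_ge0//; apply/andP; split; lra.
    exists (K * beta_kernel a b c'); first by apply: Kb; [lra|lra|right; lra].
    apply: (@le_trans _ _ (G q - G u0)); first by rewrite Ec' ler_wpM2l//; lra.
    have /andP[h1 h2] : 0 <= G u0 <= 1 by apply: G01; lra.
    have /andP[h3 h4] : 0 <= G q <= 1 by apply: G01; lra.
    lra.
rewrite ler_pdivlMr// Ec mulrAC.
apply: (@le_trans _ _ (Kq * g * (q' - q))).
  apply: ler_wpM2r; first by rewrite subr_ge0 ltW.
  by rewrite ler_wpM2r// ltW.
by rewrite ler_piMl// subr_ge0 ltW.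
Qed.

Let sqrt2pi : R := Num.sqrt (2 * pi).

Let gauss_antideriv (C k u0 u : R) : k != 0 ->
  is_derive u 1 (fun u => C * sqrt2pi / k * - gaussianQ (k * (u - u0)))
    (C * expR (- (k ^+ 2 * (u - u0) ^+ 2 / 2))).
Proof.
move=> k0.
have H := is_deriveZ (C * sqrt2pi / k) (is_derive_gaussianQ_affine k u0 u).
apply: (is_derive_eq H); rewrite /gauss_pdf -/sqrt2pi exprMn; set ee := expR _.
have r0 : sqrt2pi != 0 by rewrite gt_eqF// sqrtr_gt0 mulr_gt0// pi_gt0.
by rewrite /GRing.scale/=; move: sqrt2pi r0 => r r0; field; rewrite ?k0 ?r0.
Qed.

(** Where the curvature is at least [k ^+ 2], the density lies below a Gaussian of the same peak; by
    [gaussianQ_increment] the interval may then be centred at the mode. *)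
Lemma beta_increment_upper a b (u0 K k q q' : R) (G : R -> R) :
  0 <= K -> 0 < k -> a%:R = (a + b)%:R * u0 -> 0 < u0 < 1 -> 0 < q -> q <= q' -> q' < 1 ->
  (forall u : R, is_derive u 1 G (K * beta_kernel a b u)) ->
  (forall c, Num.min q u0 <= c <= Num.max q' u0 -> k ^+ 2 <= (a + b)%:R / (c * (1 - c))) ->
  G q' - G q <= K * beta_kernel a b u0 * sqrt2pi / k * (1 - 2 * gaussianQ (k * ((q' - q) / 2))).
Proof.
move=> K0 k0 au0 u01 q0 qq' q'1 dG Hk.
have k0' : k != 0 by rewrite gt_eqF.
have H := @le_derive_increment R G _ _ _ q q' qq' (fun u _ => dG u)
  (fun u _ => gauss_antideriv (K * beta_kernel a b u0) u0 u k0').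
apply: (le_trans (H _)).
  move=> u /andP[qu uq']; rewrite -mulrA ler_wpM2l// expRN ler_pdivlMr ?expR_gt0//.
  have u_01 : 0 < u < 1 by apply/andP; split; [apply: lt_le_trans qu|apply: le_lt_trans q'1].
  have := beta_kernel_le (k := k ^+ 2) u01 u_01 au0.
  rewrite subrr expr0n/= mulr0 mul0r expR0 mulr1; apply => c cuv.
  apply: mulr_ge0_le0; first by clear - cuv; case: cuv => ?; nra.
  rewrite subr_le0; apply: Hk; rewrite ge_min le_max.
  by clear - cuv qu uq'; apply/andP; split; apply/orP; case: cuv => ?; [right|left|left|right]; lra.
rewrite -mulrBr ler_wpM2l//.
  rewrite divr_ge0 ?(ltW k0)// mulr_ge0 ?sqrtr_ge0// mulr_ge0// beta_kernel_ge0//.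
  by move: u01 => /andP[/ltW-> /ltW->].
have hd : 0 <= k * ((q' - q) / 2) by rewrite mulr_ge0 ?(ltW k0)// divr_ge0// subr_ge0.
have := gaussianQ_increment (k * (q - u0)) hd.
rewrite (_ : k * (q - u0) + 2 * (k * ((q' - q) / 2)) = k * (q' - u0)); last by field.
by rewrite opprK addrC.
Qed.

(** The reverse comparison near the mode. Since the mass is at most 1, it bounds the peak height
    from above, which replaces Stirling's formula. *)
Lemma beta_increment_lower a b (u0 K k w : R) (G : R -> R) :
  0 <= K -> 0 < k -> a%:R = (a + b)%:R * u0 -> 0 <= w -> 0 < u0 - w -> u0 + w < 1 ->
  (forall u : R, is_derive u 1 G (K * beta_kernel a b u)) ->
  (forall c, u0 - w <= c <= u0 + w -> (a + b)%:R / (c * (1 - c)) <= k ^+ 2) ->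
  K * beta_kernel a b u0 * sqrt2pi / k * (1 - 2 * gaussianQ (k * w)) <= G (u0 + w) - G (u0 - w).
Proof.
move=> K0 k0 au0 w0 u0w u0w1 dG Hk.
have k0' : k != 0 by rewrite gt_eqF.
have ww : u0 - w <= u0 + w by lra.
have u01 : 0 < u0 < 1 by lra.
have H := @le_derive_increment R _ _ G _ (u0 - w) (u0 + w) ww
  (fun u _ => gauss_antideriv (K * beta_kernel a b u0) u0 u k0') (fun u _ => dG u).
apply: le_trans (H _).
  rewrite -mulrBr [_ - w - _]addrC addKr [_ + w - _]addrC addKr mulrN gaussianQN.
  by rewrite (_ : - _ - _ = 1 - 2 * gaussianQ (k * w))//; ring.
move=> u uw; rewrite -mulrA ler_wpM2l// expRN ler_pdivrMr ?expR_gt0//.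
have u_01 : 0 < u < 1 by lra.
have := beta_kernel_le (k := k ^+ 2) u_01 u01 au0.
rewrite subrr expr0n/= mulr0 mul0r expR0 mulr1; apply => c cuv.
apply: mulr_le0_ge0; first by clear - cuv; case: cuv => ?; nra.
rewrite subr_ge0; apply: Hk.
by clear - cuv uw; case: cuv => ?; lra.
Qed.

(* Variance of a coordinate near the one of Bern(q). *)
Lemma bernoulli_var_window (q d c : R) : 0 < q < 1 -> 0 < d <= 1 / 4 ->
  `|c - q| <= d * (q * (1 - q)) ->
  [/\ 0 < c < 1, (1 - d) ^+ 2 * (c * (1 - c)) <= q * (1 - q) &
    q * (1 - q) <= (1 + d) ^+ 2 * (c * (1 - c))].
Proof.
move=> /andP[q0 q1] /andP[d0 d14]; have : 0 < q * (1 - q) by rewrite mulr_gt0 ?subr_gt0.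
have vq : q * (1 - q) <= q /\ q * (1 - q) <= 1 - q by split; nra.
have E : c * (1 - c) - q * (1 - q) = (c - q) * (1 - c - q) by ring.
move: vq E; set v := q * (1 - q) => -[vq1 vq2] E v0.
rewrite ler_norml => /andP[c1 c2].
have c0 : 0 < c by nra.
have c'0 : c < 1 by nra.
have u1 : c * (1 - c) <= v + d * v by have : (c - q) * (1 - c - q) <= d * v; [nra|lra].
have u2 : v - d * v <= c * (1 - c) by have : - (d * v) <= (c - q) * (1 - c - q); [nra|lra].
split; first by rewrite c0.
- have : (1 - d) ^+ 2 * (c * (1 - c)) <= (1 - d) ^+ 2 * (v + d * v) by rewrite ler_wpM2l ?sqr_ge0.
  move=> /le_trans; apply; rewrite -[leRHS]mul1r.
  rewrite (_ : _ * (v + _) = (1 - d) ^+ 2 * (1 + d) * v); last by ring.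
  by rewrite ler_pM2r//; clear - d0 d14; nra.
- have : (1 + d) ^+ 2 * (v - d * v) <= (1 + d) ^+ 2 * (c * (1 - c)) by rewrite ler_wpM2l ?sqr_ge0.
  apply: le_trans; rewrite -[leLHS]mul1r.
  rewrite (_ : _ * (v - _) = (1 + d * (1 - d - d ^+ 2)) * v); last by ring.
  by rewrite ler_pM2r// lerDl mulr_ge0 ?ltW//; clear - d0 d14; nra.
Qed.

(** The interval spans 2 h standard deviations of the Beta law at q, so its mass is asymptotically
    at most 1 - 2 Q(h); the margin from h to x absorbs the errors uniformly in a and b. A far mode
    is handled by [beta_increment_far]. A near one makes the curvature nearly constant, and
    [beta_increment_upper] is combined with the peak height obtained from [beta_increment_lower]. *)
Lemma beta_shift (q h x : R) : 0 < q < 1 -> 0 < h -> h < x -> exists2 M, 0 < M &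
  forall (nu : R) (a b : nat) (K : R) (G : R -> R), M <= nu ->
  (a + b)%:R = nu ^+ 2 -> 0 <= K ->
  (forall u : R, is_derive u 1 G (K * beta_kernel a b u)) ->
  (forall u, 0 <= u <= 1 -> 0 <= G u <= 1) ->
  G (q + 2 * h * Num.sqrt (q * (1 - q)) / nu) - G q <= 1 - 2 * gaussianQ x.
Proof.
move=> q01 h0 hx; have /andP[q0 q1] := q01.
have v0 : 0 < q * (1 - q) by rewrite mulr_gt0 ?subr_gt0.
have [s s0 [s2 ->]] : exists2 s, 0 < s & s ^+ 2 = q * (1 - q) /\ Num.sqrt (q * (1 - q)) = s.
  by exists (Num.sqrt (q * (1 - q))); rewrite ?sqrtr_gt0// sqr_sqrtr// ltW.
have Q0 : gaussianQ (0 : R) = 1 / 2 by have := gaussianQN (0 : R); rewrite oppr0; lra.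
have [t0 t0E] : exists t, t = 1 - 2 * gaussianQ h by eexists.
have [e0 e0E] : exists e, e = 1 - 2 * gaussianQ x by eexists.
have t0_gt0 : 0 < t0 by have := gaussianQ_lt h0; rewrite Q0 t0E; lra.
have te : t0 < e0 by have := gaussianQ_lt hx; rewrite t0E e0E; lra.
have e00 : 0 < e0 by exact: lt_trans te.
(* [d] measures the relative room between the two Gaussian masses; it pays for the distortion of the
   curvature by (1 - d)^2 and (1 + d)^2 and for the mass beyond [L]. *)
have [d [d0 d14 tE]] : exists d, [/\ 0 < d, d <= 1 / 4 & t0 = (1 - 4 * d) * e0].
  have g1 : t0 / e0 < 1 by rewrite ltr_pdivrMr// mul1r.
  have g0 : 0 < t0 / e0 by rewrite divr_gt0.
  exists ((1 - t0 / e0) / 4); split; [lra|lra|].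
  by field; rewrite gt_eqF.
have [L L0 [QL _]] := gaussianQ_small d0.
have ratio : (1 + d) * t0 <= (1 - d) * (1 - 2 * gaussianQ L) * e0.
  have h1 : (1 + d) * (1 - 4 * d) <= (1 - d) * (1 - 2 * d) by nra.
  have h2 : (1 - d) * (1 - 2 * d) <= (1 - d) * (1 - 2 * gaussianQ L).
    by rewrite ler_wpM2l//; lra.
  rewrite tE mulrA ler_pM2r//; exact: le_trans h2.
have d14' : 0 < d <= 1 / 4 by rewrite d0.
have win c := @bernoulli_var_window q d c q01 d14'.
rewrite -s2 in win.
have [eta eta0 etaE] : exists2 eta, 0 < eta & eta = d * s ^+ 2.
  by exists (d * s ^+ 2) => //; rewrite mulr_gt0// exprn_gt0.
rewrite -etaE in win.
have hs0 : 0 < 2 * h * s by rewrite mulr_gt0// mulr_gt0.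
have Ls0 : 0 < L * s by rewrite mulr_gt0.
have B0 : 0 < 2 * h * s / e0 by rewrite divr_gt0.
(* From this [nu] on, the gap [g], the interval length [dl] and the half-window [w], all of order 1
   / nu, fit together into the window of radius [eta] about q on which the curvature is
   controlled. *)
exists ((2 * h * s / e0 + 2 * h * s + L * s) / eta).
  by rewrite divr_gt0// addr_gt0// addr_gt0.
move=> nu a b K G Mnu abE K0 dG G01.
have nu0 : 0 < nu by apply: lt_le_trans Mnu; rewrite divr_gt0// addr_gt0// addr_gt0.
have {}Mnu : 2 * h * s / e0 / nu + 2 * h * s / nu + L * s / nu <= eta.
  by rewrite ler_pdivrMr// in Mnu; rewrite -!mulrDl ler_pdivrMr// [leRHS]mulrC.
have [dl dlE dl0] : exists2 dl, dl = 2 * h * s / nu & 0 < dl.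
  by exists (2 * h * s / nu) => //; rewrite divr_gt0.
(* With this gap the bound [dl / g] for a far mode is exactly the target [e0]. *)
have [g gE g0] : exists2 g, g = 2 * h * s / e0 / nu & 0 < g.
  by exists (2 * h * s / e0 / nu) => //; rewrite divr_gt0.
have [w wE w0] : exists2 w, w = L * s / nu & 0 < w.
  by exists (L * s / nu) => //; rewrite divr_gt0.
rewrite -dlE -gE -wE in Mnu *.
have dlg : dl / g = e0 by rewrite dlE gE; field; rewrite !gt_eqF.
have N0 : 0 < (a + b)%:R :> R by rewrite abE exprn_gt0.
have [u0 [au0 u0_ge0 u0_le1]] : exists u0 : R, [/\ a%:R = (a + b)%:R * u0, 0 <= u0 & u0 <= 1].
  exists (a%:R / (a + b)%:R); split; first by rewrite mulrC divfK// gt_eqF.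
    by rewrite divr_ge0.
  by rewrite ler_pdivrMr// mul1r ler_nat leq_addr.
have {}win c : q - eta <= c <= q + eta -> [/\ 0 < c < 1, (1 - d) ^+ 2 * (c * (1 - c)) <= s ^+ 2 &
    s ^+ 2 <= (1 + d) ^+ 2 * (c * (1 - c))].
  by move=> cw; apply: win; rewrite ler_norml; clear - cw; lra.
have qq' : q < q + dl by rewrite ltrDl.
have q'1 : q + dl < 1.
  have [|/andP[_ //] _ _] := win (q + dl).
  by clear - Mnu dl0 g0 w0; lra.
have far : q + dl + g < u0 <= 1 \/ 0 <= u0 < q - g -> G (q + dl) - G q <= 1 - 2 * gaussianQ x.
  move=> /(beta_increment_far K0 au0 q0 qq' q'1 g0 dG G01).
  by rewrite [q + dl]addrC addrK dlg e0E.
have [far1|near1] := ltP (q + dl + g) u0.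
  by apply: far; left; rewrite far1.
have [far2|near2] := ltP u0 (q - g).
  by apply: far; right; rewrite u0_ge0.
rewrite -e0E.
have k1 : 0 < 1 + d by clear - d0; lra.
have k2 : 0 < 1 - d by clear - d14; lra.
have ns0 : 0 < nu / s by rewrite divr_gt0.
have kpos k : 0 < k -> 0 < k * (nu / s) by move=> ?; rewrite mulr_gt0.
have ksq k c : 0 < c < 1 -> (k * (nu / s)) ^+ 2 - (a + b)%:R / (c * (1 - c)) =
    (k ^+ 2 * (c * (1 - c)) - s ^+ 2) * (nu ^+ 2 / (s ^+ 2 * (c * (1 - c)))).
  move=> /andP[c0 c1]; rewrite abE; field.
  by rewrite !gt_eqF// subr_gt0.
have ksq0 c : 0 < c < 1 -> 0 <= nu ^+ 2 / (s ^+ 2 * (c * (1 - c))).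
  by move=> /andP[/ltW c0 /ltW c1]; rewrite divr_ge0 ?sqr_ge0// mulr_ge0 ?sqr_ge0// mulr_ge0 ?subr_ge0.
have [u0win _ _] : [/\ 0 < u0 < 1, (1 - d) ^+ 2 * (u0 * (1 - u0)) <= s ^+ 2 &
    s ^+ 2 <= (1 + d) ^+ 2 * (u0 * (1 - u0))].
  by apply: win; clear - near1 near2 Mnu g0 dl0 w0; lra.
have up := beta_increment_upper K0 (kpos _ k2) au0 u0win q0 (ltW qq') q'1 dG.
have down := beta_increment_lower K0 (kpos _ k1) au0 (ltW w0) _ _ dG.
have {}up : G (q + dl) - G q <= K * beta_kernel a b u0 * sqrt2pi / ((1 - d) * (nu / s)) * t0.
  apply: (le_trans (up _)).
    move=> c cq; rewrite -subr_le0.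
    have [|c01 h1 _] := win c.
      move: cq; rewrite ge_min le_max => /andP[/orP c1 /orP c2].
      by clear - c1 c2 near1 near2 Mnu g0 dl0 w0; case: c1 => ?; case: c2 => ?; lra.
    by rewrite ksq// mulr_le0_ge0 ?ksq0// subr_le0.
  rewrite ler_wpM2l//.
    rewrite divr_ge0// ?(ltW (kpos _ k2))// mulr_ge0 ?sqrtr_ge0// mulr_ge0// beta_kernel_ge0//.
    by move: u0win => /andP[/ltW-> /ltW->].
  rewrite t0E [q + dl]addrC addrK.
  have -> : (1 - d) * (nu / s) * (dl / 2) = (1 - d) * h by rewrite dlE; field; rewrite !gt_eqF.
  have : gaussianQ h <= gaussianQ ((1 - d) * h).
    by apply: gaussianQ_anti; rewrite ler_piMl ?(ltW h0)//; clear - d0; lra.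
  by clear; lra.
have uw1 : q - eta <= u0 - w by clear - near2 Mnu g0 dl0 w0; lra.
have uw2 : u0 + w <= q + eta by clear - near1 Mnu g0 dl0 w0; lra.
have ww : u0 - w <= u0 + w by clear - w0; lra.
(* The mass of the window of radius [w] about the mode is at most 1: this bounds the peak height in
   [up]. *)
have {}down : K * beta_kernel a b u0 * sqrt2pi / ((1 + d) * (nu / s)) * (1 - 2 * gaussianQ L) <= 1.
  have [|/andP[l1 l2] _ _] := win (u0 - w); first by rewrite uw1/= (le_trans ww).
  have [|/andP[l3 l4] _ _] := win (u0 + w); first by rewrite uw2 (le_trans _ ww).
  apply: (@le_trans _ _ (G (u0 + w) - G (u0 - w))); last first.
    have /andP[g1 g2] : 0 <= G (u0 + w) <= 1 by apply: G01; rewrite !ltW.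
    have /andP[g3 g4] : 0 <= G (u0 - w) <= 1 by apply: G01; rewrite !ltW.
    by clear - g1 g2 g3 g4; lra.
  apply: le_trans (down l1 l4 _).
    rewrite ler_wpM2l//.
      rewrite divr_ge0// ?(ltW (kpos _ k1))// mulr_ge0 ?sqrtr_ge0// mulr_ge0// beta_kernel_ge0//.
      by move: u0win => /andP[/ltW-> /ltW->].
    have -> : (1 + d) * (nu / s) * w = (1 + d) * L by rewrite wE; field; rewrite !gt_eqF.
    have : gaussianQ ((1 + d) * L) <= gaussianQ L.
      by apply: gaussianQ_anti; rewrite ler_peMl ?(ltW L0)//; clear - d0; lra.
    by clear; lra.
  move=> c /andP[cw1 cw2]; rewrite -subr_ge0.
  have [|c01 _ h1] := win c; first by rewrite (le_trans uw1 cw1) (le_trans cw2 uw2).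
  by rewrite ksq// mulr_ge0 ?ksq0// subr_ge0.
apply: (le_trans up).
have kE (X k : R) : X / (k * (nu / s)) = X / (nu / s) / k by rewrite invfM mulrA mulrAC.
have [y y0 yE] : exists2 y, 0 <= y & K * beta_kernel a b u0 * sqrt2pi / (nu / s) = y.
  eexists; last by [].
  rewrite divr_ge0// ?(ltW ns0)// mulr_ge0 ?sqrtr_ge0// mulr_ge0// beta_kernel_ge0//.
  by move: u0win => /andP[/ltW-> /ltW->].
move: down; rewrite !kE yE mulrAC ler_pdivrMr// mul1r mulrAC ler_pdivrMr// => down.
have h1 : y * ((1 + d) * t0) <= y * ((1 - d) * (1 - 2 * gaussianQ L) * e0) by rewrite ler_wpM2l.
have h2 : y * (1 - 2 * gaussianQ L) * ((1 - d) * e0) <= (1 + d) * ((1 - d) * e0).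
  by rewrite ler_wpM2r// mulr_ge0// ltW.
rewrite -(ler_pM2l k1) mulrCA (le_trans h1)//.
by rewrite (_ : y * _ = y * (1 - 2 * gaussianQ L) * ((1 - d) * e0)) 1?[e0 * _]mulrC//; ring.
Qed.
End BetaShiftMain.

(** * Hamming weights and binomial tails *)

Section HammingWeight.
Variable n : nat.
Implicit Types z : bits n.

Lemma hamming_weight_le z : (hamming_weight z <= n)%N.
Proof. by rewrite -[leqRHS]card_ord max_card. Qed.

Lemma card_hamming_weight k :
  #|[set z : bits n | hamming_weight z == k]| = 'C(n, k).
Proof.
pose f (A : {set 'I_n}) : bits n := [ffun i => i \in A].
have fI : injective f.
  by move=> A B /ffunP AB; apply/setP => i; have := AB i; rewrite !ffunE.
rewrite -[in RHS](card_ord n) -card_draws -(card_imset _ fI).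
apply: eq_card => z; rewrite inE; apply/idP/imsetP.
  move=> zk; exists [set i | z i]; first by rewrite inE -(eqP zk) cardsE.
  by apply/ffunP => i; rewrite ffunE inE.
move=> [A]; rewrite inE => /eqP <- ->; rewrite /hamming_weight; apply/eqP/eq_card => i.
by rewrite inE /= ffunE.
Qed.

Lemma sum_hamming_weight (R : nmodType) (F : nat -> R) :
  \sum_(z : bits n) F (hamming_weight z) = \sum_(k < n.+1) F k *+ 'C(n, k).
Proof.
rewrite (partition_big (fun z => inord (hamming_weight z) : 'I_n.+1) xpredT)//=.
apply: eq_bigr => k _; rewrite -card_hamming_weight -sumr_const.
apply: eq_big => z.
  by rewrite inE -val_eqE/= inordK// ltnS hamming_weight_le.
by move=> /eqP <-; rewrite inordK// ltnS hamming_weight_le.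
Qed.

Lemma prod_bernoulli (R : realType) (u : R) z :
  \prod_i bernoulli_pmf u (z i) =
  u ^+ hamming_weight z * (1 - u) ^+ (n - hamming_weight z).
Proof.
rewrite /bernoulli_pmf (bigID (fun i => z i))/=; congr (_ * _).
  rewrite (eq_bigr (fun=> u)) => [|i ->//].
  by rewrite prodr_const; congr (_ ^+ _); apply: eq_card => i.
rewrite (eq_bigr (fun=> 1 - u)) => [|i /negbTE ->//].
have -> : (n - hamming_weight z)%N = #|[predC [pred i | z i]]|.
  by rewrite -[X in (X - _)%N](card_ord n) -(cardC [pred i | z i]) addKn.
by rewrite prodr_const; congr (_ ^+ _); apply: eq_card => i.
Qed.

End HammingWeight.

Section BernoulliTail.
Variable R : realType.

(** Upper tail of Bin(n, u), kept as a sum over the cube so that it can be compared with vectors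
    that are not i.i.d. *)
Definition bernoulli_tail n s (u : R) :=
  \sum_(z : bits n) (\prod_i bernoulli_pmf u (z i)) * (s <= hamming_weight z)%N%:R.

Lemma sum_bernoulli_pmf (u : R) : \sum_b bernoulli_pmf u b = 1.
Proof. by rewrite big_bool/= /bernoulli_pmf addrC subrK. Qed.

Lemma sum_prod_bernoulli (I : finType) (u : R) :
  \sum_(z : {ffun I -> bool}) \prod_i bernoulli_pmf u (z i) = 1.
Proof.
by rewrite (sum_ffun_prod (fun _ => bernoulli_pmf u)) big1// => i _; rewrite sum_bernoulli_pmf.
Qed.

Lemma prod_bernoulli_ge0 (I : finType) (u : R) (z : {ffun I -> bool}) :
  0 <= u <= 1 -> 0 <= \prod_i bernoulli_pmf u (z i).
Proof. by move=> u01; apply: prodr_ge0 => i _; exact: bernoulli_pmf_ge0. Qed.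

Lemma bernoulli_tail_01 n s (u : R) : 0 <= u <= 1 -> 0 <= bernoulli_tail n s u <= 1.
Proof.
move=> u01; apply/andP; split.
  by apply: sumr_ge0 => z _; rewrite mulr_ge0 ?prod_bernoulli_ge0.
rewrite -(sum_prod_bernoulli 'I_n u); apply: ler_sum => z _.
by rewrite ler_piMr ?prod_bernoulli_ge0//; case: leqP.
Qed.

Let bern_poly n k : {poly R} := 'C(n, k)%:R *: ('X ^+ k * (1 - 'X) ^+ (n - k)).

Let bernoulli_tailE n s u : (s <= n.+1)%N ->
  bernoulli_tail n s u = (\sum_(s <= k < n.+1) bern_poly n k).[u].
Proof.
move=> sn; rewrite /bernoulli_tail.
under eq_bigr do rewrite prod_bernoulli.
rewrite (sum_hamming_weight n (fun k => u ^+ k * (1 - u) ^+ (n - k) * (s <= k)%N%:R)).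
rewrite horner_sum -(big_mkord xpredT (fun k => (u ^+ k * (1 - u) ^+ (n - k) * (s <= k)%N%:R) *+ 'C(n, k))).
rewrite (big_cat_nat (leq0n s) sn)/= [X in X + _]big_nat_cond big1 ?add0r; last first.
  by move=> k; rewrite andbT => /andP[_]; rewrite ltnNge => /negbTE->; rewrite mulr0 mul0rn.
apply: eq_big_nat => k /andP[-> _]; rewrite mulr1 -mulr_natl.
by rewrite /bern_poly !hornerE.
Qed.

(** The derivative of a Bernstein polynomial is a difference of two neighbours of lower degree, so
    the derivative of a tail telescopes to a single term, a multiple of a Beta kernel. *)
Let deriv_bern_poly n k : (bern_poly n.+1 k.+1)^`() =
  n.+1%:R *: (bern_poly n k - bern_poly n k.+1).
Proof.
have c1 : 'C(n.+1, k.+1)%:R * k.+1%:R = n.+1%:R * 'C(n, k)%:R :> R.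
  by rewrite -!natrM mul_bin_diag mulnC.
have c2 : 'C(n.+1, k.+1)%:R * (n - k)%:R = n.+1%:R * 'C(n, k.+1)%:R :> R.
  by rewrite -!natrM mulnC -(mul_bin_down n.+1 k.+1).
have dE : ('X ^+ k.+1 * (1 - 'X) ^+ (n - k))^`() =
    k.+1%:R *: ('X^k * (1 - 'X) ^+ (n - k)) -
    (n - k)%:R *: ('X ^+ k.+1 * (1 - 'X) ^+ (n - k.+1)) :> {poly R}.
  rewrite derivM derivXn deriv_exp derivB derivC derivX sub0r !scaler_nat subnS.
  by rewrite mulN1r mulNrn mulrN mulrnAl mulrnAr.
rewrite /bern_poly subSS derivZ dE !scalerBr !scalerA c1 c2.
by [].
Qed.

Lemma is_derive_bernoulli_tail n s (u : R) : (s <= n)%N ->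
  is_derive u 1 (bernoulli_tail n.+1 s.+1)
    (n.+1%:R * 'C(n, s)%:R * beta_kernel s (n - s) u).
Proof.
move=> sn.
have -> : bernoulli_tail n.+1 s.+1 = horner (\sum_(s.+1 <= k < n.+2) bern_poly n.+1 k).
  by apply/funext => v; rewrite bernoulli_tailE// ltnS leqW.
apply: (is_derive_eq (is_derive_poly _ _)).
rewrite raddf_sum/= big_add1/=.
rewrite (eq_bigr (fun k => - n.+1%:R *: (bern_poly n k.+1 - bern_poly n k))); last first.
  by move=> k _; rewrite deriv_bern_poly -[in RHS]opprB scalerN scaleNr opprK.
rewrite -scaler_sumr telescope_sumr; last exact: leqW.
rewrite [X in X - _]/bern_poly bin_small// scale0r sub0r scalerN scaleNr opprK.
by rewrite /bern_poly !hornerE.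
Qed.
End BernoulliTail.

(** * Independent noise, permutations and monotone symmetric functions *)

Section Convolution.
Variables (R : comNzRingType) (I A B C : finType).

(** Applying [op] coordinatewise to two independent product vectors gives a product vector again,
    with the pushed-forward marginals. *)
Lemma sum_prod_convolution (a : I -> A -> R) (b : I -> B -> R) (op : A -> B -> C)
    (f : {ffun I -> C} -> R) :
  \sum_(z : {ffun I -> A}) \sum_(w : {ffun I -> B})
    (\prod_i a i (z i)) * (\prod_i b i (w i)) * f [ffun i => op (z i) (w i)] =
  \sum_(y : {ffun I -> C}) f y *
    \prod_i \sum_x \sum_(t | op x t == y i) a i x * b i t.
Proof.
transitivity (\sum_(y : {ffun I -> C}) f y * \sum_(z : {ffun I -> A}) \sum_(w : {ffun I -> B})
   \prod_i (a i (z i) * b i (w i) * (op (z i) (w i) == y i)%:R)); last first.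
  apply: eq_bigr => y _; congr (_ * _).
  transitivity (\sum_(z : {ffun I -> A}) \prod_i \sum_t a i (z i) * b i t * (op (z i) t == y i)%:R).
    apply: eq_bigr => z _.
    by rewrite -(sum_ffun_prod (fun i t => a i (z i) * b i t * (op (z i) t == y i)%:R)).
  rewrite (sum_ffun_prod (fun i x => \sum_t a i x * b i t * (op x t == y i)%:R)).
  apply: eq_bigr => i _; apply: eq_bigr => x _; rewrite [RHS]big_mkcond.
  by apply: eq_bigr => t _; case: ifP; rewrite ?mulr1 ?mulr0.
under [RHS]eq_bigr do rewrite mulr_sumr.
rewrite [RHS]exchange_big; apply: eq_bigr => z _.
under [RHS]eq_bigr do rewrite mulr_sumr.
rewrite [RHS]exchange_big; apply: eq_bigr => w _.
under [RHS]eq_bigr do rewrite !big_split/= prod_indicator.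
rewrite (bigD1 [ffun i => op (z i) (w i)])//= [X in _ + X]big1 ?addr0.
  have -> : [forall i, op (z i) (w i) == [ffun i => op (z i) (w i)] i].
    by apply/forallP => i; rewrite ffunE.
  by rewrite mulr1 mulrC.
move=> y /negbTE yn.
suff /negbTE-> : ~~ [forall i, op (z i) (w i) == y i] by rewrite !mulr0.
apply: contraFN yn => /forallP H; apply/eqP/ffunP => i; rewrite ffunE.
by rewrite (eqP (H i)).
Qed.

End Convolution.

Section Permute.
Variable n : nat.
Implicit Types (x z : bits n) (s : 'I_n -> 'I_n).

Definition permute_bits s z : bits n := [ffun i => z (s i)].

Lemma permute_bits_inj s : injective s -> injective (permute_bits s).
Proof.
move=> sI x z /ffunP E; apply/ffunP => i.
have [t sK tK] := injF_bij sI.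
by have := E (t i); rewrite !ffunE tK.
Qed.

Lemma hamming_weight_permute s z : injective s ->
  hamming_weight (permute_bits s z) = hamming_weight z.
Proof.
move=> sI; rewrite /hamming_weight -!sum1_card [RHS](reindex_inj sI).
by apply: eq_bigl => i; rewrite !unfold_in /= ffunE.
Qed.

Lemma prod_permute (R : comNzRingType) (f : bool -> R) s z : injective s ->
  \prod_i f (permute_bits s z i) = \prod_i f (z i).
Proof. by move=> sI; rewrite [RHS](reindex_inj sI); apply: eq_bigr => i _; rewrite ffunE. Qed.

(** List the coordinates of each vector with its ones first and match the two lists: an index at
    which the permuted [x] is one stands among the first entries of the list of [z], hence is a one
    of [z]. *)
Lemma permute_bits_le x z : (hamming_weight x <= hamming_weight z)%N ->
  exists2 s, injective s & forall i, permute_bits s x i -> z i.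
Proof.
move=> xz.
pose l (y : bits n) := enum [pred i | y i] ++ enum [predC [pred i | y i]].
have lm y i : i \in l y.
  by rewrite mem_cat !mem_enum !inE orbN.
have lu y : uniq (l y).
  rewrite cat_uniq !enum_uniq andbT/= -all_predC; apply/allP => i.
  by rewrite mem_enum /= mem_enum !inE => /negbTE->.
have ls y : size (l y) = n.
  by rewrite size_cat -!cardE cardC card_ord.
pose f i := nth i (l x) (index i (l z)).
have fI : injective f.
  move=> i j; rewrite /f => E.
  have il k : (index k (l z) < size (l x))%N.
    by rewrite (leq_trans (n := size (l z))) ?index_mem ?lm ?ls.
  rewrite (set_nth_default j) ?il// in E.
  move/eqP: E; rewrite nth_uniq ?il// => /eqP E.
  by rewrite -(nth_index i (lm z i)) E nth_index.
exists f => // i; rewrite ffunE /f => xi.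
have [//|zi] := boolP (z i).
have h1 : (hamming_weight z <= index i (l z))%N.
  rewrite /l index_cat mem_enum inE (negbTE zi).
  by rewrite -cardE leq_addr.
have h2 : (hamming_weight x <= index i (l z))%N by apply: leq_trans h1.
move: xi; rewrite nth_cat -cardE ltnNge h2/= => xi.
have : nth i (enum [predC [pred i | x i]]) (index i (l z) - #|[pred i | x i]|) \in
   enum [predC [pred i | x i]].
  rewrite mem_nth// -cardE ltn_subLR// cardC card_ord.
  by rewrite (leq_trans (n := size (l z))) ?index_mem ?lm ?ls.
by rewrite mem_enum !inE xi.
Qed.

(** A symmetric function that increases in every coordinate is an increasing function of the weight.
    It is applied to tail probabilities and to the likelihood ratio. *)
Lemma sym_mono_le (R : realType) (f : bits n -> R) :
  (forall s z, injective s -> f (permute_bits s z) = f z) ->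
  (forall x z, (forall i, x i -> z i) -> f x <= f z) ->
  forall x z, (hamming_weight x <= hamming_weight z)%N -> f x <= f z.
Proof. by move=> fs fm x z /permute_bits_le[s sI /fm]; rewrite fs. Qed.

End Permute.

Section NoiseTail.
Variables (R : realType) (n : nat) (q : R).
Hypotheses (q_ge0 : 0 <= q) (q_lt : q < 1 / 2).
Implicit Types (x z e : bits n).

Definition noise_tail s x : R :=
  \sum_(e : bits n) noise_law q e * (s <= hamming_weight (xorb_bits x e))%N%:R.

Lemma xorb_bitsK x : involutive (xorb_bits x).
Proof. by move=> z; apply/ffunP => i; rewrite !ffunE addKb. Qed.

Lemma noise_law_ge0 e : 0 <= noise_law q e.
Proof. by have ? := q_lt; apply: prod_bernoulli_ge0; rewrite q_ge0/=; lra. Qed.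

Lemma sum_noise_law : \sum_(e : bits n) noise_law q e = 1.
Proof. exact: sum_prod_bernoulli. Qed.

Lemma sum_noise_xor x (f : bits n -> R) :
  \sum_e noise_law q e * f (xorb_bits x e) = \sum_z noise_law q (xorb_bits x z) * f z.
Proof.
rewrite (reindex_inj (inv_inj (xorb_bitsK x))).
by apply: eq_bigr => z _; rewrite xorb_bitsK.
Qed.

Lemma noise_tail_ge0 s x : 0 <= noise_tail s x.
Proof. by apply: sumr_ge0 => e _; rewrite mulr_ge0 ?noise_law_ge0. Qed.

(** Bern(theta) plus Bern(q) modulo 2 is Bern(q + theta (1 - 2 q)). *)
Lemma sum_noise_tail s (theta : R) :
  \sum_(x : bits n) (\prod_i bernoulli_pmf theta (x i)) * noise_tail s x =
  bernoulli_tail n s (q + theta * (1 - 2 * q)).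
Proof.
transitivity (\sum_(x : bits n) \sum_(e : bits n) (\prod_i bernoulli_pmf theta (x i)) *
    (\prod_i bernoulli_pmf q (e i)) * (s <= hamming_weight [ffun i => x i (+) e i])%N%:R).
  apply: eq_bigr => x _; rewrite /noise_tail mulr_sumr.
  by apply: eq_bigr => e _; rewrite mulrA.
rewrite (sum_prod_convolution (fun _ => bernoulli_pmf theta) (fun _ => bernoulli_pmf q) addb
  (fun z : bits n => (s <= hamming_weight z)%N%:R)).
apply: eq_bigr => y _; rewrite mulrC; congr (_ * _); apply: eq_bigr => i _.
rewrite big_bool [X in X + _ = _]big_mkcond [X in _ + X = _]big_mkcond !big_bool /bernoulli_pmf /=.
by case: (y i) => /=; ring.
Qed.

(** Average over an i.i.d. Bern(theta) input: where its weight reaches [w0] it has the heavier tail,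
    and elsewhere the trivial bound 1 is used. *)
Lemma noise_tail_bound s (theta : R) w0 x : 0 <= theta <= 1 ->
  (forall z, (w0 <= hamming_weight z)%N -> noise_tail s x <= noise_tail s z) ->
  noise_tail s x <= bernoulli_tail n s (q + theta * (1 - 2 * q)) +
    \sum_(z : bits n) (\prod_i bernoulli_pmf theta (z i)) * (hamming_weight z < w0)%N%:R.
Proof.
move=> t01 H; rewrite -sum_noise_tail -big_split/=.
rewrite -[leLHS]mul1r -[X in X * _ <= _](sum_prod_bernoulli 'I_n theta) mulr_suml.
apply: ler_sum => z _; rewrite -mulrDr ler_wpM2l ?prod_bernoulli_ge0//.
have [zw|wz] := ltnP; last by rewrite addr0 H.
apply: (@le_trans _ _ 1); last by rewrite lerDr noise_tail_ge0.
rewrite -sum_noise_law; apply: ler_sum => e _.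
by rewrite ler_piMr ?noise_law_ge0//; case: leqP.
Qed.

Lemma noise_tail_permute s (p : 'I_n -> 'I_n) x : injective p ->
  noise_tail s (permute_bits p x) = noise_tail s x.
Proof.
move=> pI; rewrite /noise_tail (reindex_inj (permute_bits_inj pI)).
apply: eq_bigr => e _; congr (_ * _); first exact: (prod_permute (bernoulli_pmf q)).
have -> : xorb_bits (permute_bits p x) (permute_bits p e) = permute_bits p (xorb_bits x e).
  by apply/ffunP => i; rewrite !ffunE.
by rewrite hamming_weight_permute.
Qed.

(* Bern(1 - q) is the law of the disjunction of Bern(q) and an independent
   Bern((1 - 2 q) / (1 - q)). *)
Lemma noise_tail_mono s x z : (forall i, x i -> z i) -> noise_tail s x <= noise_tail s z.
Proof.
have q0' := q_ge0; have q1' := q_lt.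
move=> xz; rewrite /noise_tail !(sum_noise_xor _ (fun z => (s <= hamming_weight z)%N%:R)).
pose th := (1 - 2 * q) / (1 - q).
have q1 : 0 < 1 - q by lra.
have th01 : 0 <= th <= 1.
  by rewrite /th divr_ge0 ?ler_pdivrMr//=; lra.
pose a i t := bernoulli_pmf q (x i (+) t).
pose b i t := bernoulli_pmf (if z i && ~~ x i then th else 0) t.
have b0 i t : 0 <= b i t.
  by apply: bernoulli_pmf_ge0; case: ifP => // _; rewrite lexx ler01.
have conv := sum_prod_convolution a b orb (fun y : bits n => (s <= hamming_weight y)%N%:R : R).
rewrite (_ : \sum_z0 noise_law q (xorb_bits z z0) * _ = \sum_(y : bits n)
  (s <= hamming_weight y)%N%:R * \prod_i \sum_u \sum_(t | u || t == y i) a i u * b i t); last first.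
  apply: eq_bigr => y _; rewrite mulrC; congr (_ * _); apply: eq_bigr => i _.
  rewrite big_bool [X in _ = X + _]big_mkcond [X in _ = _ + X]big_mkcond !big_bool /a /b ffunE.
  have := xz i; case: (x i) => [/(_ isT)->|_]; case: (z i); case: (y i);
    rewrite /bernoulli_pmf /th /=; try ring; by field; rewrite gt_eqF.
rewrite -conv; apply: ler_sum => u _.
apply: (@le_trans _ _ (\sum_(w : bits n) (\prod_i a i (u i)) * (\prod_i b i (w i)) *
    (s <= hamming_weight u)%N%:R)).
  rewrite -mulr_suml -mulr_sumr.
  rewrite (sum_ffun_prod b) [X in _ * X * _]big1 ?mulr1; last first.
    by move=> i _; exact: sum_bernoulli_pmf.
  by rewrite le_eqVlt; apply/orP; left; apply/eqP; congr (_ * _); apply: eq_bigr => i _; rewrite ffunE.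
apply: ler_sum => w _; rewrite ler_wpM2l//.
  rewrite mulr_ge0 ?prodr_ge0// => i _; rewrite bernoulli_pmf_ge0//; apply/andP; split; lra.
rewrite ler_nat; case: (leqP s (hamming_weight u)) => // su.
rewrite (leq_trans su)// /hamming_weight; apply/subset_leq_card/fintype.subsetP => i.
by rewrite !unfold_in /= ffunE => ->.
Qed.

Lemma noise_tail_le s x z : (hamming_weight x <= hamming_weight z)%N ->
  noise_tail s x <= noise_tail s z.
Proof.
apply: sym_mono_le => [p y pI|y y']; first exact: noise_tail_permute.
exact: noise_tail_mono.
Qed.

End NoiseTail.

(** * Random placement of a codeword and its likelihood ratio *)

Section Placement.
Variables (R : realType) (n : nat) (J : finType).
Implicit Types (c : J -> bool) (f : {ffun J -> 'I_n}) (z : bits n).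

Definition place c f : bits n := [ffun i => [exists j, c j && (f j == i)]].

Lemma place_at c f j : injective f -> place c f (f j) = c j.
Proof.
move=> fI; rewrite ffunE; apply/existsP/idP => [[i /andP[ci /eqP/fI <-]]//|cj].
by exists j; rewrite cj eqxx.
Qed.

Lemma hamming_weight_place c f : (hamming_weight (place c f) <= #|[pred j | c j]|)%N.
Proof.
rewrite /hamming_weight; apply: leq_trans (leq_image_card f _).
apply/subset_leq_card/fintype.subsetP => i; rewrite unfold_in /= ffunE => /existsP[j /andP[cj /eqP<-]].
by apply: fintype.image_f; rewrite inE.
Qed.

Lemma prod_place c f (g : 'I_n -> R) : injective f ->
  \prod_i (if place c f i then g i else 1) = \prod_j (if c j then g (f j) else 1).
Proof.
move=> fI; rewrite -[RHS]big_mkcond (partition_big f xpredT)//=; apply: eq_bigr => i _.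
rewrite ffunE; case: existsP => [[j /andP[cj /eqP fj]]|ne].
  rewrite (big_pred1 j) ?fj// => k /=; apply/andP/eqP => [[_ /eqP fk]|->].
    by apply: fI; rewrite fj fk.
  by rewrite cj fj eqxx.
by rewrite big_pred0// => j; apply/negbTE/negP => H; case: ne; exists j.
Qed.

(** Likelihood ratio of one observed bit [b], for input 1 against input 0. *)
Definition flip_ratio (q : R) (b : bool) := if b then (1 - q) / q else q / (1 - q).

Lemma flip_ratio_ge0 q b : 0 <= q <= 1 -> 0 <= flip_ratio q b.
Proof. by move=> /andP[q0 q1]; case: b; rewrite divr_ge0// subr_ge0. Qed.

Lemma noise_law_place q c f z : 0 < q < 1 -> injective f ->
  noise_law q (xorb_bits (place c f) z) =
  noise_law q z * \prod_j (if c j then flip_ratio q (z (f j)) else 1).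
Proof.
move=> /andP[q0 q1] fI; rewrite -(prod_place c (fun i => flip_ratio q (z i)) fI) -big_split.
have q0' : q != 0 by rewrite gt_eqF.
have q1' : 1 - q != 0 by rewrite gt_eqF// subr_gt0.
apply: eq_bigr => i _; rewrite ffunE /bernoulli_pmf /flip_ratio.
by case: (place c f i); case: (z i); rewrite /= ?mulr1// mulrC divfK.
Qed.

(** Expectation over a uniformly random injection; the falling factorial counts the injections. *)
Definition avg_inj (F : {ffun J -> 'I_n} -> R) : R :=
  (n ^_ #|J|)%:R^-1 * \sum_(f : {ffun J -> 'I_n} | injectiveb f) F f.

Lemma card_injections : #|[pred f : {ffun J -> 'I_n} | injectiveb f]| = (n ^_ #|J|)%N.
Proof. by rewrite -[n in RHS]card_ord -card_inj_ffuns cardsE; apply: eq_card. Qed.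

Lemma ffact_gt0 : (#|J| <= n)%N -> 0 < (n ^_ #|J|)%:R :> R.
Proof. by move=> Jn; rewrite ltr0n ffact_gt0. Qed.

Lemma avg_inj_const (a : R) : (#|J| <= n)%N -> avg_inj (fun=> a) = a.
Proof.
move=> Jn; rewrite /avg_inj sumr_const card_injections -[a *+ _]mulr_natl mulKf//.
by rewrite gt_eqF// ffact_gt0.
Qed.

Lemma avg_inj_le F G : (forall f, injective f -> F f <= G f) -> avg_inj F <= avg_inj G.
Proof.
move=> FG; rewrite ler_wpM2l ?invr_ge0 ?ler0n//.
by apply: ler_sum => f /injectiveP; exact: FG.
Qed.

Lemma eq_avg_inj F G : (forall f, injective f -> F f = G f) -> avg_inj F = avg_inj G.
Proof. by move=> FG; congr (_ * _); apply: eq_bigr => f /injectiveP; exact: FG. Qed.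

Lemma avg_injD F G : avg_inj (fun f => F f + G f) = avg_inj F + avg_inj G.
Proof. by rewrite /avg_inj big_split/= mulrDr. Qed.

Lemma avg_injZ a F : avg_inj (fun f => a * F f) = a * avg_inj F.
Proof. by rewrite /avg_inj -mulr_sumr mulrCA. Qed.

Lemma avg_inj_sum (T : finType) (F : T -> {ffun J -> 'I_n} -> R) :
  avg_inj (fun f => \sum_t F t f) = \sum_t avg_inj (F t).
Proof. by rewrite /avg_inj exchange_big mulr_sumr. Qed.

End Placement.

(** * The optimal detector is a weight threshold *)

Section CovertTest.
Variables (R : realType) (n : nat) (J T : finType) (q theta D : R).
Variables (mu : T -> R) (c : T -> J -> bool) (w0 : nat).
Hypotheses (Jn : (#|J| <= n)%N) (q0 : 0 < q) (q_lt : q < 1 / 2) (theta01 : 0 <= theta <= 1).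
Hypotheses (mu0 : forall t, 0 <= mu t) (mu1 : \sum_t mu t = 1).
Hypothesis cw : forall t, (#|[pred j | c t j]| <= w0)%N.
Hypothesis tailD : forall s,
  bernoulli_tail n s (q + theta * (1 - 2 * q)) - bernoulli_tail n s q <= D.

Let q01 : 0 < q < 1.
Proof. by have q1 := q_lt; rewrite q0; lra. Qed.

Let q01' : 0 <= q <= 1.
Proof. by move: q01 => /andP[/ltW-> /ltW->]. Qed.

(** Likelihood ratio of the observation, a random codeword at uniformly random positions against
    silence. *)
Let H (z : bits n) : R :=
  \sum_t mu t * avg_inj (fun f : {ffun J -> 'I_n} => \prod_j (if c t j then flip_ratio q (z (f j)) else 1)).

(** Permuting the coordinates only permutes the injections, over which the average is uniform. *)
Let H_permute p z : injective p -> H (permute_bits p z) = H z.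
Proof.
move=> pI; apply: eq_bigr => t _; congr (_ * (_ * _)).
have [p' pK p'K] := injF_bij pI.
have p'I : injective p' := can_inj p'K.
pose h (f : {ffun J -> 'I_n}) := [ffun j => p' (f j)].
have hI : injective h.
  by move=> f g /ffunP E; apply/ffunP => j; have := E j; rewrite !ffunE => /p'I.
rewrite (reindex_inj hI); apply: eq_big => [f|f _].
  apply/injectiveP/injectiveP => fI j k.
    by move=> jk; apply: fI; rewrite !ffunE jk.
  by rewrite !ffunE => /p'I/fI.
by apply: eq_bigr => j _; rewrite !ffunE p'K.
Qed.

(** Since q < 1/2, [flip_ratio] is larger at an observed 1. *)
Let H_mono (x z : bits n) : (forall i, x i -> z i) -> H x <= H z.
Proof.
move=> xz; apply: ler_sum => t _; rewrite ler_wpM2l//; apply: avg_inj_le => f _.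
apply: ler_prod => j _; case: (c t j); last by rewrite ler01 lexx.
rewrite flip_ratio_ge0//=; have := xz (f j).
case: (x (f j)) => [/(_ isT)->//|_]; case: (z (f j)) => //=.
rewrite ler_pdivrMr; last by have := q_lt; lra.
rewrite mulrAC ler_pdivlMr ?q0//; have := q_lt; have := q0; nra.
Qed.

Let H_le x z : (hamming_weight x <= hamming_weight z)%N -> H x <= H z.
Proof. by apply: sym_mono_le; [move=> p y; exact: H_permute|exact: H_mono]. Qed.

Let H_threshold : exists s, forall z, (1 < H z) = (s <= hamming_weight z)%N.
Proof.
have [/existsP[z0 Hz0]|/existsPn ne] := boolP [exists z, 1 < H z].
  case: (@arg_minnP _ z0 (fun z => 1 < H z) (@hamming_weight n) Hz0) => z1 Hz1 minz.
  exists (hamming_weight z1) => z; apply/idP/idP; first exact: minz.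
  by move=> /H_le; exact: lt_le_trans.
exists n.+1 => z; rewrite (negbTE (ne z)); apply/esym/negbTE.
by rewrite -ltnNge ltnS hamming_weight_le.
Qed.

Let sum_H (F : bits n -> R) :
  \sum_t mu t * avg_inj (fun f : {ffun J -> 'I_n} =>
     \sum_e noise_law q e * F (xorb_bits (place (c t) f) e)) =
  \sum_z noise_law q z * H z * F z.
Proof.
transitivity (\sum_t \sum_z mu t * (noise_law q z * F z *
   avg_inj (fun f : {ffun J -> 'I_n} => \prod_j (if c t j then flip_ratio q (z (f j)) else 1)))).
  apply: eq_bigr => t _; rewrite -mulr_sumr; congr (_ * _).
  under [RHS]eq_bigr do rewrite -avg_injZ.
  rewrite -avg_inj_sum; apply: eq_avg_inj => f fI.
  rewrite sum_noise_xor; apply: eq_bigr => z _.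
  by rewrite noise_law_place// mulrAC.
rewrite exchange_big; apply: eq_bigr => z _.
rewrite -mulrA [H z * _]mulrC mulrA mulr_sumr; apply: eq_bigr => t _.
by rewrite mulrCA.
Qed.

(** Neyman-Pearson: no test gains more than the test [1 < H z], which is a weight threshold. Its
    gain is a difference of weight tails, and [noise_tail_bound] reduces it to the difference of
    binomial tails bounded by [D]. *)
Lemma covert_test (Phi : bits n -> bool) :
  \sum_t mu t * avg_inj (fun f : {ffun J -> 'I_n} =>
     \sum_e noise_law q e * (Phi (xorb_bits (place (c t) f) e))%:R) -
  \sum_e noise_law q e * (Phi e)%:R <=
  D + \sum_(z : bits n) (\prod_i bernoulli_pmf theta (z i)) * (hamming_weight z < w0)%N%:R.
Proof.
have [s Hs] := H_threshold.
rewrite (sum_H (fun z => (Phi z)%:R)) -sumrB.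
(* Pointwise, (H - 1) Phi is at most the positive part of H - 1. *)
apply: (@le_trans _ _ (\sum_z (noise_law q z * H z * (s <= hamming_weight z)%N%:R -
    noise_law q z * (s <= hamming_weight z)%N%:R))).
  apply: ler_sum => z _; rewrite -!mulrA -!mulrBr ler_wpM2l ?noise_law_ge0 ?(ltW q0)//.
  rewrite -Hs; case: ltP => Hz; case: (Phi z); rewrite ?mulr1 ?mulr0 ?subrr// ?subr_ge0 ?subr_le0//.
  exact: ltW.
rewrite sumrB -(sum_H (fun z => (s <= hamming_weight z)%N%:R)).
rewrite -[X in _ - X]/(bernoulli_tail n s q).
have := tailD s; set b1 := bernoulli_tail _ _ _; set b0 := bernoulli_tail _ _ _.
set P := (X in _ <= D + X).
suff : \sum_t mu t * avg_inj (fun f : {ffun J -> 'I_n} =>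
     noise_tail q s (place (c t) f)) <= b1 + P.
  by rewrite /noise_tail; lra.
rewrite -[leRHS]mul1r -mu1 mulr_suml; apply: ler_sum => t _; rewrite ler_wpM2l//.
rewrite -(@avg_inj_const R n J (b1 + P))//; apply: avg_inj_le => f fI.
apply: noise_tail_bound => // [|z wz]; first exact: ltW.
by apply: noise_tail_le; rewrite ?ltW// (leq_trans _ wz)// (leq_trans (hamming_weight_place _ _)).
Qed.

End CovertTest.

(** * Nearly uniform injections from key bits *)

Section Lehmer.

(* [s_j < n - j] is the rank of the j-th entry among the values that the
   earlier entries leave free. *)
Fixpoint lehmer (s : seq nat) : seq nat :=
  if s is a :: s' then a :: map (bump a) (lehmer s') else [::].

Lemma size_lehmer s : size (lehmer s) = size s.
Proof. by elim: s => //= a s IH; rewrite size_map IH. Qed.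

Lemma lehmer_uniq s : uniq (lehmer s).
Proof.
elim: s => //= a s IH; rewrite (map_inj_uniq (can_inj (@bumpK a))) IH andbT.
by apply/mapP => -[x _ /eqP]; rewrite (negbTE (neq_bump a x)).
Qed.

Lemma lehmer_lt n s : (forall j, (j < size s)%N -> (nth 0%N s j < n - j)%N) ->
  all (fun x => (x < n)%N) (lehmer s).
Proof.
elim: s n => //= a s IH n H; have := H 0%N isT; rewrite subn0 /= => -> /=.
rewrite all_map; have : all (fun x => x < n.-1)%N (lehmer s).
  by apply: IH => j js; have := H j.+1 js; rewrite /= subnS -predn_sub.
apply: sub_all => x /=; rewrite /bump; case: (a <= x)%N => /=; lia.
Qed.

(** Peel off the head and close the gap it leaves with [unbump]. Thus every injection has admissible
    digits, as the lower bound on its probability requires. *)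
Lemma lehmer_surj n t : uniq t -> all (fun x => (x < n)%N) t ->
  exists s, [/\ size s = size t, forall j, (j < size s)%N -> (nth 0%N s j < n - j)%N
    & lehmer s = t].
Proof.
elim: {t}(size t) {-2}t (erefl (size t)) n => [|m IH] [|a t] //= st n.
  by move=> _ _; exists [::].
move=> /andP[at' ut] /andP[an tn].
have tbu x : x \in t -> x != a by move=> xt; apply: contraNneq at' => <-.
have [|||s [s1 s2 s3]] := IH (map (unbump a) t) _ n.-1.
- by rewrite size_map; case: st.
- rewrite map_inj_in_uniq// => x y xt yt xy.
  by rewrite -[x](@unbumpK a) ?inE ?tbu// xy unbumpK// inE tbu.
- rewrite all_map; apply/allP => x xt /=; have := allP tn _ xt; have := tbu _ xt.
  rewrite /unbump; case: (ltnP a x) => /=; lia.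
exists (a :: s); split=> /=.
- by rewrite s1 size_map.
- by case=> [|j] /= js; [rewrite subn0|have := s2 j js; lia].
- rewrite s3 -map_comp map_id_in// => x xt /=.
  by rewrite unbumpK// inE tbu.
Qed.

End Lehmer.

(** The ranks y d + a, for y below the quotient, are all in range. This measures how far a residue
    of a uniform number is from uniform. *)
Lemma card_modn_ge (T : finType) (d a : nat) : (a < d)%N ->
  (#|T| %/ d <= #|[pred x : T | enum_rank x %% d == a]|)%N.
Proof.
move=> ad; have d0 : (0 < d)%N by apply: leq_ltn_trans ad.
have lt (y : 'I_(#|T| %/ d)) : (y * d + a < #|T|)%N.
  have h1 : ((#|T| %/ d) * d <= #|T|)%N by exact: leq_trunc_div.
  have h2 : (y.+1 * d <= (#|T| %/ d) * d)%N by rewrite leq_mul2r ltn_ord orbT.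
  by rewrite mulSn in h2; lia.
pose g y := enum_val (Ordinal (lt y)).
have gI : injective g.
  move=> x y /enum_val_inj /(congr1 val) /= /eqP.
  by rewrite eqn_add2r eqn_pmul2r// => /eqP/val_inj.
rewrite -[X in (X <= _)%N]card_ord -(card_codom gI).
apply/subset_leq_card/fintype.subsetP => x /codomP[y ->].
by rewrite inE enum_valK /= modnMDl modn_small.
Qed.

Section KeyPositions.
Variables (R : realType) (n Delta D : nat) (J : finType).
Hypotheses (n_gt0 : (0 < n)%N) (Jn : (#|J| <= n)%N) (JD : (#|J| * D <= Delta)%N).

Definition key_chunk (k : bits Delta) (j : J) : bits D :=
  [ffun i : 'I_D => nth false (codom k) (enum_rank j * D + i)].

Definition key_digit (j : J) (u : bits D) : nat := (enum_rank u %% (n - enum_rank j))%N.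

(** The default of [insubd] only serves typing: for admissible digits the Lehmer entries are below
    [n]. *)
Definition digits_position (a : J -> nat) : {ffun J -> 'I_n} :=
  [ffun j => insubd (Ordinal n_gt0) (nth 0%N (lehmer [seq a i | i <- enum J]) (enum_rank j))].

Definition key_position (k : bits Delta) : {ffun J -> 'I_n} :=
  digits_position (fun j => key_digit j (key_chunk k j)).

Lemma val_digits_position a j : (forall i, (a i < n - enum_rank i)%N) ->
  digits_position a j = nth 0%N (lehmer [seq a i | i <- enum J]) (enum_rank j) :> nat.
Proof.
move=> H; rewrite ffunE val_insubd.
have -> // : (nth 0 (lehmer [seq a i | i <- enum J]) (enum_rank j) < n)%N.
suff /allP : all (fun x => x < n)%N (lehmer [seq a i | i <- enum J]).
  by apply; rewrite mem_nth// size_lehmer size_map -cardE ltn_ord.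
apply: lehmer_lt.
move=> i; rewrite size_map -cardE => iJ.
have := H (enum_val (Ordinal iJ)); rewrite enum_valK/= => h.
rewrite (nth_map (enum_val (Ordinal iJ))) -?cardE//.
by rewrite -(enum_val_nth _ (Ordinal iJ)).
Qed.

Lemma digits_position_inj a : (forall i, (a i < n - enum_rank i)%N) ->
  injective (digits_position a).
Proof.
move=> H i j /(congr1 val); rewrite /= !val_digits_position// => /eqP.
have sl : size (lehmer [seq a i | i <- enum J]) = #|J| by rewrite size_lehmer size_map -cardE.
rewrite nth_uniq ?lehmer_uniq ?sl//.
by move=> /eqP/val_inj/enum_rank_inj.
Qed.

Lemma key_digit_lt j u : (key_digit j u < n - enum_rank j)%N.
Proof. by rewrite ltn_mod subn_gt0 (leq_trans _ Jn). Qed.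

Lemma key_position_inj k : injective (key_position k).
Proof. by apply: digits_position_inj => i; exact: key_digit_lt. Qed.

Lemma digits_position_surj (f : {ffun J -> 'I_n}) : injective f ->
  exists2 a : J -> nat, (forall i, (a i < n - enum_rank i)%N) & digits_position a = f.
Proof.
move=> fI; pose t := [seq val (f j) | j <- enum J].
have [||s [s1 s2 s3]] := @lehmer_surj n t.
- by rewrite map_inj_uniq ?enum_uniq// => i j /val_inj/fI.
- by apply/allP => x /mapP[j _ ->]; exact: ltn_ord.
have ss : size s = #|J| by rewrite s1 size_map cardE.
have aE : [seq nth 0%N s (enum_rank i) | i <- enum J] = s.
  apply: (@eq_from_nth _ 0%N) => [|i]; rewrite size_map -cardE// => iJ.
  rewrite (nth_map (enum_val (Ordinal iJ))) -?cardE//.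
  by rewrite -(enum_val_nth _ (Ordinal iJ)) enum_valK.
have alt (i : J) : (nth 0%N s (enum_rank i) < n - enum_rank i)%N by apply: s2; rewrite ss; exact: (ltn_ord (enum_rank i)).
exists (fun i => nth 0%N s (enum_rank i)) => //.
apply/ffunP => j; apply: val_inj; rewrite /= val_digits_position// aE s3.
rewrite (nth_map j) -?cardE//; congr (val (f _)).
by rewrite -enum_val_nth enum_rankK.
Qed.

End KeyPositions.

Lemma sum_curry (R : nmodType) (J I A : finType) (F : {ffun J -> {ffun I -> A}} -> R) :
  \sum_(y : {ffun J * I -> A}) F [ffun j => [ffun i => y (j, i)]] = \sum_u F u.
Proof.
pose h (u : {ffun J -> {ffun I -> A}}) : {ffun J * I -> A} := [ffun p => u p.1 p.2].
rewrite (reindex h) /=; last first.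
  apply: onW_bij; exists (fun y : {ffun J * I -> A} => [ffun j => [ffun i => y (j, i)]]).
    by move=> u; apply/ffunP => j; apply/ffunP => i; rewrite !ffunE.
  by move=> y; apply/ffunP => -[j i]; rewrite !ffunE.
apply: eq_bigr => u _; congr F.
by apply/ffunP => j; apply/ffunP => i; rewrite !ffunE.
Qed.

Lemma nth_codom_ord (N : nat) (k : bits N) (i : 'I_N) : nth false (codom k) i = k i.
Proof. by rewrite codomE (nth_map i) ?size_enum_ord// nth_ord_enum. Qed.

Lemma prod_ge_1subM (R : realDomainType) (I : finType) (e : R) : 0 <= e <= 1 ->
  1 - #|I|%:R * e <= \prod_(i : I) (1 - e).
Proof.
move=> /andP[e0 e1]; rewrite prodr_const; elim: #|I| => [|m IH].
  by rewrite mul0r subr0.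
rewrite exprS; have : (1 - e) * (1 - m%:R * e) <= (1 - e) * (1 - e) ^+ m.
  by rewrite ler_wpM2l// subr_ge0.
apply: le_trans; rewrite -natr1.
have : 0 <= m%:R * e ^+ 2 by rewrite mulr_ge0 ?sqr_ge0.
lra.
Qed.

Section KeyLaw.
Variables (R : realType) (n Delta D : nat) (J : finType).
Hypotheses (n_gt0 : (0 < n)%N) (Jn : (#|J| <= n)%N) (JD : (#|J| * D <= Delta)%N).
Hypothesis nD : (n <= 2 ^ D)%N.
Let eps : R := n%:R / 2 ^+ D.

Let slot_lt (p : J * 'I_D) : (enum_rank p.1 * D + p.2 < Delta)%N.
Proof.
apply: leq_trans JD; apply: (@leq_trans ((enum_rank p.1).+1 * D)).
  by rewrite mulSn addnC ltn_add2r.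
by rewrite leq_mul2r (ltn_ord (enum_rank p.1)) orbT.
Qed.

Let slot p := Ordinal (slot_lt p).

Let slotI : injective slot.
Proof.
move=> [j i] [j' i'] /(congr1 val) /= E.
have D0 : (0 < D)%N by apply: leq_trans (ltn_ord i).
have := congr1 (modn^~ D) E; rewrite !modnMDl !modn_small// => /val_inj ii.
have := congr1 (divn^~ D) E; rewrite !divnMDl// !divn_small// !addn0 => /val_inj/enum_rank_inj jj.
by rewrite ii jj.
Qed.

(** Disjoint chunks of a uniform key are independent and uniform; key bits beyond the last chunk sum
    out. *)
Lemma sum_key_chunk (F : {ffun J -> bits D} -> R) :
  \sum_(k : bits Delta) (2 ^+ Delta)^-1 * F [ffun j => key_chunk D k j] =
  \sum_(u : {ffun J -> bits D}) (\prod_(j : J) (2 ^+ D)^-1) * F u.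
Proof.
transitivity (\sum_(k : {ffun 'I_Delta -> bool}) (\prod_(b < Delta) (2^-1 : R)) *
    F [ffun j => [ffun i => [ffun p => k (slot p)] (j, i)]]).
  apply: eq_bigr => k _; rewrite prodr_const card_ord exprVn; congr (_ * F _).
  apply/ffunP => j; apply/ffunP => i; rewrite !ffunE.
  by rewrite (nth_codom_ord k (slot (j, i))).
rewrite (sum_prod_marginal (fun _ _ => 2^-1) (fun _ a => a)
   (fun y => F [ffun j => [ffun i => y (j, i)]]) slotI).
rewrite [X in X * _]big1 ?mul1r; last by move=> b _; rewrite big_bool /=; lra.
rewrite -(sum_curry (fun u => (\prod_(j : J) (2 ^+ D)^-1) * F u)).
apply: eq_bigr => y _; rewrite mulrC; congr (_ * _).
rewrite -exprVn.
transitivity (\prod_(p : J * 'I_D) (2^-1 : R)).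
  by apply: eq_bigr => p _; rewrite big_pred1_eq.
by rewrite !prodr_const card_prod card_ord mulnC exprM.
Qed.

(** A digit modulo n - j takes each value with probability at least (1 - eps) / (n - j), where [eps]
    is n / 2^D; the product over the digits is bounded below by Bernoulli's inequality. *)
Lemma key_position_point (f : {ffun J -> 'I_n}) : injective f ->
  (1 - #|J|%:R * eps) / (n ^_ #|J|)%:R <=
  \sum_(k : bits Delta) (2 ^+ Delta)^-1 * (key_position D J n_gt0 k == f)%:R.
Proof.
move=> /(digits_position_surj n_gt0)[a alt af].
pose G (u : {ffun J -> bits D}) : R := \prod_j (key_digit n j (u j) == a j)%:R.
apply: (@le_trans _ _ (\sum_(k : bits Delta) (2 ^+ Delta)^-1 * G [ffun j => key_chunk D k j])).
  rewrite sum_key_chunk /G.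
  rewrite [leRHS](eq_bigr (fun u : {ffun J -> bits D} =>
    \prod_j ((2 ^+ D)^-1 * (key_digit n j (u j) == a j)%:R))); last first.
    by move=> u _; rewrite big_split.
  rewrite (sum_ffun_prod (fun j (u : bits D) => (2 ^+ D)^-1 * (key_digit n j u == a j)%:R)).
  rewrite ffact_prod natr_prod.
  rewrite [X in _ / X](_ : _ = \prod_(j : J) (n - enum_rank j)%:R); last first.
    by rewrite (reindex (@enum_rank J))//; apply: onW_bij; exact: enum_rank_bij.
  have e01 : 0 <= eps <= 1.
    rewrite divr_ge0 ?exprn_ge0//= ler_pdivrMr ?exprn_gt0// mul1r -natrX ler_nat//.
  apply: (@le_trans _ _ (\prod_(j : J) ((1 - eps) / (n - enum_rank j)%:R))).
    rewrite big_split/= prodfV ler_wpM2r ?invr_ge0 ?prodr_ge0//.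
    exact: prod_ge_1subM.
  apply: ler_prod => j _; apply/andP; split.
    by rewrite divr_ge0 ?subr_ge0//; move: e01 => /andP[].
  rewrite -mulr_sumr -natr_sum.
  have -> : (\sum_(i : bits D) (key_digit n j i == a j) = #|[pred u : bits D | enum_rank u %% (n - enum_rank j) == a j]|)%N.
    by rewrite -[RHS]sum1_card [RHS]big_mkcond; apply: eq_bigr => u _; rewrite inE /key_digit; case: ifP.
  have njR : 0 < (n - enum_rank j)%:R :> R by rewrite ltr0n; apply: leq_ltn_trans (alt j).
  have cM : #|{: bits D}| = (2 ^ D)%N by rewrite card_ffun card_bool card_ord.
  have H : (2 ^ D %/ (n - enum_rank j) <= #|[pred u : bits D | enum_rank u %% (n - enum_rank j) == a j]|)%N.
    by rewrite -[X in (X %/ _)%N]cM; exact: (@card_modn_ge (bits D) _ _ (alt j)).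
  have M0 : 0 < 2 ^+ D :> R by rewrite exprn_gt0.
  rewrite [leRHS]mulrC ler_pdivlMr// mulrAC ler_pdivrMr//.
  rewrite /eps mulrBl mul1r divfK ?gt_eqF//.
  apply: (@le_trans _ _ ((2 ^ D %/ (n - enum_rank j)) * (n - enum_rank j))%:R).
    have := divn_eq (2 ^ D) (n - enum_rank j).
    have := ltn_pmod (2 ^ D) (leq_ltn_trans (leq0n _) (alt j)).
    rewrite lerBlDr -natrX -natrD ler_nat; lia.
  by rewrite natrM ler_wpM2r// ler_nat.
apply: ler_sum => k _; rewrite ler_wpM2l ?invr_ge0 ?exprn_ge0//.
rewrite /G prod_indicator ler_nat; case: forallP => //= H.
suff -> : key_position D J n_gt0 k = f by rewrite eqxx.
rewrite -af; apply/ffunP => j; rewrite !ffunE; congr (insubd _ (nth _ (lehmer _) _)).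
by apply: eq_map => i; have := H i; rewrite ffunE => /eqP.
Qed.

Lemma key_position_avg_ge (F : {ffun J -> 'I_n} -> R) : (forall f, 0 <= F f) ->
  (1 - #|J|%:R * eps) * avg_inj F <=
  \sum_(k : bits Delta) (2 ^+ Delta)^-1 * F (key_position D J n_gt0 k).
Proof.
move=> F0.
apply: (@le_trans _ _ (\sum_(f : {ffun J -> 'I_n} | injectiveb f)
   F f * \sum_(k : bits Delta) (2 ^+ Delta)^-1 * (key_position D J n_gt0 k == f)%:R)).
  rewrite /avg_inj mulrA mulr_sumr; apply: ler_sum => f /injectiveP fI.
  by rewrite mulrC ler_wpM2l// key_position_point.
under eq_bigr do rewrite mulr_sumr.
rewrite exchange_big/=; apply: ler_sum => k _.
rewrite (bigD1 (key_position D J n_gt0 k))/=; last by apply/injectiveP; exact: key_position_inj.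
rewrite eqxx mulr1 mulrC big1 ?addr0// => f /andP[_ /negbTE fk].
by rewrite eq_sym fk !mulr0.
Qed.

(** The lower bound applied to 1 - F. It lets every probability over the key be computed with
    uniform positions, at an additive cost [#|J|%:R * eps]. *)
Lemma key_position_avg_le (F : {ffun J -> 'I_n} -> R) : (forall f, 0 <= F f <= 1) ->
  \sum_(k : bits Delta) (2 ^+ Delta)^-1 * F (key_position D J n_gt0 k) <=
  avg_inj F + #|J|%:R * eps.
Proof.
move=> F01.
have := @key_position_avg_ge (fun f => 1 - F f).
move=> /(_ (fun f => ltac:(by rewrite subr_ge0; have /andP[] := F01 f))).
have -> : avg_inj (fun f => 1 - F f) = 1 - avg_inj F :> R.
  rewrite (_ : (fun f => 1 - F f) = (fun f => 1 + (-1) * F f)); last by apply/funext => f; rewrite mulN1r.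
  by rewrite avg_injD avg_injZ avg_inj_const// mulN1r.
have -> : \sum_(k : bits Delta) (2 ^+ Delta)^-1 * (1 - F (key_position D J n_gt0 k)) =
    1 - \sum_(k : bits Delta) (2 ^+ Delta)^-1 * F (key_position D J n_gt0 k).
  under eq_bigr do rewrite mulrBr mulr1.
  rewrite sumrB sumr_const card_ffun card_bool card_ord -[X in X - _]mulr_natl natrX divff ?expf_neq0//.
have A1 : 0 <= avg_inj F.
  by rewrite -(@avg_inj_const R n J 0)//; apply: avg_inj_le => f _; have /andP[] := F01 f.
have e0 : 0 <= #|J|%:R * eps by rewrite mulr_ge0// divr_ge0// exprn_ge0.
have : 0 <= (#|J|%:R * eps) * avg_inj F by rewrite mulr_ge0.
lra.
Qed.

End KeyLaw.

Lemma sum_inj_le (R : realDomainType) (I J : finType) (phi : I -> J) (P : pred I) (Q : pred J)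
    (h : J -> R) : injective phi -> (forall i, P i -> Q (phi i)) -> (forall j, 0 <= h j) ->
  \sum_(i | P i) h (phi i) <= \sum_(j | Q j) h j.
Proof.
move=> phiI PQ h0.
rewrite [leRHS](bigID (fun j => j \in phi @: [set i | P i]%SET))/= -[leLHS]addr0.
apply: lerD; last by apply: sumr_ge0.
rewrite (eq_bigl (fun j => j \in phi @: [set i | P i]%SET)).
  rewrite big_imset => [|i j _ _]; last exact: phiI.
  by rewrite le_eqVlt; apply/orP; left; apply/eqP; apply: eq_bigl => i; rewrite inE.
move=> j; apply: andb_idl => /imsetP[i]; rewrite inE => Pi ->; exact: PQ.
Qed.

(** * Random coding and expurgation *)

Section RandomCode.
Variables (R : realType) (T : finType) (p : T -> R).
Hypotheses (p0 : forall x, 0 <= p x) (p1 : \sum_x p x = 1).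
Variable U : finType.

Definition expect_code (F : {ffun U -> T} -> R) : R :=
  \sum_(C : {ffun U -> T}) (\prod_a p (C a)) * F C.

Lemma expect_codeD F G : expect_code (fun C => F C + G C) = expect_code F + expect_code G.
Proof. by rewrite /expect_code -big_split; apply: eq_bigr => C _; rewrite mulrDr. Qed.

Lemma expect_code_sum (I : finType) (P : pred I) (F : I -> {ffun U -> T} -> R) :
  expect_code (fun C => \sum_(i | P i) F i C) = \sum_(i | P i) expect_code (F i).
Proof.
rewrite /expect_code exchange_big/=; apply: eq_bigr => C _.
by rewrite mulr_sumr.
Qed.

Lemma expect_code_prod (F : U -> T -> R) :
  expect_code (fun C => \prod_a F a (C a)) = \prod_a \sum_x p x * F a x.
Proof.
rewrite /expect_code -(sum_ffun_prod (fun a x => p x * F a x)).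
by apply: eq_bigr => C _; rewrite big_split.
Qed.

Lemma expect_code1 u (f : T -> R) : expect_code (fun C => f (C u)) = \sum_x p x * f x.
Proof.
have := expect_code_prod (fun a x => if a == u then f x else 1).
rewrite (bigD1 u)//= eqxx [X in _ * X]big1 ?mulr1; last first.
  by move=> a /negbTE->; under eq_bigr do rewrite mulr1.
move=> <-; apply: eq_bigr => C _; congr (_ * _).
by rewrite (bigD1 u)//= eqxx big1 ?mulr1// => a /negbTE->.
Qed.

Lemma expect_code2 u u' (f g : T -> R) : u != u' ->
  expect_code (fun C => f (C u) * g (C u')) = (\sum_x p x * f x) * (\sum_x p x * g x).
Proof.
move=> uu'; have u'u : (u' == u) = false by rewrite eq_sym (negbTE uu').
have := expect_code_prod (fun a x => if a == u then f x else if a == u' then g x else 1).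
rewrite (bigD1 u)//= eqxx (bigD1 u') ?u'u//= eqxx.
rewrite [X in _ * (_ * X)]big1 ?mulr1; last first.
  by move=> a /andP[/negbTE-> /negbTE->]; under eq_bigr do rewrite mulr1.
move=> <-; apply: eq_bigr => C _; congr (_ * _).
rewrite (bigD1 u)//= eqxx (bigD1 u') ?u'u//= eqxx.
by rewrite big1 ?mulr1// => a /andP[/negbTE-> /negbTE->].
Qed.

Lemma expect_code_exists F (e : R) : expect_code F <= e -> exists C, F C <= e.
Proof.
move=> Fe; apply: contrapT => /forallNP H.
have : e < expect_code F; last by rewrite ltNge Fe.
have P1 : \sum_(C : {ffun U -> T}) \prod_a p (C a) = 1.
  by rewrite (sum_ffun_prod (fun _ => p)) big1.
rewrite -subr_gt0 -[e]mul1r -P1 mulr_suml -sumrB.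
under eq_bigr do rewrite -mulrBr.
have F0 C : 0 < F C - e by rewrite subr_gt0 ltNge; exact/negP/H.
rewrite lt_neqAle; apply/andP; split; last first.
  by apply: sumr_ge0 => C _; rewrite mulr_ge0 ?prodr_ge0// ltW.
apply/eqP => /esym/eqP; rewrite psumr_eq0; last first.
  by move=> C _; rewrite mulr_ge0 ?prodr_ge0// ltW.
move=> /allP H0.
have : \sum_(C : {ffun U -> T}) \prod_a p (C a) = 0.
  apply: big1 => C _; have /= := H0 C (mem_index_enum _).
  by rewrite mulf_eq0 (gt_eqF (F0 C)) orbF => /eqP.
by move/eqP; rewrite P1 oner_eq0.
Qed.

End RandomCode.

Section Codebook.
Variables (R : realType) (l b : nat) (rho : R) (g : bool -> bool -> R) (theta : R) (w : nat).
Variables (T T0 : finType) (V : T -> bool -> bool -> R) (V0 : T0 -> bool -> R).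
Variables (e1 e2 e3 : R).

Let p (x : bits l) := \prod_i bernoulli_pmf rho (x i).
(** Threshold test of a word against an output; [g] will be the information density. It does not
    involve the actual channel, so one decoder serves them all. *)
Definition passes (x y : bits l) : bool := theta <= \sum_i g (x i) (y i).

(** Draw 2^(b+1) words i.i.d. The badness of a word adds up, over all channels, the failure of its
    own test ([e1]), false acceptances of the other words ([e2] each) and the indicator of excessive
    weight ([e3]). Its mean is at most eps / 2, so some draw has at least half of its words with
    badness at most eps, and 2^b of those are kept; dropping words only lowers the errors of the
    rest. *)
Lemma codebook_exists : 0 <= rho <= 1 ->
  (forall t x y, 0 <= V t x y) -> (forall t x, \sum_y V t x y = 1) ->
  (forall t y, 0 <= V0 t y) -> (forall t, \sum_y V0 t y = 1) ->
  (forall t, \sum_x p x * \sum_(y : bits l) (\prod_i V t (x i) (y i)) * (~~ passes x y)%:R <= e1) ->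
  (forall y, \sum_x p x * (passes x y)%:R <= e2) ->
  \sum_x p x * (w < hamming_weight x)%N%:R <= e3 -> 0 <= e1 -> 0 <= e2 -> 0 < e3 ->
  let eps := 2 * (#|T|%:R * (e1 + 2 ^+ b.+1 * e2) + #|T0|%:R * (2 ^+ b.+1 * e2) + e3) in
  eps < 1 ->
  exists C : bits b -> bits l,
  [/\ forall t u, \sum_(y : bits l) (\prod_i V t (C u i) (y i)) *
        ((~~ passes (C u) y)%:R + \sum_(u' | u' != u) (passes (C u') y)%:R) <= eps,
      forall t, \sum_(y : bits l) (\prod_i V0 t (y i)) *
        \sum_u (passes (C u) y)%:R <= eps &
      forall u, (hamming_weight (C u) <= w)%N].
Proof.
move=> rho01 V_ge0 V1 V0_ge0 V01 h1 h2 h3 e1_ge0 e2_ge0 e3_gt0 eps eps1.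
(* One more bit than needed, so that half of the words can be discarded. *)
pose U := bits b.+1.
have cU : #|{: U}| = (2 ^ b.+1)%N by rewrite card_ffun card_bool card_ord.
have p_ge0 x : 0 <= p x by exact: prod_bernoulli_ge0.
have p1 : \sum_x p x = 1 by exact: sum_prod_bernoulli.
pose bad1 t (C : {ffun U -> bits l}) u := \sum_(y : bits l) (\prod_i V t (C u i) (y i)) *
        ((~~ passes (C u) y)%:R + \sum_(u' | u' != u) (passes (C u') y)%:R).
pose bad2 t (C : {ffun U -> bits l}) := \sum_(y : bits l) (\prod_i V0 t (y i)) *
        \sum_u (passes (C u) y)%:R.
pose bad (C : {ffun U -> bits l}) u := \sum_t bad1 t C u + \sum_t bad2 t C + (w < hamming_weight (C u))%N%:R.
have VV t x : \sum_(y : bits l) \prod_i V t (x i) (y i) = 1.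
  by rewrite (sum_ffun_prod (fun i => V t (x i))) big1.
have VV0 t : \sum_(y : bits l) \prod_i V0 t (y i) = 1.
  by rewrite (sum_ffun_prod (fun i => V0 t)) big1.
have U2 (a : R) : \sum_(u : U) a = 2 ^+ b.+1 * a.
  by rewrite sumr_const cU -[LHS]mulr_natl natrX.
have Ebad1 t u : expect_code p (fun C => bad1 t C u) <= e1 + 2 ^+ b.+1 * e2.
  have -> : (fun C => bad1 t C u) = (fun C : {ffun U -> bits l} =>
      \sum_(y : bits l) (\prod_i V t (C u i) (y i)) * (~~ passes (C u) y)%:R +
      \sum_(u' | u' != u) \sum_(y : bits l) (\prod_i V t (C u i) (y i)) * (passes (C u') y)%:R).
    apply/funext => C; rewrite exchange_big/= -big_split/=; apply: eq_bigr => y _.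
    by rewrite mulrDr mulr_sumr.
  rewrite expect_codeD; apply: lerD.
    by rewrite (expect_code1 p1 u (fun x => \sum_(y : bits l) (\prod_i V t (x i) (y i)) * (~~ passes x y)%:R)).
  rewrite expect_code_sum -U2 [leRHS](bigID (fun u' => u' != u))/= -[leLHS]addr0.
  apply: lerD; last by apply: sumr_ge0.
  apply: ler_sum => u' uu'; rewrite expect_code_sum.
  apply: (@le_trans _ _ (\sum_(y : bits l) (\sum_x p x * \prod_i V t (x i) (y i)) * e2)).
    apply: ler_sum => y _.
    rewrite (@expect_code2 _ _ p p1 U u u' (fun x : bits l => \prod_i V t (x i) (y i)) (fun x => (passes x y)%:R)) 1?eq_sym//.
    rewrite ler_wpM2l// sumr_ge0// => x _; rewrite mulr_ge0// prodr_ge0//.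
  rewrite -mulr_suml exchange_big/=.
  under eq_bigr do rewrite -mulr_sumr VV mulr1.
  by rewrite p1 mul1r.
have Ebad2 t : expect_code p (bad2 t) <= 2 ^+ b.+1 * e2.
  rewrite /bad2 expect_code_sum -U2.
  apply: (@le_trans _ _ (\sum_(y : bits l) (\prod_i V0 t (y i)) * \sum_(u : U) e2)).
    apply: ler_sum => y _; rewrite mulr_sumr.
    have -> : (fun C : {ffun U -> bits l} => (\prod_i V0 t (y i)) * \sum_u (passes (C u) y)%:R) =
      (fun C => \sum_u (\prod_i V0 t (y i)) * (passes (C u) y)%:R).
      by apply/funext => C; rewrite mulr_sumr.
    rewrite expect_code_sum; apply: ler_sum => u _.
    rewrite (expect_code1 p1 u (fun x => (\prod_i V0 t (y i)) * (passes x y)%:R))/=.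
    under eq_bigr do rewrite mulrCA.
    by rewrite -mulr_sumr ler_wpM2l// prodr_ge0.
  by rewrite -mulr_suml VV0 mul1r.
have Ebad u : expect_code p (fun C => bad C u) <= eps / 2.
  rewrite /bad !expect_codeD !expect_code_sum.
  rewrite [eps](mulrC 2) mulfK//; apply: lerD; first apply: lerD.
  - rewrite mulr_natl -sumr_const; apply: ler_sum => t _; exact: Ebad1.
  - rewrite mulr_natl -sumr_const; apply: ler_sum => t _; exact: Ebad2.
  - by rewrite (expect_code1 p1 u (fun x => (w < hamming_weight x)%N%:R)).
have [C HC] : exists C, \sum_u bad C u <= 2 ^+ b.+1 * (eps / 2).
  apply: (expect_code_exists p_ge0 p1); rewrite expect_code_sum -U2.
  by apply: ler_sum => u _.
have bad1_ge0 t u : 0 <= bad1 t C u.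
  apply: sumr_ge0 => y _; rewrite mulr_ge0 ?prodr_ge0// addr_ge0// sumr_ge0//.
have bad2_ge0 t : 0 <= bad2 t C.
  by apply: sumr_ge0 => y _; rewrite mulr_ge0 ?prodr_ge0// sumr_ge0.
have bad_ge0 u : 0 <= bad C u.
  by rewrite !addr_ge0// sumr_ge0.
have e2_0 : 0 <= 2 ^+ b.+1 * e2 by rewrite mulr_ge0// exprn_ge0.
have eps0 : 0 < eps.
  by rewrite mulr_gt0// ltr_wpDl// addr_ge0 ?mulr_ge0// addr_ge0.
pose good := [pred u | bad C u <= eps].
have cgood : (2 ^ b <= #|good|)%N.
  have h : #|[predC good]|%:R * eps <= 2 ^+ b * eps.
    rewrite mulr_natl -sumr_const.
    have -> : 2 ^+ b * eps = 2 ^+ b.+1 * (eps / 2) :> R by rewrite exprS; field.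
    apply: le_trans HC.
    rewrite [leRHS](bigID (mem [predC good]))/= -[leLHS]addr0.
    apply: lerD; last by apply: sumr_ge0.
    by apply: ler_sum => u; rewrite !inE -ltNge => /ltW.
  rewrite ler_pM2r// -natrX ler_nat in h.
  by rewrite -(leq_add2r #|[predC good]|) (cardC good) cU expnS mul2n -addnn leq_add2l.
have cb : #|{: bits b}| = (2 ^ b)%N by rewrite card_ffun card_bool card_ord.
have cbg : (#|{: bits b}| <= #|good|)%N by rewrite cb.
pose phi (u : bits b) : U := enum_val (widen_ord cbg (enum_rank u)).
have phiI : injective phi.
  by move=> u u' /enum_val_inj /(congr1 val)/= /val_inj/enum_rank_inj.
have phig u : bad C (phi u) <= eps.
  by have := enum_valP (widen_ord cbg (enum_rank u)); rewrite inE.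
exists (fun u => C (phi u)); split.
- move=> t u; apply: le_trans (phig u).
  apply: (@le_trans _ _ (bad1 t C (phi u))).
    apply: ler_sum => y _; rewrite ler_wpM2l ?prodr_ge0// lerD2l.
    apply: (@sum_inj_le _ _ _ phi (fun u' => u' != u) (fun u' => u' != phi u) (fun a => (passes (C a) y)%:R)) => // u'.
    by rewrite (inj_eq phiI).
  rewrite /bad -addrA (bigD1 t)//= -addrA lerDl !addr_ge0// sumr_ge0//.
(* [bad2] does not depend on the word, so any kept word bounds it. *)
- move=> t; apply: le_trans (phig [ffun=> false]).
  apply: (@le_trans _ _ (bad2 t C)).
    apply: ler_sum => y _; rewrite ler_wpM2l ?prodr_ge0//.
    exact: (@sum_inj_le _ _ _ phi xpredT xpredT (fun a => (passes (C a) y)%:R)).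
  rewrite /bad [X in _ + X + _](bigD1 t)//= addrAC addrCA lerDl !addr_ge0// sumr_ge0//.
(* An overweight word alone has badness at least 1 > eps. *)
- move=> u; rewrite leqNgt; apply/negP => wu.
  have := phig u; rewrite /bad wu.
  have h4 : 0 <= \sum_t bad1 t C (phi u) by rewrite sumr_ge0.
  have h5 : 0 <= \sum_t bad2 t C by rewrite sumr_ge0.
  rewrite /=; lra.
Qed.

End Codebook.

(** * The channel created by a jammer ignorant of the positions *)

Section Jamming.
Variables (R : realType) (n l : nat) (J K : finType) (q : R) (iota : K -> 'I_l -> J).
Hypotheses (n_gt0 : (0 < n)%N) (Jn : (#|J| <= n)%N) (q0 : 0 < q) (q_lt : q < 1 / 2).
Hypothesis iotaI : forall k, injective (iota k).
Implicit Types (z s : bits n) (c : J -> bool).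

(** Normalizing constant of the law of the position of a code bit 1 given z. *)
Definition mean_ratio z : R := n%:R^-1 * \sum_a flip_ratio q (z a).
Definition jam_rate0 s : R := n%:R^-1 * \sum_a (s a)%:R.
(** Probability that [s] flips a code bit 1 whose position has density proportional to [flip_ratio];
    [jam_rate0] is its analogue for a code bit 0, whose position is uniform. *)
Definition jam_rate1 z s : R :=
  (n%:R^-1 * \sum_a (s a)%:R * flip_ratio q (z a)) / mean_ratio z.

Definition flip_channel (alpha beta : R) (x y : bool) : R :=
  if x then bernoulli_pmf (1 - beta) y else bernoulli_pmf alpha y.

Let nR : n%:R != 0 :> R. Proof. by rewrite pnatr_eq0 -lt0n. Qed.

Let mean1 : \sum_(a < n) n%:R^-1 = 1 :> R.
Proof. by rewrite sumr_const card_ord -[LHS]mulr_natl divff. Qed.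

Lemma sum_flip_channel z s (x y : bool) : mean_ratio z != 0 ->
  \sum_(a < n | (x (+) s a) == y) n%:R^-1 * (if x then flip_ratio q (z a) else 1) =
  (if x then mean_ratio z else 1) * flip_channel (jam_rate0 s) (jam_rate1 z s) x y.
Proof.
move=> m0; rewrite big_mkcond/= /flip_channel /bernoulli_pmf /jam_rate0 /jam_rate1.
case: x; case: y => /=.
- rewrite mulrBr mulr1 mulrCA divff// mulr1 /mean_ratio -mulrBr -sumrB mulr_sumr.
  apply: eq_bigr => a _; case: (s a) => /=; ring.
- rewrite subKr mulrCA divff// mulr1 mulr_sumr.
  apply: eq_bigr => a _; case: (s a) => /=; ring.
- rewrite mul1r mulr_sumr; apply: eq_bigr => a _; case: (s a) => /=; ring.
- rewrite mul1r -[X in X - _]mean1 mulr_sumr -sumrB; apply: eq_bigr => a _; case: (s a) => /=; ring.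
Qed.

Lemma sum_flip_block c z s k (err : bits l -> R) : mean_ratio z != 0 ->
  \sum_(f : {ffun J -> 'I_n}) (\prod_j (n%:R^-1 * (if c j then flip_ratio q (z (f j)) else 1))) *
    err [ffun i => c (iota k i) (+) s (f (iota k i))] =
  (\prod_j (if c j then mean_ratio z else 1)) *
  \sum_(y : bits l) (\prod_i flip_channel (jam_rate0 s) (jam_rate1 z s) (c (iota k i)) (y i)) * err y.
Proof.
move=> m0.
rewrite (sum_prod_marginal (fun j a => n%:R^-1 * (if c j then flip_ratio q (z a) else 1))
  (fun i a => c (iota k i) (+) s a) err (@iotaI k)).
rewrite [X in _ = X * _](bigID (mem (codom (iota k))))/= -mulrA mulrCA; congr (_ * _).
  apply: eq_bigr => j _; rewrite -mulr_sumr; case: (c j); first by [].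
  by rewrite mulr_sumr; under eq_bigr do rewrite mulr1.
have cu : uniq (codom (iota k)) by rewrite (map_inj_uniq (@iotaI k)) enum_uniq.
rewrite -(big_uniq _ cu) big_image mulr_sumr; apply: eq_bigr => y _.
rewrite mulrC mulrA; congr (_ * _); rewrite -big_split; apply: eq_bigr => i _.
exact: sum_flip_channel.
Qed.

(** Distinct positions are replaced by independent ones at the price of a factor, bounded when
    [#|J|] is O(sqrt n). *)
Lemma avg_inj_le_all (F : {ffun J -> 'I_n} -> R) : (forall f, 0 <= F f) ->
  avg_inj F <= (n%:R ^+ #|J| / (n ^_ #|J|)%:R) *
    \sum_(f : {ffun J -> 'I_n}) (\prod_(j : J) n%:R^-1) * F f.
Proof.
move=> F0; rewrite -mulr_sumr prodr_const exprVn mulrACA divff ?expf_neq0// mul1r.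
rewrite ler_wpM2l ?invr_ge0//.
rewrite [leRHS](bigID (fun f : {ffun J -> 'I_n} => injectiveb f))/= lerDl.
exact: sumr_ge0.
Qed.

Variables (c : J -> bool) (typ : pred (bits n)) (W : bits n -> bits n -> R).
Variables (err : {ffun J -> bool} -> R) (errk : K -> bits l -> R) (eps Lam : R).
Hypotheses (W0 : forall z s, 0 <= W z s) (W1 : forall z, \sum_s W z s = 1).
Hypotheses (err01 : forall v, 0 <= err v <= 1) (errk0 : forall k y, 0 <= errk k y).
Hypothesis err_errk : forall v, err v <= \sum_k errk k [ffun i => v (iota k i)].
Hypothesis errk_eps : forall z s k, typ z -> W z s != 0 ->
  \sum_(y : bits l) (\prod_i flip_channel (jam_rate0 s) (jam_rate1 z s) (c (iota k i)) (y i)) *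
    errk k y <= eps.
Hypothesis typ_pos : forall z, typ z -> 0 < mean_ratio z.
Hypothesis typ_Lam : forall z, typ z -> \prod_j (if c j then mean_ratio z else 1) <= Lam.
Hypotheses (eps0 : 0 <= eps) (Lam0 : 0 <= Lam).

Let q01 : 0 < q < 1. Proof. by have h := q_lt; rewrite q0/=; lra. Qed.
Let q01' : 0 <= q <= 1. Proof. by move: q01 => /andP[/ltW-> /ltW->]. Qed.
Let noise0 (z : bits n) : 0 <= noise_law q z. Proof. exact: prod_bernoulli_ge0. Qed.

(** The jammer sees only z, so after exchanging sums [s] is fixed while the positions are averaged
    under their posterior given z. Without distinctness that posterior is a product, each block goes
    through a memoryless channel, and a union bound over blocks applies. [Lam] pays for the
    normalization, and atypical z are counted as errors. *)
Lemma jam_bound :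
  avg_inj (fun f : {ffun J -> 'I_n} => \sum_e noise_law q e *
    \sum_s W (xorb_bits (place c f) e) s * err [ffun j => c j (+) s (f j)]) <=
  avg_inj (fun f : {ffun J -> 'I_n} =>
    \sum_e noise_law q e * (~~ typ (xorb_bits (place c f) e))%:R) +
  (n%:R ^+ #|J| / (n ^_ #|J|)%:R) * (Lam * (#|K|%:R * eps)).
Proof.
pose G z (f : {ffun J -> 'I_n}) := (typ z)%:R * \sum_s W z s *
  \sum_k errk k [ffun i => c (iota k i) (+) s (f (iota k i))].
have G0 z f : 0 <= G z f.
  by rewrite mulr_ge0// sumr_ge0// => s _; rewrite mulr_ge0// sumr_ge0.
apply: (@le_trans _ _ (avg_inj (fun f : {ffun J -> 'I_n} =>
   \sum_e noise_law q e * (~~ typ (xorb_bits (place c f) e))%:R) +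
   avg_inj (fun f => \sum_e noise_law q e * G (xorb_bits (place c f) e) f))).
  rewrite -avg_injD; apply: avg_inj_le => f fI; rewrite -big_split/=; apply: ler_sum => e _.
  rewrite -mulrDr ler_wpM2l//; set z := xorb_bits _ _.
  rewrite /G; case: (boolP (typ z)) => tz /=.
    rewrite add0r mul1r; apply: ler_sum => s _; rewrite ler_wpM2l//.
    apply: le_trans (err_errk _) _; apply: ler_sum => k _.
    rewrite le_eqVlt; apply/orP; left; apply/eqP; congr (errk k _).
    by apply/ffunP => i; rewrite !ffunE.
  rewrite mul0r addr0 -(W1 z); apply: ler_sum => s _.
  by rewrite ler_piMr//; have /andP[] := err01 [ffun j => c j (+) s (f j)].
rewrite lerD2l.
have r0 b : 0 <= flip_ratio q b := flip_ratio_ge0 b q01'.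
(* Change of measure: the observation is drawn from pure noise and weighted by the likelihood ratio
   of the placement. *)
rewrite (@eq_avg_inj _ _ _ _ (fun f => \sum_z noise_law q z *
   ((\prod_j (if c j then flip_ratio q (z (f j)) else 1)) * G z f))); last first.
  move=> f fI; rewrite (sum_noise_xor _ _ (fun z => G z f)); apply: eq_bigr => z _.
  rewrite noise_law_place ?mulrA//.
apply: le_trans (avg_inj_le_all _) _.
  move=> f; apply: sumr_ge0 => z _; rewrite mulr_ge0// mulr_ge0// prodr_ge0// => j _.
  by case: (c j) => //; exact: r0.
rewrite ler_wpM2l ?divr_ge0 ?exprn_ge0//.
rewrite [leLHS](eq_bigr (fun f : {ffun J -> 'I_n} => \sum_z (\prod_(j : J) n%:R^-1) *
  (noise_law q z * ((\prod_j (if c j then flip_ratio q (z (f j)) else 1)) * G z f)))); last first.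
  by move=> f _; rewrite mulr_sumr.
rewrite exchange_big/= -[leRHS]mul1r -[X in _ <= X * _](@sum_noise_law R n q) mulr_suml.
apply: ler_sum => z _.
rewrite [leLHS](eq_bigr (fun f : {ffun J -> 'I_n} => noise_law q z * ((\prod_(j : J) n%:R^-1) *
  ((\prod_j (if c j then flip_ratio q (z (f j)) else 1)) * G z f)))); last first.
  by move=> f _; rewrite mulrCA.
rewrite -mulr_sumr ler_wpM2l//.
have [tz|ntz] := boolP (typ z); last first.
  by rewrite big1 ?mulr_ge0// => f _; rewrite /G (negbTE ntz) mul0r !mulr0.
have m0 : mean_ratio z != 0 by rewrite gt_eqF// typ_pos.
have -> : \sum_(f : {ffun J -> 'I_n}) (\prod_(j : J) n%:R^-1) *
      ((\prod_j (if c j then flip_ratio q (z (f j)) else 1)) * G z f) =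
  \sum_s W z s * \sum_k (\prod_j (if c j then mean_ratio z else 1)) *
    \sum_(y : bits l) (\prod_i flip_channel (jam_rate0 s) (jam_rate1 z s) (c (iota k i)) (y i)) * errk k y.
  transitivity (\sum_s W z s * \sum_k \sum_(f : {ffun J -> 'I_n})
      (\prod_j (n%:R^-1 * (if c j then flip_ratio q (z (f j)) else 1))) *
      errk k [ffun i => c (iota k i) (+) s (f (iota k i))]); last first.
    apply: eq_bigr => s _; congr (_ * _); apply: eq_bigr => k _.
    by rewrite sum_flip_block.
  transitivity (\sum_s \sum_(f : {ffun J -> 'I_n}) W z s *
      \sum_k (\prod_j (n%:R^-1 * (if c j then flip_ratio q (z (f j)) else 1))) *
      errk k [ffun i => c (iota k i) (+) s (f (iota k i))]); last first.
    by apply: eq_bigr => s _; rewrite exchange_big -mulr_sumr.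
  rewrite exchange_big; apply: eq_bigr => f _.
  rewrite /G tz mul1r mulrA -big_split/= mulr_sumr; apply: eq_bigr => s _.
  by rewrite mulrCA; congr (_ * _); rewrite mulr_sumr.
have P0 : 0 <= \prod_j (if c j then mean_ratio z else 1).
  by apply: prodr_ge0 => j _; case: (c j) => //; rewrite ltW// typ_pos.
rewrite -[leRHS]mul1r -[X in _ <= X * _](W1 z) mulr_suml; apply: ler_sum => s _.
have [->|Wzs] := eqVneq (W z s) 0; first by rewrite !mul0r.
rewrite ler_wpM2l// -mulr_sumr.
apply: (@le_trans _ _ (\prod_j (if c j then mean_ratio z else 1) * (#|K|%:R * eps))).
  rewrite ler_wpM2l// mulr_natl -sumr_const; apply: ler_sum => k _; exact: errk_eps.
by rewrite ler_wpM2r ?typ_Lam// mulr_ge0.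
Qed.

End Jamming.

(** * Circuit size calculus *)

Section Computable.
Variable X : Type.
Implicit Types (f g : X -> bool) (E F G : (X -> bool) -> Prop).

(** The constant false is always allowed as an input, since an undefined wire carries false. *)
Definition gate_over E f := exists op g h,
  [/\ E g \/ g = (fun=> false), E h \/ h = (fun=> false) & f = fun x => op (g x) (h x)].

Fixpoint derives E (fs : seq (X -> bool)) : Prop :=
  if fs is f :: fs' then gate_over E f /\ derives (fun g => g = f \/ E g) fs' else True.

(* From wires that carry the functions in [E], [s] gates yield all of [F]. *)
Definition computable E s F := exists fs,
  [/\ (size fs <= s)%N, derives E fs & forall f, F f -> List.In f fs \/ E f].

Definition union_wires E F f := E f \/ F f.

Lemma derives_sub E F fs : (forall f, E f -> F f) -> derives E fs -> derives F fs.
Proof.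
elim: fs E F => //= f fs IH E F EF [[op [g [h [Eg Eh ->]]]] d]; split.
  exists op, g, h; split=> //; first by case: Eg => [/EF|]; [left|right].
  by case: Eh => [/EF|]; [left|right].
by apply: IH d => g' [|/EF]; [left|right].
Qed.

Lemma derives_cat E fs gs : derives E fs ->
  derives (fun f => List.In f fs \/ E f) gs -> derives E (fs ++ gs).
Proof.
elim: fs E => /= [|f fs IH] E; first by move=> _; apply: derives_sub => f [].
move=> [Ef d] dg; split=> //; apply: IH => //.
apply: derives_sub dg => g [[->|]|]; [by right; left|by left|by right; right].
Qed.

Lemma computable_sub E E' s s' F F' : (forall f, E f -> E' f) -> (s <= s')%N ->
  (forall f, F' f -> F f) -> computable E s F -> computable E' s' F'.
Proof.
move=> EE ss FF [fs [h1 h2 h3]]; exists fs; split; first exact: leq_trans ss.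
  exact: derives_sub h2.
by move=> f /FF/h3[|/EE]; [left|right].
Qed.

Lemma computable_bind E s s' F G : computable E s F ->
  computable (union_wires E F) s' G -> computable E (s + s') (union_wires F G).
Proof.
move=> [fs [s1 d1 h1]] [gs [s2 d2 h2]]; exists (fs ++ gs); split.
- by rewrite size_cat leq_add.
- apply: derives_cat => //; apply: derives_sub d2 => f [Ef|/h1//]; by right.
- move=> f [/h1|/h2].
    by case=> ?; [left; apply/List.in_or_app; left|right].
  case=> [?|]; first by left; apply/List.in_or_app; right.
  case=> [?|/h1[?|?]]; first by right.
    by left; apply/List.in_or_app; left.
  by right.
Qed.

Lemma computable_in E F : (forall f, F f -> E f) -> computable E 0 F.
Proof. by move=> FE; exists [::]; split=> // f /FE; right. Qed.

Lemma computable_union E s s' F G : computable E s F -> computable E s' G ->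
  computable E (s + s') (union_wires F G).
Proof.
by move=> h1 h2; apply: computable_bind h1 _; apply: computable_sub h2 => // f; left.
Qed.

Lemma computable_gate E op g h : E g -> E h ->
  computable E 1 (eq (fun x => op (g x) (h x))).
Proof.
move=> Eg Eh; exists [:: fun x => op (g x) (h x)]; split=> //=.
  by split=> //; exists op, g, h; split=> //; left.
by move=> f <-; left; left.
Qed.

Lemma computable_const E (b : bool) : computable E 1 (eq (fun=> b)).
Proof.
exists [:: fun=> b]; split=> //=; last by move=> f <-; left; left.
by split=> //; exists (fun _ _ => b), (fun=> false), (fun=> false); split=> //; right.
Qed.

Lemma computable_family (T : eqType) (s : seq T) E c (F : T -> (X -> bool) -> Prop) :
  (forall a, a \in s -> computable E c (F a)) ->
  computable E (size s * c) (fun f => exists2 a, a \in s & F a f).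
Proof.
elim: s => [|a s IH] H; first by apply: computable_in => f [].
have h1 := H a (mem_head _ _).
have h2 := IH (fun a' a's => H a' (mem_behead (s := a :: s) a's)).
apply: computable_sub (computable_union h1 h2) => //.
move=> f [a']; rewrite inE => /orP[/eqP->|a's] Fa; first by left.
by right; exists a'.
Qed.

Lemma computable_fold (T : eqType) (s : seq T) E (op : T -> bool -> bool -> bool) (b : bool)
    (f : T -> X -> bool) :
  (forall a, a \in s -> E (f a)) ->
  computable E (size s).+1 (eq (fun x => foldr (fun a r => op a (f a x) r) b s)).
Proof.
elim: s => [|a s IH] H; first exact: computable_const.
have h1 := IH (fun a' a's => H a' (mem_behead (s := a :: s) a's)).
rewrite -[(size (a :: s)).+1]addn1.
have Ea : E (f a) by apply: H; exact: mem_head.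
have h2 := computable_bind h1 (computable_gate (op a) (or_introl Ea) (or_intror erefl)).
by apply: computable_sub h2 => // g <-; right.
Qed.

Lemma computable_has (T : eqType) (s : seq T) E (f : T -> X -> bool) :
  (forall a, a \in s -> E (f a)) ->
  computable E (size s).+1 (eq (fun x => has (fun a => f a x) s)).
Proof.
move=> H; have := computable_fold (fun=> orb) false H.
by congr (computable _ _ (eq _)); apply/funext => x; elim: s {H} => //= a s ->.
Qed.

Lemma computable_all (T : eqType) (s : seq T) E (f : T -> X -> bool) :
  (forall a, a \in s -> E (f a)) ->
  computable E (size s).+1 (eq (fun x => all (fun a => f a x) s)).
Proof.
move=> H; have := computable_fold (fun=> andb) true H.
by congr (computable _ _ (eq _)); apply/funext => x; elim: s {H} => //= a s ->.
Qed.

(** Shannon expansion on the first wire: two smaller tables and a multiplexer of three gates. *)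
Lemma computable_table E (fs : seq (X -> bool)) (t : seq bool -> bool) :
  (forall f, List.In f fs -> E f) ->
  computable E (4 * 2 ^ size fs) (eq (fun x => t [seq f x | f <- fs])).
Proof.
(* The exact solution of c(0) = 1, c(k + 1) = 2 c(k) + 3. *)
suff : (forall f, List.In f fs -> E f) ->
  computable E (4 * 2 ^ size fs - 3) (eq (fun x => t [seq f x | f <- fs])).
  by move=> H Efs; apply: computable_sub (H Efs) => //; rewrite leq_subr.
elim: fs t => [|f fs IH] t H /=; first exact: computable_const.
have H' g : List.In g fs -> E g by move=> ?; apply: H; right.
pose g (b : bool) := fun x => t (b :: [seq f x | f <- fs]).
have hg b := IH (fun s => t (b :: s)) H'.
have hE : E f by apply: H; left.
have h1 := computable_union (hg true) (hg false).
have h2 : computable (union_wires E (union_wires (eq (g true)) (eq (g false)))) (1 + 1 + 1)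
   (eq (fun x => (f x && g true x) || (~~ f x && g false x))).
  have k1 := @computable_gate (union_wires E (union_wires (eq (g true)) (eq (g false)))) andb
     f (g true) (or_introl hE) (or_intror (or_introl erefl)).
  have k2 := @computable_gate (union_wires E (union_wires (eq (g true)) (eq (g false))))
     (fun u v => ~~ u && v) f (g false) (or_introl hE) (or_intror (or_intror erefl)).
  have k3 := computable_bind (computable_union k1 k2) (@computable_gate _ orb
    (fun x => f x && g true x) (fun x => ~~ f x && g false x) (or_intror (or_introl erefl))
    (or_intror (or_intror erefl))).
  by apply: computable_sub k3 => // h <-; right.
apply: computable_sub (computable_bind h1 h2) => //.
  have : (0 < 2 ^ size fs)%N by rewrite expn_gt0.
  rewrite expnS; lia.
move=> h <-; right; apply/funext => x; rewrite /g.
by case: (f x); rewrite ?orbF.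
Qed.

(** Turns dependence on few wires into a circuit without exhibiting a formula; with O(log n) wires
    the size is polynomial. All ingredients of the code that come from existence proofs are
    implemented in this way. *)
Lemma computable_determined E (fs : seq (X -> bool)) (phi : X -> bool) :
  (forall f, List.In f fs -> E f) ->
  (forall x y, (forall f, List.In f fs -> f x = f y) -> phi x = phi y) ->
  computable E (4 * 2 ^ size fs) (eq phi).
Proof.
move=> H D.
pose t (s : seq bool) := `[< exists2 x, [seq f x | f <- fs] = s & phi x >].
have := computable_table t H; congr (computable _ _ (eq _)).
apply/funext => x; apply/asboolP/idP => [[y E1 py]|px]; last by exists x.
rewrite (D x y)// => f ffs.
clear - E1 ffs; elim: fs E1 ffs => //= f' fs IH [E1 E2] [<-//|]; exact: IH.
Qed.

Lemma computable_realize (d s : nat) (inp : X -> seq bool) (outs : seq (X -> bool)) :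
  (forall x, size (inp x) = d) ->
  computable (fun f => f = (fun=> false) \/ exists2 i, (i < d)%N & f = fun x => nth false (inp x) i)
    s (fun f => List.In f outs) ->
  exists c : circuit, (circuit_size c <= s + size outs)%N /\
    forall x, run_circuit c (inp x) = [seq f x | f <- outs].
Proof.
move=> sz [fs [sfs dfs Hout]].
pose wired (ws : X -> seq bool) k f := f = (fun=> false) \/
  exists2 i, (i < k)%N & f = fun x => nth false (ws x) i.
have wiredE ws k f : (forall x, size (ws x) = k) -> wired ws k f ->
    exists i, f = fun x => nth false (ws x) i.
  move=> sk [->|[i _ ->]]; last by exists i.
  (* The index just past the defined wires reads false. *)
  by exists k; apply/funext => x; rewrite nth_default// sk.
have gatesE : exists2 gs, size gs = size fs &
    forall x, foldl run_gate (inp x) gs = inp x ++ [seq f x | f <- fs].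
  move: dfs; rewrite -/(wired inp d); clear Hout sfs.
  suff G ws k E : (forall x, size (ws x) = k) -> (forall f, E f -> wired ws k f) ->
      derives E fs -> exists2 gs, size gs = size fs &
      forall x, foldl run_gate (ws x) gs = ws x ++ [seq f x | f <- fs].
    exact: G.
  elim: fs ws k E => [|f fs IH] ws k E sk Ews; first by move=> _; exists [::] => // x; rewrite cats0.
  move=> [[op [g [h [Eg Eh fE]]]] dfs].
  have [ig igE] : exists i, g = fun x => nth false (ws x) i.
    by apply: (wiredE ws k) => //; case: Eg => [/Ews//|->]; left.
  have [ih ihE] : exists i, h = fun x => nth false (ws x) i.
    by apply: (wiredE ws k) => //; case: Eh => [/Ews//|->]; left.
  have [||gs gs1 gs2] := IH (fun x => rcons (ws x) (f x)) k.+1 _ _ _ dfs.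
  - by move=> x; rewrite size_rcons sk.
  - move=> f' [->|/Ews[->|[i ik ->]]]; [|by left|].
      by right; exists k => //; apply/funext => x; rewrite nth_rcons sk ltnn eqxx.
    right; exists i; first exact: ltnW.
    by apply/funext => x; rewrite nth_rcons sk ik.
  exists (Gate op ig ih :: gs); first by rewrite /= gs1.
  move=> x /=; rewrite -cat_rcons -gs2; congr (foldl _ _ _).
  by rewrite /run_gate /= fE igE ihE.
have [gs gs1 gs2] := gatesE.
pose ws x := inp x ++ [seq f x | f <- fs].
have idx f : List.In f outs -> exists i, f = fun x => nth false (ws x) i.
  move=> /Hout[ffs|[->|[i id ->]]].
  - have [i ifs <-] : exists2 i, (i < size fs)%N & nth (fun=> false) fs i = f.
      clear - ffs; elim: fs ffs => //= g fs IH [->|/IH[i ifs <-]]; first by exists 0%N.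
      by exists i.+1.
    exists (d + i)%N; apply/funext => x.
    by rewrite /ws nth_cat sz ltnNge leq_addr/= addKn (nth_map (fun=> false)).
  - by exists (d + size fs)%N; apply/funext => x; rewrite nth_default// size_cat sz size_map.
  - by exists i; apply/funext => x; rewrite /ws nth_cat sz id.
have [is_ is1 is2] : exists2 is_ : seq nat, size is_ = size outs &
    forall x, [seq nth false (ws x) i | i <- is_] = [seq f x | f <- outs].
  clear - idx; elim: outs idx => [|f outs IH] idx; first by exists [::].
  have [i fi] := idx f (or_introl erefl).
  have [is_ h1 h2] := IH (fun g gi => idx g (or_intror gi)).
  by exists (i :: is_) => [|x] /=; rewrite ?h1// h2 fi.
exists (Circuit gs is_); split; first by rewrite /circuit_size /= gs1 is1 leq_add2r.
by move=> x; rewrite /run_circuit /= gs2 is2.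
Qed.

End Computable.

(** * Binary numbers on wires *)

Section BinaryNotation.

Definition bit (a i : nat) : bool := odd (a %/ 2 ^ i).

Lemma bitS a i : bit a i.+1 = bit (a %/ 2) i.
Proof. by rewrite /bit expnS divnMA. Qed.

Lemma bit_inj L a b : (a < 2 ^ L)%N -> (b < 2 ^ L)%N ->
  (forall i, (i < L)%N -> bit a i = bit b i) -> a = b.
Proof.
elim: L a b => [|L IH] a b; first by rewrite expn0 !ltnS !leqn0 => /eqP-> /eqP->.
move=> aL bL ab.
have h : (a %/ 2 = b %/ 2)%N.
  apply: IH => [||i iL]; rewrite ?ltn_divLR// -?expnSr//.
  by rewrite -!bitS ab.
rewrite (divn_eq a 2) (divn_eq b 2) h !modn2.
by have := ab 0%N isT; rewrite /bit expn0 !divn1 => ->.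
Qed.

Lemma bit_large a i : (a < 2 ^ i)%N -> bit a i = false.
Proof. by move=> ai; rewrite /bit divn_small. Qed.

Definition bits_val (beta : nat -> bool) K := (\sum_(i < K) beta i * 2 ^ i)%N.

Lemma bits_val_lt beta K : (bits_val beta K < 2 ^ K)%N.
Proof.
elim: K => [|K IH]; first by rewrite /bits_val big_ord0.
rewrite /bits_val big_ord_recr/= expnS mul2n -addnn -addSn leq_add//.
by case: (beta K); rewrite ?mul1n ?mul0n// expn_gt0.
Qed.

Lemma bit_bits_val beta K i : (i < K)%N -> bit (bits_val beta K) i = beta i.
Proof.
elim: K beta i => // K IH beta i iK.
have E : bits_val beta K.+1 = (beta 0%N + bits_val (fun i => beta i.+1) K * 2)%N.
  rewrite /bits_val big_ord_recl/= expn0 muln1 big_distrl/=; congr (_ + _)%N.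
  by apply: eq_bigr => j _; rewrite expnSr mulnA.
case: i iK => [|i] iK.
  by rewrite /bit expn0 divn1 E oddD oddM andbF addbF; case: (beta 0%N).
rewrite bitS E addnC divnMDl// divn_small ?addn0 ?IH//.
by case: (beta 0%N).
Qed.

Lemma bits_val_bit a K : (a < 2 ^ K)%N -> bits_val (bit a) K = a.
Proof.
move=> aK; apply: (@bit_inj K) => //; first exact: bits_val_lt.
by move=> i iK; rewrite bit_bits_val.
Qed.

(** Lexicographic comparison from the most significant bit, in the shape of a fold so that it costs
    linearly many gates. *)
Lemma compare_bits beta a K :
  foldr (fun i r => if beta i == bit a i then r else ~~ beta i) true (rev (iota 0 K))
  = (bits_val beta K <= bits_val (bit a) K)%N.
Proof.
elim: K => [|K IH]; first by rewrite /bits_val !big_ord0.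
rewrite -addn1 iotaD rev_cat/= add0n addn1 IH /bits_val !big_ord_recr/=.
rewrite -/(bits_val beta K) -/(bits_val (bit a) K).
have := bits_val_lt beta K; have := bits_val_lt (bit a) K.
case: (beta K); case: (bit a K) => /=; rewrite ?mul1n ?mul0n; lia.
Qed.

End BinaryNotation.

Section NatWires.
Variable X : Type.
Implicit Types (E : (X -> bool) -> Prop) (F G : X -> nat).

Definition nat_wires L F : (X -> bool) -> Prop :=
  fun f => exists2 i, (i < L)%N & f = fun x => bit (F x) i.

Lemma computable_nat_pred E L F G (phi : X -> bool) :
  (forall f, nat_wires L F f -> E f) -> (forall f, nat_wires L G f -> E f) ->
  (forall x, F x < 2 ^ L)%N -> (forall x, G x < 2 ^ L)%N ->
  (forall x y, F x = F y -> G x = G y -> phi x = phi y) ->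
  computable E (4 * 2 ^ (L + L)) (eq phi).
Proof.
move=> EF EG FL GL D.
pose fs := [seq (fun x => bit (F x) i) | i <- iota 0 L] ++ [seq (fun x => bit (G x) i) | i <- iota 0 L].
have sz : size fs = (L + L)%N by rewrite size_cat !size_map size_iota.
have inm (H : X -> nat) f : List.In f [seq (fun x => bit (H x) i) | i <- iota 0 L] <-> nat_wires L H f.
  split.
    suff G0 k n : List.In f [seq (fun x => bit (H x) i) | i <- iota k n] ->
       exists2 i, (i < k + n)%N & f = fun x => bit (H x) i by exact: G0.
    elim: n k => //= n IH k [<-|/IH[i ik ->]]; first by exists k; rewrite // addnS ltnS leq_addr.
    by exists i; rewrite // -addSnnS.
  move=> [i iL ->].
  have := iL; rewrite -{1}(add0n L).
  suff G0 k n : (k <= i < k + n)%N -> List.In (fun x => bit (H x) i) [seq (fun x => bit (H x) i) | i <- iota k n].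
    by move=> ?; apply: G0.
  elim: n k => [|n IH] k /=; first by rewrite addn0; case: leqP => //= a b; lia.
  move=> /andP[ki ikn]; have [->|ne] := eqVneq k i; first by left.
  by right; apply: IH; lia.
rewrite -sz; apply: computable_determined => [f ffs|x y fxy].
  by have [/(inm F f).1/EF|/(inm G f).1/EG] := List.in_app_or _ _ _ ffs.
apply: D.
- apply: (bit_inj (FL x) (FL y)) => i iL.
  by apply: (fxy (fun x => bit (F x) i)); apply/List.in_or_app; left; apply/inm; exists i.
- apply: (bit_inj (GL x) (GL y)) => i iL.
  by apply: (fxy (fun x => bit (G x) i)); apply/List.in_or_app; right; apply/inm; exists i.
Qed.

Lemma computable_nat_op E L F G (op : nat -> nat -> nat) :
  (forall f, nat_wires L F f -> E f) -> (forall f, nat_wires L G f -> E f) ->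
  (forall x, F x < 2 ^ L)%N -> (forall x, G x < 2 ^ L)%N ->
  computable E (L * (4 * 2 ^ (L + L))) (nat_wires L (fun x => op (F x) (G x))).
Proof.
move=> EF EG FL GL.
have step i : i \in iota 0 L ->
    computable E (4 * 2 ^ (L + L)) (eq (fun x => bit (op (F x) (G x)) i)).
  by move=> _; apply: (computable_nat_pred EF EG) => // x y -> ->.
have := computable_family step; rewrite size_iota; apply: computable_sub => //.
by move=> f [i iL ->]; exists i => //; rewrite mem_iota.
Qed.

(** Dynamic programming: with [P x t r] the entry r of the decoding of the digits from t on,
    [P x t r.+1] is [bump (a x t) (P x t.+1 r)]. Each of the at most m^2 entries is a function of
    two L-bit numbers. *)
Lemma computable_lehmer E L n m (a : X -> nat -> nat) :
  (n < 2 ^ L)%N -> (forall x i, (i < m)%N -> (a x i < n - i)%N) ->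
  (forall i f, (i < m)%N -> nat_wires L (a^~ i) f -> E f) ->
  computable E (m * (m * (L * (4 * 2 ^ (L + L))))) (fun f => exists2 r, (r < m)%N &
     nat_wires L (fun x => nth 0%N (lehmer (mkseq (a x) m)) r) f).
Proof.
move=> nL an Ea; pose P x t r := nth 0%N (lehmer (mkseq (fun i => a x (t + i)%N) (m - t))) r.
have P0 x t : (t < m)%N -> P x t 0%N = a x t.
  by move=> tm; rewrite /P -(subnSK tm) /= addn0.
have PS x t r : (t + r.+1 < m)%N -> P x t r.+1 = bump (a x t) (P x t.+1 r).
  move=> trm; have tm : (t < m)%N by lia.
  rewrite /P -(subnSK tm) /= addn0 (nth_map 0%N).
    congr (bump _ (nth _ (lehmer _) _)).
    rewrite /mkseq (iotaDl 1 0) -map_comp; apply: eq_map => i /=.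
    by rewrite addnA addn1.
  by rewrite size_lehmer size_map size_iota; lia.
have PL x t r : (t + r < m)%N -> (P x t r < 2 ^ L)%N.
  move=> trm; apply: leq_ltn_trans nL.
  suff /allP H : all (fun y => y < n - t)%N (lehmer (mkseq (fun i => a x (t + i)%N) (m - t))).
    have : (P x t r < n - t)%N.
      by apply: H; rewrite mem_nth// size_lehmer size_mkseq; lia.
    lia.
  apply: lehmer_lt => j; rewrite size_mkseq => jm.
  rewrite nth_mkseq//; have := an x (t + j)%N; rewrite subnDA; apply; lia.
suff H r : computable E (r * (m * (L * (4 * 2 ^ (L + L))))) (fun f => exists2 p,
    (p.1 + p.2 < m)%N && (p.2 < r)%N & nat_wires L (fun x => P x p.1 p.2) f).
  apply: computable_sub (H m) => // f [r' rm wf]; exists (0%N, r'); first by rewrite /= rm.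
  case: wf => i iL ->; exists i => //; apply/funext => x /=.
  by rewrite /P subn0.
elim: r => [|r IH]; first by apply: computable_in => f [p]; rewrite ltn0 andbF.
rewrite mulSn addnC.
set c := (L * _)%N in IH *.
have step : forall t, t \in iota 0 m -> computable (union_wires E (fun f => exists2 p,
    (p.1 + p.2 < m)%N && (p.2 < r)%N & nat_wires L (fun x => P x p.1 p.2) f)) c
    (fun f => (t + r < m)%N /\ nat_wires L (fun x => P x t r) f).
  move=> t; rewrite mem_iota => /andP[_ tm].
  have [trm|ntrm] := pselect (t + r < m)%N; last first.
    by exists [::]; split=> // f [].
  case: r trm {IH} => [|r] trm.
    exists [::]; split=> // f [_ [i iL ->]]; right; left; apply: (Ea t) => //; exists i => //.
    by apply/funext => x; rewrite P0.
  have -> : (fun f => (t + r.+1 < m)%N /\ nat_wires L (fun x => P x t r.+1) f) =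
      (fun f => (t + r.+1 < m)%N /\ nat_wires L (fun x => bump (a x t) (P x t.+1 r)) f).
    apply/funext => f; apply/propext; rewrite (_ : (fun x => P x t r.+1) = (fun x => bump (a x t) (P x t.+1 r)))//.
    by apply/funext => x; rewrite PS.
  set E' := union_wires _ _.
  have K := @computable_nat_op E' L (a^~ t) (fun x => P x t.+1 r) bump.
  apply: (computable_sub (fun _ => id) (leqnn _) _ (K _ _ _ _)).
  - by move=> f [].
  - by move=> f wf; left; apply: (Ea t) => //; lia.
  - by move=> f wf; right; exists (t.+1, r) => //=; lia.
  - by move=> x; have := an x t tm; lia.
  - by move=> x; apply: PL; lia.
have := computable_bind IH (computable_family step); rewrite size_iota.
apply: computable_sub => // f [[t r']] /= /andP[trm].
rewrite ltnS leq_eqVlt => /orP[/eqP rr|rr] wf.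
  by right; exists t; rewrite -?rr// mem_iota; lia.
by left; exists (t, r') => //=; rewrite trm.
Qed.
End NatWires.

Lemma computable_fin (X : Type) (T : finType) E c (F : T -> (X -> bool) -> Prop) :
  (forall a, computable E c (F a)) -> computable E (#|T| * c) (fun f => exists a, F a f).
Proof.
move=> H; have := computable_family (s := enum T) (fun a _ => H a).
rewrite -cardE; apply: computable_sub => // f [a Fa]; exists a => //.
by rewrite mem_enum.
Qed.

Lemma List_In_map (S T : Type) (f : S -> T) (s : seq S) y :
  List.In y (map f s) <-> exists2 x, List.In x s & f x = y.
Proof.
elim: s => [|a s IH] /=; first by split=> // -[].
split=> [[<-|/IH[x xs <-]]|[x [->|xs] fx]]; [by exists a; first left|by exists x; first right|by left|].
by right; apply/IH; exists x.
Qed.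

Lemma List_In_mem (T : eqType) (s : seq T) x : List.In x s <-> x \in s.
Proof.
elim: s => //= a s IH; rewrite inE; split=> [[->|/IH->]|/orP[/eqP->|/IH]]; rewrite ?eqxx ?orbT//; first by left.
by right.
Qed.

(** * The hidden code and its circuits *)

Section CodeCircuits.
Variables (n N Delta D B b l L : nat).
Hypotheses (n_gt0 : (0 < n)%N) (B_gt0 : (0 < B)%N) (NB : (N < 2 ^ (B * b))%N) (nL : (n < 2 ^ L)%N).
Variables (C : bits b -> bits l) (bdec : bits l -> option (bits b)).
Local Notation J := (('I_B * 'I_l)%type : finType).
Local Notation m := #|J|.
Hypothesis Jn : (m <= n)%N.

Definition msg_block (a : nat) (k : 'I_B) : bits b := [ffun i : 'I_b => bit a (k * b + i)].

Definition codeword (a : nat) (j : J) : bool := C (msg_block a j.1) j.2.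

(** A message is accepted only if every block decodes to its bits; the default [ord0] means that
    nothing was sent. *)
Definition decode_word (v : {ffun J -> bool}) : 'I_N.+1 :=
  odflt ord0 [pick a : 'I_N.+1 | [forall k, bdec [ffun i => v (k, i)] == Some (msg_block a k)]].

Definition positions (key : bits Delta) : {ffun J -> 'I_n} := key_position D J n_gt0 key.

Definition hidden_code : jam_code n N Delta :=
  @Code n N Delta
    (fun t a key => if t then place (codeword a) (positions key) else [ffun=> false])
    (fun y key => decode_word [ffun j => y (positions key j)])
    (fun _ _ => erefl).

Lemma msg_block_inj (a a' : nat) : (a < 2 ^ (B * b))%N -> (a' < 2 ^ (B * b))%N ->
  (forall k, msg_block a k = msg_block a' k) -> a = a'.
Proof.
move=> aN a'N H; apply: (bit_inj aN a'N) => i iB.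
have b0 : (0 < b)%N by move: iB; case: (b) => //; rewrite muln0.
have kB : (i %/ b < B)%N by rewrite ltn_divLR.
have ib : (i %% b < b)%N by rewrite ltn_mod.
have /ffunP/(_ (Ordinal ib)) := H (Ordinal kB).
by rewrite !ffunE /= -divn_eq.
Qed.

Definition position_cost := (m * (L * (4 * 2 ^ D)) + m * (m * (L * (4 * 2 ^ (L + L)))) +
   m * n * (4 * 2 ^ (L + L)))%N.

(** The digits are tables on [D] key bits, the Lehmer code is decoded, and each position is compared
    with each coordinate. *)
Lemma computable_positions (X : Type) (E : (X -> bool) -> Prop) (key : X -> bits Delta) :
  (forall i, E (fun x => nth false (codom (key x)) i)) ->
  computable E position_cost
    (fun f => exists p : J * 'I_n, f = fun x => positions (key x) p.1 == p.2).
Proof.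
move=> Ek.
pose a x r := nth 0%N [seq key_digit n j (key_chunk D (key x) j) | j <- enum J] r.
have digit_lt (j : J) (u : bits D) : (key_digit n j u < n - enum_rank j)%N by exact: key_digit_lt.
have aE x (j : J) : a x (enum_rank j) = key_digit n j (key_chunk D (key x) j).
  have sz : (enum_rank j < size (enum J))%N by rewrite -cardE.
  rewrite /a (nth_map j)//.
  by rewrite -enum_val_nth enum_rankK.
have rk i : (i < m)%N -> exists j : J, i = enum_rank j :> nat.
  by move=> im; exists (enum_val (Ordinal im)); rewrite enum_valK.
have an x i : (i < m)%N -> (a x i < n - i)%N.
  by move=> /rk[j ->]; rewrite aE digit_lt.
have h1 : computable E (m * (L * (4 * 2 ^ D)))
    (fun f => exists j : J, nat_wires L (fun x => a x (enum_rank j)) f).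
  apply: computable_fin => j.
  have step i : i \in iota 0 L -> computable E (4 * 2 ^ D) (eq (fun x => bit (a x (enum_rank j)) i)).
    move=> _; pose fs := [seq (fun x => nth false (codom (key x)) (enum_rank j * D + i')) | i' : 'I_D <- enum 'I_D].
    have sz : size fs = D by rewrite size_map size_enum_ord.
    rewrite -[D in (2 ^ D)%N]sz.
    apply: computable_determined => [f /List_In_map[i' _ <-]|x y fxy]; first exact: Ek.
    rewrite !aE; congr (bit (key_digit n j _) i); apply/ffunP => i'; rewrite !ffunE.
    apply: (fxy (fun x => nth false (codom (key x)) (enum_rank j * D + i'))).
    by apply/List_In_map; exists i' => //; apply/List_In_mem; rewrite mem_enum.
  have := computable_family step; rewrite size_iota; apply: computable_sub => //.
  by move=> f [i iL ->]; exists i => //; rewrite mem_iota.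
have h2 := @computable_lehmer X (union_wires E (fun f => exists j : J, nat_wires L (fun x => a x (enum_rank j)) f)) L n m a nL an.
have h3 := computable_bind h1 (h2 _).
apply: computable_sub (computable_bind (h3 _) (s' := m * n * (4 * 2 ^ (L + L)))
  (G := fun f => exists p : J * 'I_n, f = fun x => positions (key x) p.1 == p.2) _) => //.
- by move=> f; right.
- by move=> i f im wf; right; have [j jE] := rk i im; exists j; rewrite -jE.
have posE x (j : J) : positions (key x) j = nth 0%N (lehmer (mkseq (a x) m)) (enum_rank j) :> nat.
  rewrite val_digits_position; last by move=> i; exact: digit_lt.
  congr (nth _ (lehmer _) _); rewrite /a; set s := map _ _.
  have -> : m = size s by rewrite size_map -cardE.
  by rewrite mkseq_nth.
have -> : (m * n = #|{: 'I_B * 'I_l * 'I_n}|)%N by rewrite [RHS]card_prod card_ord.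
apply: computable_fin => -[j i] /=.
have PL x : (nth 0 (lehmer (mkseq (a x) m)) (enum_rank j) < 2 ^ L)%N.
  by rewrite -posE; apply: ltn_trans nL.
have wr f : nat_wires L (fun x => nth 0%N (lehmer (mkseq (a x) m)) (enum_rank j)) f ->
    union_wires E (union_wires (fun f => exists j : J, nat_wires L (fun x => a x (enum_rank j)) f)
      (fun f => exists2 r, (r < m)%N & nat_wires L (fun x => nth 0%N (lehmer (mkseq (a x) m)) r) f)) f.
  by move=> wf; right; right; exists (enum_rank j) => //; exact: (ltn_ord (enum_rank j)).
have K := computable_nat_pred wr wr PL PL (phi := fun x => positions (key x) j == i).
apply: (computable_sub _ (leqnn _) _ (K _)) => [|f ->|x y E1 _] //.
by rewrite -!val_eqE/= !posE E1.
Qed.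

Lemma exists_has (T : finType) (P : pred T) : [exists x, P x] = has P (enum T).
Proof.
by apply/existsP/hasP => [[x Px]|[x _ Px]]; exists x; rewrite // mem_enum.
Qed.

Lemma up_log_gt (a : nat) : (a < 2 ^ up_log 2 a.+1)%N.
Proof. exact: up_logP. Qed.

Definition encoder_cost :=
  (position_cost + m * (4 * 2 ^ b) + n * (m * 1 + m.+1 + 1) + n)%N.

Lemma encoder_circuit : exists c, computes_encoder c hidden_code /\
  (circuit_size c <= encoder_cost)%N.
Proof.
pose nb := up_log 2 N.+1.
pose X := (bool * 'I_N.+1 * bits Delta)%type.
pose inp (x : X) := x.1.1 :: message_bits x.1.2 ++ codom x.2.
pose d := (1 + (nb + Delta))%N.
have szm (a : 'I_N.+1) : size (message_bits a) = nb by rewrite size_mkseq.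
have sz x : size (inp x) = d.
  by rewrite /inp /= size_cat szm size_codom card_ord.
pose E (f : X -> bool) := f = (fun=> false) \/
  exists2 i, (i < d)%N & f = fun x => nth false (inp x) i.
have Ekey i : E (fun x => nth false (codom x.2) i).
  have [iD|Di] := ltnP i Delta.
    right; exists (1 + (nb + i))%N; first by rewrite /d !add1n ltnS ltn_add2l.
    apply/funext => x; rewrite /inp add1n /= nth_cat szm ltnNge leq_addr/=.
    by rewrite addKn.
  left; apply/funext => x; rewrite nth_default// size_codom card_ord//.
have Ebit i : E (fun x => bit x.1.2 i).
  have [iD|Di] := ltnP i nb.
    right; exists (1 + i)%N; first by rewrite /d !add1n ltnS ltn_addr.
    apply/funext => x; rewrite /inp add1n /= nth_cat szm iD.
    by rewrite nth_mkseq.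
  left; apply/funext => x; apply: bit_large.
  apply: leq_trans (leq_pexp2l _ Di) => //.
  by apply: leq_trans (ltn_ord x.1.2) _; exact: up_log_gt.
have Et : E (fun x : X => x.1.1) by right; exists 0%N => //.
have h1 := computable_positions Ekey.
have h2 : computable E (m * (4 * 2 ^ b)) (fun f => exists j, f = fun x : X => codeword x.1.2 j).
  apply: computable_fin => j.
  pose fs := [seq (fun x : X => bit x.1.2 (j.1 * b + i)) | i : 'I_b <- enum 'I_b].
  have szf : size fs = b by rewrite size_map size_enum_ord.
  rewrite -[b in (2 ^ b)%N]szf.
  have K := @computable_determined _ E fs (fun x => codeword x.1.2 j).
  apply: (computable_sub _ (leqnn _) _ (K _ _)) => [|f ->|f /List_In_map[i _ <-]|x y fxy] //.
  rewrite /codeword; congr (C _ _); apply/ffunP => i; rewrite !ffunE.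
  apply: (fxy (fun x => bit x.1.2 (j.1 * b + i))).
  by apply/List_In_map; exists i => //; apply/List_In_mem; rewrite mem_enum.
have h12 := computable_union h1 h2.
set F1 := (F in union_wires F _) in h12; set F2 := (F in union_wires _ F) in h12.
pose U := union_wires E (union_wires F1 F2).
pose out (i : 'I_n) (x : X) := x.1.1 && has (fun j : J => codeword x.1.2 j && (positions x.2 j == i)) (enum J).
have h3 : computable U (n * (m * 1 + m.+1 + 1)) (fun f => exists i, f = out i).
  rewrite -[n in (n * _)%N]card_ord; apply: computable_fin => i.
  have k1 : computable U (m * 1) (fun f => exists j : J, f = fun x : X => codeword x.1.2 j && (positions x.2 j == i)).
    apply: computable_fin => j.
    have Uc : U (fun x => codeword x.1.2 j) by right; right; exists j.
    have Up : U (fun x => positions x.2 j == i) by right; left; exists (j, i).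
    by apply: computable_sub (computable_gate andb Uc Up) => // f ->.
  have k2 := @computable_has X J (enum J) (union_wires U (fun f => exists j : J, f = fun x : X => codeword x.1.2 j && (positions x.2 j == i)))
    (fun j (x : X) => codeword x.1.2 j && (positions x.2 j == i)).
  rewrite -cardE in k2.
  have k3 := computable_bind k1 (k2 _).
  have k4 := computable_bind (k3 _) (@computable_gate _ _ andb (fun x : X => x.1.1)
      (fun x : X => has (fun j : J => codeword x.1.2 j && (positions x.2 j == i)) (enum J)) _ _).
  apply: (computable_sub _ (leqnn _) _ (k4 _ _ _)) => [|f ->|j _||] //.
  - by right.
  - by right; exists j.
  - by left; left.
  - by right; right.
have [|c [cs cE]] := @computable_realize X d (position_cost + m * (4 * 2 ^ b) + n * (m * 1 + m.+1 + 1)) inp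
    [seq out i | i <- enum 'I_n] sz.
  apply: computable_sub (computable_bind h12 h3) => // f /List_In_map[i _ <-].
  by right; exists i.
exists c; split; last by rewrite size_map size_enum_ord in cs.
move=> t a key; rewrite -[LHS]/(run_circuit c (inp (t, a, key))) cE.
rewrite codomE -map_comp; apply: eq_map => i /=; rewrite /out /=.
case: t; last by rewrite ffunE.
by rewrite ffunE exists_has.
Qed.

Section Decoder.
Variable v : {ffun J -> bool}.

Let word (k : 'I_B) : bits l := [ffun i => v (k, i)].
Let k0 : 'I_B := Ordinal B_gt0.

Definition decoded_bit (r : nat) : bool :=
  nth false (codom (odflt [ffun=> false] (bdec (word (nth k0 (enum 'I_B) (r %/ b)))))) (r %% b).

(** The comparison with [N] is needed because the concatenated blocks may spell a number that is no
    message. *)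
Definition decode_ok : bool := all (fun k => bdec (word k) : bool) (enum 'I_B) &&
  foldr (fun i r => if decoded_bit i == bit N i then r else ~~ decoded_bit i) true
    (rev (iota 0 (B * b))).

Let decoded_bitE r (k : 'I_B) (i : 'I_b) : r = (k * b + i)%N ->
  decoded_bit r = odflt [ffun=> false] (bdec (word k)) i.
Proof.
move=> ->; have b0 : (0 < b)%N by apply: leq_ltn_trans (ltn_ord i).
rewrite /decoded_bit divnMDl// divn_small// addn0 modnMDl modn_small//.
by rewrite nth_ord_enum nth_codom_ord.
Qed.

Let bit_index r : (r < B * b)%N -> exists k : 'I_B, exists i : 'I_b, r = (k * b + i)%N.
Proof.
move=> rB; have b0 : (0 < b)%N by move: rB; case: (b) => //; rewrite muln0.
have kB : (r %/ b < B)%N by rewrite ltn_divLR.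
have ib : (r %% b < b)%N by rewrite ltn_mod.
by exists (Ordinal kB), (Ordinal ib); rewrite /= -divn_eq.
Qed.

Let decoded_bit_msg (a : nat) r : (forall k, bdec (word k) = Some (msg_block a k)) ->
  (r < B * b)%N -> decoded_bit r = bit a r.
Proof.
move=> H /bit_index[k [i rE]].
by rewrite (decoded_bitE rE) H /= ffunE -rE.
Qed.

Let nbK : (up_log 2 N.+1 <= B * b)%N.
Proof. exact: up_log_min. Qed.

Let val_le : (bits_val decoded_bit (B * b) <= bits_val (bit N) (B * b))%N =
  (bits_val decoded_bit (B * b) <= N)%N.
Proof. by rewrite bits_val_bit. Qed.

(** Replaces the search over exponentially many messages in [decode_word] by reading the answer off
    the decoded blocks: blocks determine a message, so at most one is accepted. *)
Lemma message_bits_decode :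
  message_bits (decode_word v) = mkseq (fun i => decode_ok && decoded_bit i) (up_log 2 N.+1).
Proof.
rewrite /decode_ok compare_bits val_le.
have [/andP[/allP fl aN]|nok] := boolP (_ && _).
  pose a : 'I_N.+1 := Ordinal (aN : (_ < N.+1)%N).
  have Ha k : bdec (word k) = Some (msg_block a k).
    have := fl k (mem_enum _ _); case E : (bdec (word k)) => [u|//] _; congr Some.
    apply/ffunP => i; rewrite ffunE /a /= bit_bits_val; last first.
      have b0 : (0 < b)%N by apply: leq_ltn_trans (ltn_ord i).
      apply: (@leq_trans (k.+1 * b)); first by rewrite mulSn addnC ltn_add2r.
      by rewrite leq_mul2r ltn_ord orbT.
    by rewrite (decoded_bitE (erefl (k * b + i)%N)) E.
  have -> : decode_word v = a.
    rewrite /decode_word; case: pickP => [a' /forallP Ha'|/(_ a)/negP[]] /=; last first.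
      by apply/forallP => k; apply/eqP; exact: Ha.
    apply: val_inj; apply: msg_block_inj => [||k].
    - by apply: leq_trans (ltn_ord a') _.
    - by apply: leq_trans (ltn_ord a) _.
    - by have /eqP := Ha' k; rewrite -/(word k) Ha => -[].
  apply/eq_in_map => i; rewrite mem_iota add0n => /andP[_ iN] /=.
  rewrite -[LHS]/(bit a i); apply/esym; apply: decoded_bit_msg => //.
  exact: leq_trans nbK.
have -> : decode_word v = ord0.
  rewrite /decode_word; case: pickP => [a' /forallP Ha'|//] /=.
  have Ha k : bdec (word k) = Some (msg_block a' k) by exact/eqP/Ha'.
  case/negP: nok; apply/andP; split; first by apply/allP => k _; rewrite Ha.
  suff -> : bits_val decoded_bit (B * b) = a' by rewrite -ltnS.
  rewrite -[RHS](@bits_val_bit a' (B * b)); last by apply: leq_trans (ltn_ord a') _.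
  by apply: eq_bigr => i _; rewrite (decoded_bit_msg Ha).
by apply: eq_mkseq => i /=; rewrite div0n.
Qed.

End Decoder.

Definition decoder_cost :=
  (position_cost + m * (n * 1 + n.+1) + (B * (4 * 2 ^ l) + B * b * (4 * 2 ^ l)) +
   (B.+1 + (B * b).+1 + 1) + up_log 2 N.+1 * 1 + up_log 2 N.+1)%N.

Lemma decoder_circuit : exists c, computes_decoder c hidden_code /\
  (circuit_size c <= decoder_cost)%N.
Proof.
pose nb := up_log 2 N.+1.
pose X := (bits n * bits Delta)%type.
pose inp (x : X) := codom x.1 ++ codom x.2.
pose d := (n + Delta)%N.
have sz x : size (inp x) = d by rewrite /inp size_cat !size_codom !card_ord.
pose E (f : X -> bool) := f = (fun=> false) \/
  exists2 i, (i < d)%N & f = fun x => nth false (inp x) i.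
have Ekey i : E (fun x => nth false (codom x.2) i).
  have [iD|Di] := ltnP i Delta.
    right; exists (n + i)%N; first by rewrite /d ltn_add2l.
    apply/funext => x; rewrite /inp nth_cat size_codom card_ord ltnNge leq_addr/=.
    by rewrite addKn.
  left; apply/funext => x; rewrite nth_default// size_codom card_ord//.
have Ey (i : 'I_n) : E (fun x => x.1 i).
  right; exists (i : nat); first by rewrite /d ltn_addr.
  apply/funext => x; rewrite /inp nth_cat size_codom card_ord ltn_ord.
  by rewrite nth_codom_ord.
have h1 := computable_positions Ekey.
pose F1 (f : X -> bool) := exists p : J * 'I_n, f = fun x => positions x.2 p.1 == p.2.
pose v (x : X) : {ffun J -> bool} := [ffun j => x.1 (positions x.2 j)].
pose F2 (f : X -> bool) := exists j : J, f = fun x => v x j.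
have h2 : computable (union_wires E F1) (m * (n * 1 + n.+1)) F2.
  apply: computable_fin => j.
  pose G (f : X -> bool) := exists i : 'I_n, f = fun x => x.1 i && (positions x.2 j == i).
  have k1 : computable (union_wires E F1) (n * 1) G.
    rewrite -[n in (n * _)%N]card_ord; apply: computable_fin => i.
    have Uy : union_wires E F1 (fun x => x.1 i) by left.
    have Up : union_wires E F1 (fun x => positions x.2 j == i) by right; exists (j, i).
    by apply: computable_sub (computable_gate andb Uy Up) => // f ->.
  have k2 := @computable_has X 'I_n (enum 'I_n) (union_wires (union_wires E F1) G)
    (fun i (x : X) => x.1 i && (positions x.2 j == i)).
  rewrite size_enum_ord in k2.
  apply: (computable_sub _ (leqnn _) _ (computable_bind k1 (k2 _))) => [|f ->|i _] //; last by right; exists i.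
  right; apply/funext => x; rewrite -exists_has.
  have -> : v x j = x.1 (positions x.2 j) by rewrite [LHS]ffunE.
  apply/existsP/idP => [[i /andP[yi /eqP->//]]|yi].
  by exists (positions x.2 j); rewrite yi eqxx.
have h12 := computable_bind h1 h2.
pose U := union_wires E (union_wires F1 F2).
pose word (x : X) (k : 'I_B) : bits l := [ffun i => v x (k, i)].
have det (k : 'I_B) (phi : X -> bool) : (forall x y, word x k = word y k -> phi x = phi y) ->
    computable U (4 * 2 ^ l) (eq phi).
  move=> D0; pose fs := [seq (fun x => v x (k, i)) | i : 'I_l <- enum 'I_l].
  have szf : size fs = l by rewrite size_map size_enum_ord.
  rewrite -[l in (2 ^ l)%N]szf; apply: computable_determined => [f /List_In_map[i _ <-]|x y fxy].
    by right; right; exists (k, i).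
  apply: D0; apply/ffunP => i; rewrite !(ffunE (fun i => v _ (k, i))).
  apply: (fxy (fun x => v x (k, i))).
  by apply/List_In_map; exists i => //; apply/List_In_mem; rewrite mem_enum.
pose F3 (f : X -> bool) := exists k, f = fun x => bdec (word x k) : bool.
have h3 : computable U (B * (4 * 2 ^ l)) F3.
  rewrite -[B in (B * _)%N]card_ord; apply: computable_fin => k.
  have K := det k (fun x => bdec (word x k) : bool) (fun x y e => congr1 (fun w => bdec w : bool) e).
  by apply: computable_sub K => // f ->.
pose F4 (f : X -> bool) := exists2 r, r \in iota 0 (B * b) & f = fun x => decoded_bit (v x) r.
have h4 : computable U (B * b * (4 * 2 ^ l)) F4.
  rewrite -[(B * b)%N in X in computable _ X _](size_iota 0).
  apply: computable_family => r _.
  have K := det (nth (Ordinal B_gt0) (enum 'I_B) (r %/ b)) (fun x => decoded_bit (v x) r)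
    (fun x y e => congr1 (fun w => nth false (codom (odflt [ffun=> false] (bdec w))) (r %% b)) e).
  by apply: computable_sub K => // f ->.
have h34 := computable_union h3 h4.
pose U' := union_wires U (union_wires F3 F4).
have h5 : computable U' (B.+1 + (B * b).+1 + 1) (eq (fun x => decode_ok (v x))).
  have k1 := @computable_all X 'I_B (enum 'I_B) U' (fun k (x : X) => bdec (word x k)).
  rewrite size_enum_ord in k1.
  have k2 := @computable_fold X nat (rev (iota 0 (B * b))) U'
    (fun i y r => if y == bit N i then r else ~~ y) true (fun i (x : X) => decoded_bit (v x) i).
  rewrite size_rev size_iota in k2.
  have k3 := computable_bind (computable_union (k1 _) (k2 _))
    (computable_gate andb (or_intror (or_introl erefl)) (or_intror (or_intror erefl))).
  apply: (computable_sub _ (leqnn _) _ (k3 _ _)) => [|f <-|k _|i] //; first by right.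
    by right; left; exists k.
  by rewrite mem_rev => ii; right; right; exists i.
pose U'' := union_wires U' (eq (fun x => decode_ok (v x))).
have h6 : computable U'' (nb * 1) (fun f => exists2 i, i \in iota 0 nb & f = fun x => decode_ok (v x) && decoded_bit (v x) i).
  rewrite -[nb in (nb * _)%N](size_iota 0); apply: computable_family => i.
  rewrite mem_iota => /andP[_ ib].
  have Uo : U'' (fun x => decode_ok (v x)) by right.
  have Ub : U'' (fun x => decoded_bit (v x) i).
    left; right; right; exists i => //; rewrite mem_iota/=; apply: leq_trans ib _.
    exact: up_log_min.
  by apply: computable_sub (computable_gate andb Uo Ub) => // f ->.
have h := computable_bind h12 (computable_bind h34 (computable_bind h5 h6)).
have [|c [cs cE]] := @computable_realize X d (decoder_cost - nb) inp
    [seq (fun x => decode_ok (v x) && decoded_bit (v x) i) | i <- iota 0 nb] sz.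
  apply: computable_sub h => [//||f /List_In_map[i /List_In_mem ib <-]].
    rewrite /decoder_cost addnK; lia.
  by right; right; right; exists i.
exists c; split.
  move=> y key; rewrite -[LHS]/(run_circuit c (inp (y, key))) cE.
  by rewrite message_bits_decode /mkseq -map_comp.
rewrite size_map size_iota subnK// in cs.
by rewrite /decoder_cost leq_addl.
Qed.

End CodeCircuits.

(** * Information density of the asymmetric channel *)

Section InformationDensity.
Variables (R : realType) (p q rho : R).
Hypotheses (p_gt0 : 0 < p) (p_lt_q : p < q) (q_lt : q < 1 / 2) (rho01 : 0 <= rho <= 1).

Definition flip1 : R := (1 - q) * p / q.
Definition bac_output (y : bool) : R := \sum_(x : bool) bernoulli_pmf rho x * bac p q x y.
Definition info_density (x y : bool) : R := ln (bac p q x y / bac_output y).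
Definition nat_info : R := \sum_(x : bool) \sum_(y : bool) bernoulli_pmf rho x * bac p q x y * info_density x y.

Lemma nat_infoE : nat_info = mutual_info (bernoulli_pmf rho) (bac p q) * ln 2.
Proof.
rewrite /mutual_info mulr_suml; apply: eq_bigr => x _; rewrite mulr_suml; apply: eq_bigr => y _.
by rewrite -[RHS]mulrA /log2 divfK// gt_eqF// ln_gt0// ltr1n.
Qed.

(** After clearing denominators the second inequality is p < q. *)
Lemma flip1_bounds : 0 < flip1 /\ flip1 < 1 - p.
Proof.
have h1 := p_gt0; have h2 := p_lt_q; have h3 := q_lt.
have q0 : 0 < q by lra.
split; first by rewrite /flip1 divr_gt0// mulr_gt0//; lra.
rewrite /flip1 ltr_pdivrMr//; nra.
Qed.

Lemma bacE x y : bac p q x y = flip_channel p flip1 x y.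
Proof. by case: x. Qed.

Lemma bac_gt0 x y : 0 < bac p q x y.
Proof.
have [f0 f1] := flip1_bounds; have h1 := p_gt0; have h2 := p_lt_q; have h3 := q_lt.
rewrite bacE /flip_channel /bernoulli_pmf; case: x; case: y; lra.
Qed.

Lemma bac_output_gt0 y : 0 < bac_output y.
Proof.
have /andP[r0 r1] := rho01; have b1 := bac_gt0 true y; have b0 := bac_gt0 false y.
rewrite /bac_output big_bool /bernoulli_pmf.
have [rh|rh] := ltP rho (1 / 2).
  by apply: ltr_wpDl; [rewrite mulr_ge0 ?(ltW b1)|rewrite mulr_gt0//; lra].
by apply: ltr_wpDr; [rewrite mulr_ge0 ?subr_ge0 ?(ltW b0)|rewrite mulr_gt0//; lra].
Qed.

Lemma info_density_mono : info_density false true <= info_density false false /\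
  info_density true false <= info_density true true.
Proof.
have [f0 f1] := flip1_bounds; have h1 := p_gt0; have h2 := p_lt_q; have h3 := q_lt.
have /andP[r0 r1] := rho01.
have k x y x' y' : bac p q x y * bac_output y' <= bac p q x' y' * bac_output y ->
    info_density x y <= info_density x' y'.
  move=> H; rewrite /info_density ler_ln ?posrE ?divr_gt0 ?bac_gt0 ?bac_output_gt0//.
  by rewrite ler_pdivrMr ?bac_output_gt0// mulrAC ler_pdivlMr ?bac_output_gt0.
have u0 : 0 <= rho * (1 - p - flip1) by rewrite mulr_ge0//; lra.
have u1 : 0 <= (1 - rho) * (1 - p - flip1) by rewrite mulr_ge0//; lra.
clear - k u0 u1; split; apply: k; rewrite /bac_output !big_bool !bacE /flip_channel /bernoulli_pmf /=;
  move: u0 u1; move: flip1 => f u0 u1; lra.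
Qed.

(** By Markov's inequality, a word drawn independently of the output passes a threshold th per
    symbol with probability at most exp(- l th), whatever the output. *)
Lemma sum_exp_info y : \sum_x bernoulli_pmf rho x * expR (info_density x y) = 1.
Proof.
have o0 := bac_output_gt0 y.
under eq_bigr do rewrite lnK ?posrE ?divr_gt0 ?bac_gt0// mulrA.
by rewrite -mulr_suml divff// gt_eqF.
Qed.

(** By [info_density_mono] fewer flips can only raise the mean of this fixed density, so the
    asymmetric channel is the worst of its class; exceeding [flip1] by [xi] costs at most the stated
    loss. *)
Lemma mean_info_ge (alpha beta xi : R) : alpha <= p -> beta <= flip1 + xi -> 0 <= xi ->
  nat_info - xi * (info_density true true - info_density true false) <=
  \sum_(a : bool * bool) bernoulli_pmf rho a.1 * flip_channel alpha beta a.1 a.2 * info_density a.1 a.2.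
Proof.
move=> ap bx xi0; have [m0 m1] := info_density_mono; have /andP[r0 r1] := rho01.
rewrite -(pair_bigA _ (fun x y => bernoulli_pmf rho x * flip_channel alpha beta x y * info_density x y)).
rewrite /nat_info !big_bool /bac /flip_channel /bernoulli_pmf /= -/flip1 -subr_ge0.
set i11 := info_density true true; set i10 := info_density true false.
set i01 := info_density false true; set i00 := info_density false false.
rewrite [leRHS](_ : _ = (1 - rho) * ((p - alpha) * (i00 - i01)) + rho * ((flip1 + xi - beta) * (i11 - i10)) +
  (1 - rho) * (xi * (i11 - i10))); last by ring.
by rewrite !addr_ge0 ?mulr_ge0 ?subr_ge0.
Qed.

End InformationDensity.

(** * One codebook for many channels *)

Section GoodCodebooks.
Variables (R : realType) (p q rho : R).
Hypotheses (p_gt0 : 0 < p) (p_lt_q : p < q) (q_lt : q < 1 / 2) (rho01 : 0 <= rho <= 1).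

Let p_le1 : p <= 1. Proof. by have h1 := p_lt_q; have h2 := q_lt; lra. Qed.

Lemma chernoff_pairs (l : nat) (V : bool -> bool -> R) (f : bool -> bool -> R) (G eta : R) :
  0 < eta -> (forall x y, 0 <= V x y) -> (forall x, \sum_y V x y = 1) ->
  (forall x y, `|f x y| <= G) -> eta <= G ->
  \sum_(a : bool * bool) bernoulli_pmf rho a.1 * V a.1 a.2 * f a.1 a.2 <= - eta ->
  \sum_(x : bits l) (\prod_i bernoulli_pmf rho (x i)) * \sum_(y : bits l)
     (\prod_i V (x i) (y i)) * (0 <= \sum_i f (x i) (y i))%R%:R <=
  expR (- (eta ^+ 2 / (8 * G ^+ 2)) * l%:R).
Proof.
move=> eta0 V0 V1 fG etaG Ef.
set c := eta / (4 * G ^+ 2).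
have G0 : 0 < G by apply: lt_le_trans etaG.
have c0 : 0 <= c by rewrite divr_ge0 ?ltW// mulr_gt0// exprn_gt0.
have b0 x : 0 <= bernoulli_pmf rho x by apply: bernoulli_pmf_ge0.
apply: (@le_trans _ _ (\sum_(x : bits l) \prod_i (bernoulli_pmf rho (x i) * \sum_y V (x i) y * expR (c * f (x i) y)))).
  apply: ler_sum => x _; rewrite big_split/= ler_wpM2l ?prodr_ge0//.
  have K := @chernoff_prod R 'I_l bool (fun i y => V (x i) y) (fun i y => c * f (x i) y) (fun i y => V0 (x i) y).
  apply: (le_trans _ K).
  apply: ler_sum => y _; rewrite ler_wpM2l ?prodr_ge0// -mulr_sumr.
  by case: (leP 0 (\sum_i f (x i) (y i))) => [h|_]; rewrite ?(mulr_ge0 c0 h)// ler0n.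
rewrite (sum_ffun_prod (fun (i : 'I_l) x => bernoulli_pmf rho x * \sum_y V x y * expR (c * f x y))).
rewrite prodr_const card_ord expRM_natr lerXn2r ?nnegrE ?expR_ge0//.
  by rewrite sumr_ge0// => x _; rewrite mulr_ge0// sumr_ge0// => y _; rewrite mulr_ge0 ?expR_ge0.
have K := @expectation_expR_le R (bool * bool)%type
  (fun a => bernoulli_pmf rho a.1 * V a.1 a.2) (fun a => f a.1 a.2) G eta eta0.
apply: (le_trans _ (K _ _ _ _ _)) => //.
- rewrite -(pair_bigA _ (fun x y => bernoulli_pmf rho x * V x y * expR (c * f x y)))/=.
  by apply: ler_sum => x _; rewrite mulr_sumr; apply: ler_sum => y _; rewrite mulrA.
- by move=> a; rewrite mulr_ge0.
- rewrite -(pair_bigA _ (fun x y => bernoulli_pmf rho x * V x y))/=.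
  by under eq_bigr do rewrite -mulr_sumr V1 mulr1; rewrite sum_bernoulli_pmf.
Qed.

(** The rate, the threshold and the guaranteed mean of the density are I - 3 eta, I - 2 eta and I -
    eta. The gap eta between neighbours makes both the rejection of the true word and the acceptance
    of any wrong one exponentially unlikely in [l]. *)
Lemma good_codebooks (delta R0 : R) : 0 < delta <= 1 -> R0 < nat_info p q rho ->
  exists E xi : R, [/\ 0 < E, 0 < xi, flip1 p q + xi < 1 &
  forall (l b w : nat) (T T0 : finType) (alpha beta : T -> R) (alpha0 : T0 -> R),
  (forall t, 0 <= alpha t <= p) -> (forall t, 0 <= beta t <= flip1 p q + xi) ->
  (forall t, 0 <= alpha0 t <= 1) -> b%:R * ln 2 <= R0 * l%:R ->
  (rho + delta) * l%:R <= w%:R ->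
  let eps := 6 * (#|T|%:R + #|T0|%:R + 1) * expR (- E * l%:R) in eps < 1 ->
  exists (C : bits b -> bits l) (bdec : bits l -> option (bits b)),
  [/\ forall t u, \sum_(y : bits l) (\prod_i flip_channel (alpha t) (beta t) (C u i) (y i)) *
        (bdec y != Some u)%:R <= eps,
      forall t, \sum_(y : bits l) (\prod_i bernoulli_pmf (alpha0 t) (y i)) *
        (bdec y != None)%:R <= eps &
      forall u, (hamming_weight (C u) <= w)%N]].
Proof.
move=> /andP[delta0 delta1] RI.
have [f0 f1] := flip1_bounds p_gt0 p_lt_q q_lt.
have [m0 m1] := info_density_mono p_gt0 p_lt_q q_lt rho01.
set g := info_density p q rho in m0 m1 *.
have [eta eta0 etaE] : exists2 eta, 0 < eta & R0 = nat_info p q rho - 3 * eta.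
  by exists ((nat_info p q rho - R0) / 3); lra.
pose th := nat_info p q rho - 2 * eta.
pose G := \sum_x \sum_y `|th - g x y| + eta.
have G1 x y : `|th - g x y| <= G.
  rewrite /G (bigD1 x)//= (bigD1 y)//= -!addrA lerDl !addr_ge0 ?sumr_ge0 ?(ltW eta0)// => i _.
  by rewrite sumr_ge0.
have G2 : eta <= G by rewrite lerDr sumr_ge0// => x _; rewrite sumr_ge0.
have G0 : 0 < G by apply: lt_le_trans G2.
have [xi [xi0 xi1 xi2]] : exists xi, [/\ 0 < xi, flip1 p q + xi < 1 & xi * (g true true - g true false) <= eta].
  have h0 : 0 < g true true - g true false + 1 by lra.
  (* The first term keeps [flip1 p q + xi] below 1 because [flip1 p q < 1 - p]; the second bounds
     the loss in [mean_info_ge] by eta. *)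
  exists (Num.min (p / 2) (eta / (g true true - g true false + 1))); split.
  - by rewrite lt_min !divr_gt0.
  - have h1 : Num.min (p / 2) (eta / (g true true - g true false + 1)) <= p / 2 by rewrite ge_min lexx.
    by have h2 := p_gt0; lra.
  - apply: (@le_trans _ _ (eta / (g true true - g true false + 1) * (g true true - g true false))).
      by rewrite ler_wpM2r ?subr_ge0// ge_min lexx orbT.
    by rewrite mulrAC ler_pdivrMr// ler_wpM2l ?(ltW eta0)//; lra.
pose E1 := eta ^+ 2 / (8 * G ^+ 2); pose E3 := delta ^+ 2 / (8 * 2 ^+ 2).
have E10 : 0 < E1 by rewrite divr_gt0 ?exprn_gt0// mulr_gt0// exprn_gt0.
have E30 : 0 < E3 by rewrite divr_gt0 ?exprn_gt0// mulr_gt0// exprn_gt0.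
pose E := Num.min E1 (Num.min eta E3).
have E0 : 0 < E by rewrite !lt_min E10 eta0.
have EE : [/\ E <= E1, E <= eta & E <= E3] by rewrite /E !ge_min !lexx !orbT.
exists E, xi; split=> // l b w T T0 alpha beta alpha0 Ha Hb Ha0 Rl wl eps eps1.
have /andP[r0 r1] := rho01.
have EX (F : R) : E <= F -> expR (- F * l%:R) <= expR (- E * l%:R).
  by move=> EF; rewrite ler_expR !mulNr lerN2 ler_wpM2r.
case: EE => /EX EX1 /EX EX2 /EX EX3.
pose V t := flip_channel (alpha t) (beta t).
have V0 t x y : 0 <= V t x y.
  have /andP[a0 a1] := Ha t; have /andP[b0 b1] := Hb t.
  rewrite /V /flip_channel; case: x; apply: bernoulli_pmf_ge0.
    by rewrite subr_ge0 (le_trans b1 (ltW xi1))/= gerBl.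
  by rewrite a0 (le_trans a1 p_le1).
have V1 t x : \sum_y V t x y = 1.
  by rewrite /V /flip_channel; case: x; rewrite sum_bernoulli_pmf.
have B0 t y : 0 <= bernoulli_pmf (alpha0 t) y by exact: bernoulli_pmf_ge0.
have h1 t : \sum_(x : bits l) (\prod_i bernoulli_pmf rho (x i)) * \sum_(y : bits l)
     (\prod_i V t (x i) (y i)) * (~~ passes g (l%:R * th) x y)%:R <= expR (- E1 * l%:R).
  apply: (le_trans _ (chernoff_pairs l eta0 (V0 t) (V1 t) G1 G2 _)).
    apply: ler_sum => x _; rewrite ler_wpM2l ?prod_bernoulli_ge0//.
    apply: ler_sum => y _; rewrite ler_wpM2l ?prodr_ge0// ler_nat /passes -ltNge.
    rewrite sumrB sumr_const card_ord -[th *+ l]mulr_natl subr_ge0.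
    by case: ltP => // /ltW ->.
  have /andP[a0 a1] := Ha t; have /andP[b0 b1] := Hb t.
  have := mean_info_ge p_gt0 p_lt_q q_lt rho01 a1 b1 (ltW xi0).
  rewrite -/g -/(V t) => K.
  under eq_bigr do rewrite mulrBr.
  rewrite sumrB -mulr_suml.
  have -> : \sum_(a : bool * bool) bernoulli_pmf rho a.1 * V t a.1 a.2 = 1.
    rewrite -(pair_bigA _ (fun x y => bernoulli_pmf rho x * V t x y))/=.
    by under eq_bigr do rewrite -mulr_sumr V1 mulr1; rewrite sum_bernoulli_pmf.
  rewrite mul1r /th; move: K; rewrite /V; set S := \sum_(a : bool * bool) _ => K.
  by lra.
have h2 (y : bits l) : \sum_(x : bits l) (\prod_i bernoulli_pmf rho (x i)) *
     (passes g (l%:R * th) x y)%:R <= expR (- (l%:R * th)).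
  apply: (@le_trans _ _ (\sum_(x : bits l) (\prod_i (bernoulli_pmf rho (x i) * expR (g (x i) (y i)))) * expR (- (l%:R * th)))).
    apply: ler_sum => x _; rewrite big_split/= -mulrA ler_wpM2l ?prod_bernoulli_ge0//.
    rewrite -expR_sum -expRD /passes; case: (leP (l%:R * th) _) => h; rewrite ?expR_ge0//.
    by rewrite -[leLHS]/(1 : R) -[leLHS](@expR0 R) ler_expR subr_ge0.
  rewrite -mulr_suml (sum_ffun_prod (fun i x => bernoulli_pmf rho x * expR (g x (y i)))).
  by rewrite big1 ?mul1r// => i _; exact: sum_exp_info.
have h3 : \sum_(x : bits l) (\prod_i bernoulli_pmf rho (x i)) * (w < hamming_weight x)%N%:R
    <= expR (- E3 * l%:R).
  (* The output channel is a dummy: only the weight of the word is estimated. *)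
  have K := @chernoff_pairs l (fun x y => bernoulli_pmf 0 y) (fun x y => x%:R - (rho + delta)) 2 delta delta0.
  apply: (le_trans _ (K _ _ _ _ _)).
  - apply: ler_sum => x _; rewrite ler_wpM2l ?prod_bernoulli_ge0//.
    rewrite -mulr_suml sum_prod_bernoulli mul1r ler_nat.
    rewrite sumrB sumr_const card_ord -[(rho + delta) *+ l]mulr_natr.
    have -> : \sum_(i < l) (x i)%:R = (hamming_weight x)%:R :> R.
      rewrite -natr_sum; congr (_%:R); rewrite /hamming_weight -sum1_card big_mkcond/=.
      by rewrite [RHS]big_mkcond; apply: eq_bigr => i _; rewrite unfold_in; case: (x i).
    case: ltnP => // wx; suff -> : (0 <= (hamming_weight x)%:R - (rho + delta) * l%:R) by [].
    by rewrite subr_ge0 (le_trans wl)// ler_nat ltnW.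
  - by move=> x y; apply: bernoulli_pmf_ge0; rewrite lexx ler01.
  - by move=> x; rewrite sum_bernoulli_pmf.
  - move=> x _; clear K h1 h2; rewrite ler_norml; case: x => /=; apply/andP; split; lra.
  - by clear K h1 h2; lra.
  - rewrite -(pair_bigA _ (fun x y => bernoulli_pmf rho x * bernoulli_pmf 0 y * (x%:R - (rho + delta))))/=.
    by rewrite !big_bool /bernoulli_pmf /=; clear K h1 h2; lra.
have e2E : 2 ^+ b.+1 * expR (- (l%:R * th)) <= 2 * expR (- E * l%:R).
  rewrite exprS -mulrA ler_pM2l//; apply: le_trans EX2.
  have -> : (2 : R) ^+ b = expR (b%:R * ln 2) by rewrite expRM_natl lnK ?posrE.
  rewrite -expRD ler_expR /th.
  clear h1 h2 h3; rewrite etaE in Rl; nra.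
have epsE : 2 * (#|T|%:R * (expR (- E1 * l%:R) + 2 ^+ b.+1 * expR (- (l%:R * th))) +
    #|T0|%:R * (2 ^+ b.+1 * expR (- (l%:R * th))) + expR (- E3 * l%:R)) <= eps.
  have k1 : #|T|%:R * (expR (- E1 * l%:R) + 2 ^+ b.+1 * expR (- (l%:R * th))) <=
      #|T|%:R * (3 * expR (- E * l%:R)) by rewrite ler_wpM2l//; clear h1 h2 h3; lra.
  have k2 : #|T0|%:R * (2 ^+ b.+1 * expR (- (l%:R * th))) <= #|T0|%:R * (2 * expR (- E * l%:R)).
    by rewrite ler_wpM2l.
  have k3 : 0 <= #|T0|%:R * expR (- E * l%:R) by rewrite mulr_ge0 ?expR_ge0.
  have k4 := expR_ge0 (- E * l%:R).
  by rewrite /eps; clear h1 h2 h3; lra.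
have [|C [C1 C2 C3]] := @codebook_exists R l b rho g (l%:R * th) w T T0 V (fun t => bernoulli_pmf (alpha0 t))
   (expR (- E1 * l%:R)) (expR (- (l%:R * th))) (expR (- E3 * l%:R)) rho01 V0 V1 B0
   (fun t => sum_bernoulli_pmf _) h1 h2 h3 (expR_ge0 _) (expR_ge0 _) (expR_gt0 _).
  exact: le_lt_trans eps1.
exists C, (fun y => [pick u | passes g (l%:R * th) (C u) y]); split=> [t u|t|//].
- apply: le_trans epsE; apply: le_trans (C1 t u); apply: ler_sum => y _.
  rewrite ler_wpM2l//; first by apply: prodr_ge0 => i _; exact: V0.
  have [pu|npu] := boolP (passes g (l%:R * th) (C u) y); last first.
    by rewrite ler_wpDr ?sumr_ge0// ler_nat; case: (_ != _).
  rewrite add0r; case: pickP => [u' pu'|/(_ u)]; last by rewrite pu.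
  have [->|u'u] := eqVneq u' u; first by rewrite eqxx sumr_ge0.
  rewrite (bigD1 u')//= pu' ler_wpDr ?sumr_ge0// ler_nat; by case: (_ != _).
- apply: le_trans epsE; apply: le_trans (C2 t); apply: ler_sum => y _.
  rewrite ler_wpM2l//; first by apply: prodr_ge0 => i _; exact: B0.
  case: pickP => [u pu|_]; last by rewrite eqxx sumr_ge0.
  by rewrite (bigD1 u)//= pu ler_wpDr ?sumr_ge0.
Qed.

End GoodCodebooks.

(** * Covertness and reliability of the hidden code at fixed length *)

Section HiddenCode.
Variables (R : realType) (n N Delta D B b l w : nat) (q : R).
Variables (C : bits b -> bits l) (bdec : bits l -> option (bits b)).
Hypotheses (n_gt0 : (0 < n)%N) (N_gt0 : (0 < N)%N).
Hypotheses (q0 : 0 < q) (q_lt : q < 1 / 2).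
Local Notation J := (('I_B * 'I_l)%type : finType).
Hypotheses (Jn : (#|J| <= n)%N) (JD : (#|J| * D <= Delta)%N) (nD : (n <= 2 ^ D)%N).
Local Notation code := (hidden_code N Delta D B n_gt0 C bdec).
Local Notation keyloss := (#|J|%:R * (n%:R / 2 ^+ D) : R).

(** Silence is treated as placing the zero word, so that [jam_bound] covers both values of T. *)
Let tx (t : bool) (a : 'I_N.+1) (j : J) : bool := t && codeword C a j.

Lemma encode_hidden t a k : encode code t a k = place (tx t a) (positions D B l n_gt0 k).
Proof.
case: t => //; apply/ffunP => i; rewrite !ffunE /=.
by apply/esym/negbTE/existsPn => j.
Qed.

Lemma message_law_ge0 t (a : 'I_N.+1) : 0 <= message_law R t a.
Proof. by case: t => //=; rewrite divr_ge0. Qed.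

Lemma sum_message_law t : \sum_(a : 'I_N.+1) message_law R t a = 1.
Proof.
case: t => /=; last first.
  by rewrite (bigD1 ord0)//= ?eqxx big1 ?addr0// => a /negbTE->.
rewrite -mulr_suml -natr_sum; have -> : (\sum_(a : 'I_N.+1) (a != ord0) = N)%N.
  by rewrite -big_mkcond/= sum1_card cardC1 card_ord.
by rewrite divff// pnatr_eq0 -lt0n.
Qed.

Lemma expect_hidden t f : expect code q t f =
  \sum_a message_law R t a * \sum_(k : bits Delta) (2 ^+ Delta)^-1 *
    \sum_e noise_law q e * f a k (xorb_bits (place (tx t a) (positions D B l n_gt0 k)) e).
Proof.
rewrite /expect; apply: eq_bigr => a _; rewrite mulr_sumr; apply: eq_bigr => k _.
rewrite mulrA mulr_sumr; apply: eq_bigr => e _.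
by rewrite encode_hidden mulrA.
Qed.

Let noise0 (e : bits n) : 0 <= noise_law q e.
Proof. by apply: noise_law_ge0 => //; exact: ltW. Qed.

Let noise_avg01 (F : bits n -> R) : (forall e, 0 <= F e <= 1) -> 0 <= \sum_e noise_law q e * F e <= 1.
Proof.
move=> F01; apply/andP; split.
  by apply: sumr_ge0 => e _; rewrite mulr_ge0//; case/andP: (F01 e).
rewrite -[leRHS](sum_noise_law n q); apply: ler_sum => e _.
by rewrite ler_piMr//; case/andP: (F01 e).
Qed.

Lemma card_tx t a : (forall u, (hamming_weight (C u) <= w)%N) ->
  (#|[pred j | tx t a j]| <= B * w)%N.
Proof.
move=> Cw; apply: (@leq_trans #|[pred j : J | C (msg_block b a j.1) j.2]|).
  by apply: subset_leq_card; apply/fintype.subsetP => j; rewrite !inE /tx /codeword => /andP[].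
rewrite -sum1_card big_mkcond/=.
rewrite -(pair_bigA _ (fun k i => if C (msg_block b a k) i then 1 else 0))/=.
rewrite -[B in (B * _)%N]card_ord -sum_nat_const.
apply: leq_sum => k _; rewrite -big_mkcond/= sum1_card; apply: leq_trans (Cw (msg_block b a k)).
by rewrite /hamming_weight; apply: subset_leq_card; apply/fintype.subsetP => i; rewrite !inE.
Qed.

Lemma detection_error_hidden theta loss : (forall u, (hamming_weight (C u) <= w)%N) ->
  0 <= theta <= 1 ->
  (forall s, bernoulli_tail n s (q + theta * (1 - 2 * q)) - bernoulli_tail n s q <= loss) ->
  1 - (loss + \sum_(z : bits n) (\prod_i bernoulli_pmf theta (z i)) * (hamming_weight z < B * w)%N%:R
    + keyloss) <= detection_error code q.
Proof.
move=> Cw theta01 tails; apply: lb_le_inf; first by eexists; exists (fun=> false).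
move=> _ [Phi _ <-].
have -> : false_alarm code q Phi = \sum_e noise_law q e * (Phi e)%:R.
  rewrite /false_alarm expect_hidden.
  transitivity (\sum_(a : 'I_N.+1) message_law R false a * \sum_(k : bits Delta) (2 ^+ Delta)^-1 * \sum_e noise_law q e * (Phi e)%:R).
    apply: eq_bigr => a _; congr (_ * _); apply: eq_bigr => k _; congr (_ * _).
    apply: eq_bigr => e _; congr (_ * _); rewrite eqb_id; congr (Phi _)%:R.
    by apply/ffunP => i; rewrite !ffunE; case: existsP => [[j]|].
  rewrite -mulr_suml sum_message_law mul1r -mulr_suml sumr_const card_ffun card_bool card_ord.
  by rewrite -[_ *+ (2 ^ Delta)]mulr_natl natrX divff ?mul1r// expf_neq0.
pose F (a : 'I_N.+1) (f : {ffun J -> 'I_n}) :=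
  \sum_e noise_law q e * (Phi (xorb_bits (place (tx true a) f) e))%:R.
have F01 a f : 0 <= F a f <= 1.
  by apply: noise_avg01 => e; case: (Phi _); rewrite ?lexx ler01.
have -> : missed_detection code q Phi =
    1 - \sum_a message_law R true a * \sum_(k : bits Delta) (2 ^+ Delta)^-1 * F a (positions D B l n_gt0 k).
  rewrite /missed_detection expect_hidden -[X in X - _](sum_message_law true) -sumrB.
  apply: eq_bigr => a _; rewrite -[X in _ = X - _]mulr1 -mulrBr; congr (_ * _).
  transitivity (\sum_(k : bits Delta) ((2 ^+ Delta)^-1 - (2 ^+ Delta)^-1 * F a (positions D B l n_gt0 k)));
    last first.
    rewrite sumrB sumr_const card_ffun card_bool card_ord -[X in X - _]mulr_natl natrX divff ?expf_neq0//.
  apply: eq_bigr => k _.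
  transitivity ((2 ^+ Delta)^-1 * (1 - F a (positions D B l n_gt0 k))); last by rewrite mulrBr mulr1.
  congr (_ * _); rewrite /F.
  rewrite -[X in _ = X - _](sum_noise_law n q) -sumrB; apply: eq_bigr => e _.
  by case: (Phi _) => /=; rewrite ?mulr1 ?mulr0 ?subrr ?subr0.
have := covert_test Jn q0 q_lt theta01 (message_law_ge0 true) (sum_message_law true)
  (fun a => card_tx true a Cw) tails Phi.
set S := \sum_t _; set P := \sum_z _; set Z := \sum_e _ => H.
have : \sum_a message_law R true a * \sum_(k : bits Delta) (2 ^+ Delta)^-1 * F a (positions D B l n_gt0 k)
    <= S + keyloss.
  rewrite -[X in _ + X]mul1r -[X in _ + X * _](sum_message_law true) mulr_suml -big_split/=.
  apply: ler_sum => a _; rewrite -mulrDr ler_wpM2l ?message_law_ge0//.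
  exact: (key_position_avg_le n_gt0 Jn JD nD (F01 a)).
by move: H; lra.
Qed.

Section Reliability.
Variables (p : R) (W : bits n -> bits n -> R) (typ : pred (bits n)) (eps Lam atyp : R).
Hypothesis jamW : jamming_strategy p W.
Hypothesis C_on : forall z s u, typ z -> (hamming_weight s)%:R <= p * n%:R ->
  \sum_(y : bits l) (\prod_i flip_channel (jam_rate0 R s) (jam_rate1 q z s) (C u i) (y i)) *
    (bdec y != Some u)%:R <= eps.
Hypothesis C_off : forall s : bits n,
  \sum_(y : bits l) (\prod_i bernoulli_pmf (jam_rate0 R s) (y i)) * (bdec y != None)%:R <= eps.
Hypotheses (typ_pos : forall z, typ z -> 0 < mean_ratio q z) (eps0 : 0 <= eps) (Lam1 : 1 <= Lam).
Hypothesis typ_Lam : forall z, typ z -> forall k, (k <= #|J|)%N -> mean_ratio q z ^+ k <= Lam.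
Hypothesis atypE : forall x : bits n, (hamming_weight x <= #|J|)%N ->
  \sum_e noise_law q e * (~~ typ (xorb_bits x e))%:R <= atyp.
Hypotheses (B_gt0 : (0 < B)%N) (NB : (N < 2 ^ (B * b))%N).

(** For T = 1 a wrong decision forces some block to be decoded wrongly. For T = 0 a message is
    announced only if every block is accepted, in particular block [k0]. *)
Lemma decoding_error_hidden t : decoding_error code q W t <=
  atyp + (n%:R ^+ #|J| / (n ^_ #|J|)%:R) * (Lam * (B%:R * eps)) + keyloss.
Proof.
have [W0 W1 Wp] := jamW.
rewrite /decoding_error expect_hidden.
rewrite -[leRHS]mul1r -[X in X * _](sum_message_law t) mulr_suml.
apply: ler_sum => a _.
have [->|ma] := eqVneq (message_law R t a) 0; first by rewrite !mul0r.
rewrite ler_wpM2l ?message_law_ge0//.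
pose err (v : {ffun J -> bool}) : R := (decode_word N bdec v != a)%:R.
pose F (f : {ffun J -> 'I_n}) := \sum_e noise_law q e *
    \sum_s W (xorb_bits (place (tx t a) f) e) s * err [ffun j => tx t a j (+) s (f j)].
have err01 v : 0 <= err v <= 1 by rewrite /err; case: (_ != _); rewrite ?lexx ler01.
have -> : \sum_(k : bits Delta) (2 ^+ Delta)^-1 * \sum_e noise_law q e *
    \sum_s W (xorb_bits (place (tx t a) (positions D B l n_gt0 k)) e) s *
      (Defs.decode code (xorb_bits (encode code t a k) s) k != a)%:R =
    \sum_(k : bits Delta) (2 ^+ Delta)^-1 * F (positions D B l n_gt0 k).
  apply: eq_bigr => k _; congr (_ * _); apply: eq_bigr => e _; congr (_ * _).
  apply: eq_bigr => s _; congr (_ * _); rewrite encode_hidden /err.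
  congr (decode_word N bdec _ != a)%:R; apply/ffunP => j.
  rewrite ffunE [LHS]ffunE [RHS]ffunE place_at//.
  exact: key_position_inj.
apply: le_trans (key_position_avg_le n_gt0 Jn JD nD _) _.
  move=> f; apply: noise_avg01 => e; apply/andP; split.
    by apply: sumr_ge0 => s _; rewrite mulr_ge0//; case/andP: (err01 [ffun j => tx t a j (+) s (f j)]).
  rewrite -[leRHS](W1 (xorb_bits (place (tx t a) f) e)); apply: ler_sum => s _.
  by rewrite ler_piMr//; case/andP: (err01 [ffun j => tx t a j (+) s (f j)]).
rewrite lerD2r.
pose k0 : 'I_B := Ordinal B_gt0.
pose errk (k : 'I_B) (y : bits l) : R :=
  if t then (bdec y != Some (msg_block b a k))%:R else (k == k0)%:R * (bdec y != None)%:R.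
have iotaI (k : 'I_B) : injective (fun i : 'I_l => (k, i) : J) by move=> i j [].
have := @jam_bound R n l J 'I_B q (fun k i => (k, i)) n_gt0 q0 q_lt iotaI (tx t a) typ W err errk eps Lam W0 W1 err01.
move=> /(_ _ _ _ typ_pos _ eps0 (le_trans ler01 Lam1)) H.
have {H} := H _ _ _ _.
rewrite card_ord => H; apply: (le_trans (H _ _ _ _)).
- by move=> k y; rewrite /errk; case: ifP => _ //; rewrite mulr_ge0.
- move=> v; rewrite /err; case: eqVneq => [_|va]; first by apply: sumr_ge0 => k _; rewrite /errk; case: ifP => _ //; rewrite mulr_ge0.
  rewrite /errk; case tt: t.
    have [k bk] : exists k, bdec [ffun i => v (k, i)] != Some (msg_block b a k).
      apply/existsP; apply: contraR va => /existsPn H0; rewrite /decode_word.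
      have a_ok : [forall k, bdec [ffun i => v (k, i)] == Some (msg_block b a k)].
        by apply/forallP => k; move: (H0 k); rewrite negbK.
      case: pickP => [a' /forallP a'_ok|/(_ a)]; last by rewrite a_ok.
      apply/eqP/val_inj/(@msg_block_inj B b) => [||k]; rewrite ?(leq_trans (ltn_ord _))//.
      by apply/eqP; move: (forallP a_ok k); rewrite (eqP (a'_ok k)).
    by rewrite (bigD1 k)//= bk ler_wpDr ?sumr_ge0.
  have a0 : a = ord0.
    by move: ma; rewrite tt /=; case: (eqVneq a ord0) => // _; rewrite eqxx.
  have bk : bdec [ffun i => v (k0, i)] != None.
    apply: contraNneq va => E; rewrite a0 /decode_word.
    by case: pickP => // a' /forallP/(_ k0); rewrite E.
  by rewrite (bigD1 k0)//= ?eqxx ?mul1r bk ler_wpDr ?sumr_ge0// => k _; rewrite mulr_ge0.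
- move=> z s k tz Ws; have sp := Wp z s Ws; rewrite /errk /tx; case tt: t.
    exact: (C_on (msg_block b a k) tz sp).
  case: eqP => _; last by rewrite big1 ?mulr0// => y _; rewrite mul0r mulr0.
  by under eq_bigr do rewrite mul1r; exact: C_off.
- move=> z tz; rewrite -big_mkcond/= prodr_const; apply: typ_Lam => //.
  exact: max_card.
rewrite lerD2r -[leRHS](@avg_inj_const R n J)//; apply: avg_inj_le => f fI.
by apply: atypE; apply: leq_trans (hamming_weight_place _ _) (max_card _).
Qed.

End Reliability.

End HiddenCode.

(** * Deviation and birthday estimates *)

Section Deviation.
Variable R : realType.

Lemma sum_hamming n (z : bits n) : (hamming_weight z)%:R = \sum_i (z i)%:R :> R.
Proof.
rewrite -natr_sum; congr (_%:R); rewrite /hamming_weight -sum1_card big_mkcond/=.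
by apply: eq_bigr => i _; rewrite unfold_in; case: (z i).
Qed.

(** Chernoff with a free tilt; the sign of [s] selects the upper or the lower tail. *)
Lemma bernoulli_deviation n (u s c : R) : 0 <= u <= 1 -> `|s| <= 1 / 2 ->
  \sum_(z : bits n) (\prod_i bernoulli_pmf u (z i)) *
    (c <= s * ((hamming_weight z)%:R - n%:R * u))%R%:R <= expR (2 * s ^+ 2 * (n%:R * u) - c).
Proof.
move=> /andP[u0 u1] s2.
have [->|n0] := eqVneq n 0%N.
  rewrite mul0r mulr0 add0r.
  have zE (z : bits 0) : z = [ffun=> false] by apply/ffunP => -[].
  rewrite (big_pred1 [ffun=> false]); last by move=> z; exact/esym/eqP/zE.
  rewrite big_ord0 mul1r sum_hamming big_ord0 subrr mulr0.
  case: (leP c 0) => c0; rewrite ?expR_ge0//.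
  by rewrite -[leLHS]/(1 : R) -[leLHS](@expR0 R) ler_expR oppr_ge0.
have nR : n%:R != 0 :> R by rewrite pnatr_eq0.
have b0 y : 0 <= bernoulli_pmf u y by apply: bernoulli_pmf_ge0; rewrite u0.
have K := @chernoff_prod R 'I_n bool (fun i y => bernoulli_pmf u y)
  (fun i y => s * (y%:R - u) - c / n%:R) (fun i y => b0 y).
apply: (le_trans _ (le_trans K _)).
  apply: ler_sum => z _; rewrite ler_wpM2l ?prodr_ge0// ler_nat.
  rewrite sumrB -mulr_sumr sumrB -sum_hamming !sumr_const card_ord.
  rewrite -[u *+ n]mulr_natl -[(c / _) *+ n]mulr_natr divfK// subr_ge0.
  by case: (_ <= _)%R.
rewrite prodr_const card_ord.
have E : \sum_(y : bool) bernoulli_pmf u y * expR (s * (y%:R - u) - c / n%:R) <=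
    expR (2 * s ^+ 2 * u - c / n%:R).
  have sn : - (1 / 2) <= s <= 1 / 2 by rewrite -ler_norml.
  case/andP: sn => s1 s3.
  have e1 : expR (s * (1 - u)) <= 1 + s * (1 - u) + 2 * (s * (1 - u)) ^+ 2.
    by apply: expR_le_quadratic; clear K; nra.
  have e2 : expR (s * (0 - u)) <= 1 + s * (0 - u) + 2 * (s * (0 - u)) ^+ 2.
    by apply: expR_le_quadratic; clear K; nra.
  have := expR_ge1Dx (2 * s ^+ 2 * u); set T := expR (2 * s ^+ 2 * u) => h4.
  rewrite big_bool /bernoulli_pmf /= mulr1n mulr0n !expRD -/T !mulrA -mulrDl ler_wpM2r ?expR_ge0//.
  have h1 : u * expR (s * (1 - u)) <= u * (1 + s * (1 - u) + 2 * (s * (1 - u)) ^+ 2).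
    by rewrite ler_wpM2l.
  have h2 : (1 - u) * expR (s * (0 - u)) <= (1 - u) * (1 + s * (0 - u) + 2 * (s * (0 - u)) ^+ 2).
    by rewrite ler_wpM2l// subr_ge0.
  have h3 : 0 <= s ^+ 2 * u ^+ 2 by rewrite mulr_ge0// sqr_ge0.
  clear K e1 e2; move: (expR (s * (1 - u))) (expR (s * (0 - u))) T h1 h2 h4 => A1 A2 A3 h1 h2 h4.
  lra.
apply: (@le_trans _ _ (expR (2 * s ^+ 2 * u - c / n%:R) ^+ n)).
  by rewrite lerXn2r ?nnegrE ?expR_ge0// sumr_ge0// => y _; rewrite mulr_ge0 ?expR_ge0.
rewrite -expRM_natl ler_expR mulrBr [_ * (c / _)]mulrC divfK//.
by rewrite mulrCA mulrA lerD2r -!mulrA.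
Qed.

(** Each factor of the falling factorial is at least n - m, and n / (n - m) <= 1 + 2 m / n when 2 m
    <= n. *)
Lemma falling_ratio n m : (2 * m <= n)%N -> (0 < n)%N ->
  n%:R ^+ m / (n ^_ m)%:R <= expR (2 * m%:R ^+ 2 / n%:R) :> R.
Proof.
move=> mn n0; have nR : 0 < n%:R :> R by rewrite ltr0n.
have mnR : 2 * m%:R <= n%:R :> R by rewrite -natrM ler_nat.
have nmR : 0 < n%:R - m%:R :> R by lra.
have m0 : 0 <= m%:R :> R by [].
have h : (n%:R - m%:R) ^+ m <= (n ^_ m)%:R :> R.
  rewrite ffact_prod natr_prod -[in X in _ ^+ X](card_ord m) -prodr_const.
  apply: ler_prod => i _; rewrite ltW//= natrB; last first.
    by apply: leq_trans (ltnW (ltn_ord i)) _; apply: leq_trans mn; rewrite leq_pmull.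
  by rewrite lerB// ler_nat ltnW.
rewrite ler_pdivrMr; last by apply: lt_le_trans h; rewrite exprn_gt0.
apply: (@le_trans _ _ (expR (2 * m%:R ^+ 2 / n%:R) * (n%:R - m%:R) ^+ m)); last first.
  by rewrite ler_wpM2l ?expR_ge0.
rewrite -ler_pdivrMr ?exprn_gt0// -expr_div_n.
have -> : 2 * m%:R ^+ 2 / n%:R = m%:R * (2 * m%:R / n%:R) :> R by rewrite expr2; ring.
rewrite expRM_natl lerXn2r ?nnegrE ?expR_ge0 ?divr_ge0 ?(ltW nmR)//.
apply: le_trans (expR_ge1Dx _).
rewrite ler_pdivrMr// -subr_ge0.
have -> : (1 + 2 * m%:R / n%:R) * (n%:R - m%:R) - n%:R =
    m%:R / n%:R * (n%:R - 2 * m%:R) :> R by field; rewrite gt_eqF.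
by rewrite mulr_ge0 ?divr_ge0 ?subr_ge0// ltW.
Qed.

End Deviation.

(** * Codebooks against every jamming vector *)

Section JamResistantCodebook.
Variables (R : realType) (p q rho : R).
Hypotheses (p_gt0 : 0 < p) (p_lt_q : p < q) (q_lt : q < 1 / 2) (rho01 : 0 <= rho <= 1).

Definition ratio_gap : R := (1 - q) / q - q / (1 - q).

Let q0 : 0 < q. Proof. by apply: lt_trans p_lt_q. Qed.
Let q1 : 0 < 1 - q. Proof. by have h := q_lt; lra. Qed.

Lemma ratio_gap_ge0 : 0 <= ratio_gap.
Proof.
rewrite /ratio_gap subr_ge0 ler_pdivrMr ?q1// mulrAC ler_pdivlMr ?q0//.
by have h := q_lt; have h0 := q0; nra.
Qed.

(** [flip_ratio] has mean 1 under Bern(q), so only the deviation of the weight of z from n q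
    matters. *)
Lemma mean_ratioE n (z : bits n) : (0 < n)%N ->
  mean_ratio q z = 1 + ((hamming_weight z)%:R / n%:R - q) * ratio_gap.
Proof.
move=> n0; have nR : n%:R != 0 :> R by rewrite pnatr_eq0 -lt0n.
have qn : q != 0 by rewrite gt_eqF// q0.
have q1n : 1 - q != 0 by rewrite gt_eqF// q1.
have -> : mean_ratio q z = n%:R^-1 * \sum_a (q / (1 - q) + (z a)%:R * ratio_gap).
  congr (_ * _); apply: eq_bigr => a _; rewrite /flip_ratio /ratio_gap.
  by case: (z a) => /=; rewrite ?mul1r ?mul0r ?addr0// [RHS]addrC subrK.
rewrite big_split/= sumr_const card_ord -mulr_suml -sum_hamming -[_ *+ n]mulr_natl.
by rewrite /ratio_gap; field; rewrite qn q1n nR.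
Qed.

Lemma mean_ratio_bounds n (z : bits n) (a d : R) : (0 < n)%N ->
  `|(hamming_weight z)%:R - n%:R * q| <= a -> a * ratio_gap <= d * n%:R ->
  1 - d <= mean_ratio q z <= 1 + d.
Proof.
move=> n0 za ad; have nR : 0 < n%:R :> R by rewrite ltr0n.
have g0 := ratio_gap_ge0.
rewrite mean_ratioE//.
have -> : (hamming_weight z)%:R / n%:R - q = ((hamming_weight z)%:R - n%:R * q) / n%:R.
  by rewrite mulrBl [n%:R * q]mulrC mulfK// gt_eqF.
set X := _ / _ * _; have : `|X| <= d.
  rewrite /X !normrM normfV (ger0_norm g0) [`|n%:R|]ger0_norm ?(ltW nR)//.
  by rewrite mulrAC ler_pdivrMr// (le_trans _ ad)// ler_wpM2r.
by rewrite ler_norml => /andP[]; lra.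
Qed.

(** The channel depends on (z, s) through the numbers of flips on ones and on zeros of z and the
    weight of z, hence (n + 1)^3 channels; silence adds n + 1 output laws. *)
Lemma jam_resistant_codebook (delta R0 : R) : 0 < delta <= 1 -> R0 < nat_info p q rho ->
  exists E d : R, [/\ 0 < E, 0 < d, d < 1 & forall (n l b w : nat) (a : R), (0 < n)%N ->
  a * ratio_gap <= d * n%:R -> b%:R * ln 2 <= R0 * l%:R -> (rho + delta) * l%:R <= w%:R ->
  let eps := 6 * ((n.+1%:R) ^+ 3 + n.+1%:R + 1) * expR (- E * l%:R) in eps < 1 ->
  exists (C : bits b -> bits l) (bdec : bits l -> option (bits b)),
  [/\ forall (z s : bits n) u, `|(hamming_weight z)%:R - n%:R * q| <= a ->
        (hamming_weight s)%:R <= p * n%:R ->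
        \sum_(y : bits l) (\prod_i flip_channel (jam_rate0 R s) (jam_rate1 q z s) (C u i) (y i)) *
          (bdec y != Some u)%:R <= eps,
      forall s : bits n, \sum_(y : bits l) (\prod_i bernoulli_pmf (jam_rate0 R s) (y i)) *
          (bdec y != None)%:R <= eps &
      forall u, (hamming_weight (C u) <= w)%N]].
Proof.
move=> delta01 RI.
have [E [xi [E0 xi0 xi1 H]]] := good_codebooks p_gt0 p_lt_q q_lt rho01 delta01 RI.
have [f0 f1] := flip1_bounds p_gt0 p_lt_q q_lt.
have q0' := q0; have q1' := q1.
have fx : 0 < flip1 p q + xi by rewrite addr_gt0.
(* Dividing [flip1 p q] by [1 - d] then gives exactly [flip1 p q + xi]. *)
exists E, (xi / (flip1 p q + xi)); split=> //; first by rewrite divr_gt0.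
  by rewrite ltr_pdivrMr// mul1r ltrDr.
set d := xi / _ => n l b w a n0 ad Rl wl eps eps1.
have dE : (1 - d) * (flip1 p q + xi) = flip1 p q.
  by rewrite mulrBl mul1r divfK ?gt_eqF// addrK.
have d1 : 0 < 1 - d by rewrite subr_gt0 ltr_pdivrMr// mul1r ltrDr.
have nR : 0 < n%:R :> R by rewrite ltr0n.
pose T := ('I_n.+1 * 'I_n.+1 * 'I_n.+1)%type.
(* The clipping in [alpha] and [beta] only tames count triples that violate the constraints; it is
   inactive for the z and s considered. *)
pose alpha (t : T) : R := Num.min ((t.1.1%:R + t.1.2%:R) / n%:R) p.
pose beta (t : T) : R := Num.max 0 (Num.min
  ((t.1.1%:R * ((1 - q) / q) + t.1.2%:R * (q / (1 - q))) / n%:R / (1 + (t.2%:R / n%:R - q) * ratio_gap))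
  (flip1 p q + xi)).
pose alpha0 (k : 'I_n.+1) : R := k%:R / n%:R.
have := H l b w T 'I_n.+1 alpha beta alpha0.
have -> : #|{: T}|%:R = n.+1%:R ^+ 3 :> R.
  by rewrite !card_prod card_ord !natrM -!expr2 -exprSr.
rewrite card_ord => /(_ _ _ _ Rl wl eps1)[t|t|t|C [bdec [C1 C2 C3]]].
- by rewrite /alpha le_min ge_min lexx orbT (ltW p_gt0) divr_ge0 ?addr_ge0.
- by rewrite /beta le_max lexx/= ge_max (ltW fx)/= ge_min lexx orbT.
- by rewrite /alpha0 divr_ge0//= ler_pdivrMr// mul1r ler_nat -ltnS.
exists C, bdec; split=> // [z s u za sp|s]; last first.
  have := C2 (inord (hamming_weight s)).
  by rewrite /alpha0 inordK ?ltnS ?hamming_weight_le// sum_hamming mulrC.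
pose k1 := #|[pred i | s i && z i]|; pose k0 := #|[pred i | s i && ~~ z i]|.
have k1n : (k1 < n.+1)%N by rewrite ltnS -[n in (_ <= n)%N]card_ord max_card.
have k0n : (k0 < n.+1)%N by rewrite ltnS -[n in (_ <= n)%N]card_ord max_card.
have k1E : k1%:R = \sum_i (s i && z i)%:R :> R.
  by rewrite -natr_sum /k1 -sum1_card big_mkcond.
have k0E : k0%:R = \sum_i (s i && ~~ z i)%:R :> R.
  by rewrite -natr_sum /k0 -sum1_card big_mkcond.
have := C1 (inord k1, inord k0, inord (hamming_weight z)) u.
rewrite /alpha /beta/= !inordK ?ltnS ?hamming_weight_le//.
rewrite -mean_ratioE//.
have -> : (k1%:R + k0%:R) / n%:R = jam_rate0 R s.
  rewrite k1E k0E -big_split/= mulrC; congr (_ * _); apply: eq_bigr => i _.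
  by case: (s i); case: (z i); rewrite /= ?addr0 ?add0r.
have -> : (k1%:R * ((1 - q) / q) + k0%:R * (q / (1 - q))) / n%:R / mean_ratio q z = jam_rate1 q z s.
  congr (_ / _); rewrite k1E k0E mulrC !mulr_suml -big_split/=; congr (_ * _).
  by apply: eq_bigr => i _; case: (s i); case: (z i); rewrite /= ?mul0r ?mul1r ?addr0 ?add0r.
have sp' : jam_rate0 R s <= p by rewrite /jam_rate0 -sum_hamming mulrC ler_pdivrMr.
rewrite min_l//.
have [m1 _] := andP (mean_ratio_bounds n0 za ad).
have m0 : 0 < mean_ratio q z by apply: lt_le_trans m1.
have r0 y : 0 <= flip_ratio q y by apply: flip_ratio_ge0; apply/andP; split; lra.
have j0 : 0 <= jam_rate1 q z s.
  rewrite divr_ge0 ?(ltW m0)// mulr_ge0 ?invr_ge0//; apply: sumr_ge0 => i _.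
  by rewrite mulr_ge0.
have j1 : jam_rate1 q z s <= flip1 p q + xi.
  rewrite ler_pdivrMr//; apply: (@le_trans _ _ (flip1 p q)); last first.
    by rewrite -[leLHS]dE mulrC ler_wpM2l// ltW.
  rewrite mulrC ler_pdivrMr//.
  (* The worst jamming puts all its flips on ones of z: this is where (1 - q) p / q comes from. *)
  apply: (@le_trans _ _ ((hamming_weight s)%:R * ((1 - q) / q))).
    rewrite sum_hamming mulr_suml; apply: ler_sum => i _; rewrite ler_wpM2l//.
    case: (z i) => //=; have := ratio_gap_ge0; rewrite /ratio_gap; lra.
  have -> : flip1 p q * n%:R = p * n%:R * ((1 - q) / q) by rewrite /flip1; ring.
  by rewrite ler_wpM2r// divr_ge0// ltW.
by rewrite min_l// max_r.
Qed.

End JamResistantCodebook.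

(** * Growth rates and rounding *)

Section Growth.
Variable R : realType.

Lemma natceil_itv (x : R) : 0 <= x -> x <= `|Num.ceil x|%:R < x + 1.
Proof.
move=> x0; have /andP[h1 h2] := ceil_itv x.
have c0 : 0 <= Num.ceil x by rewrite ceil_ge0 (lt_le_trans _ x0)// ltrN10.
rewrite natr_absz ger0_norm// h2/=.
by move: h1; rewrite rmorphB/= ltrBlDr.
Qed.

Lemma up_log_le_ln (k : nat) : (1 < k)%N -> ((up_log 2 k)%:R - 1) * ln 2 <= ln (k.-1%:R : R).
Proof.
move=> k1; have u0 : (0 < up_log 2 k)%N by rewrite up_log_gt0.
have k0 : (0 < k.-1)%N by rewrite -ltnS (ltn_predK k1).
have H : (2 ^ (up_log 2 k).-1 <= k.-1)%N by rewrite -ltnS (ltn_predK k1) up_log_gtn.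
have -> : (up_log 2 k)%:R - 1 = (up_log 2 k).-1%:R :> R by rewrite -subn1 natrB.
rewrite -ler_expR lnK ?posrE ?ltr0n// expRM_natl lnK ?posrE//.
by rewrite -natrX ler_nat.
Qed.

Lemma ln2_ge : 1 / 2 <= ln 2 :> R.
Proof.
have := @le_ln1Dx R (- (1 / 2)); rewrite (_ : 1 + - (1 / 2) = 2^-1 :> R); last by lra.
rewrite lnV ?posrE//; lra.
Qed.

Lemma expR_log_len n : n.+1%:R <= expR ((up_log 2 n.+1)%:R : R).
Proof.
apply: (@le_trans _ _ (2 ^+ up_log 2 n.+1)).
  by rewrite -natrX ler_nat up_logP.
rewrite -[X in expR X]mulr1 expRM_natl lerXn2r ?nnegrE ?expR_ge0//.
by have := expR_ge1Dx (1 : R); rewrite (_ : 1 + 1 = 2 :> R).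
Qed.

(** With t the fourth root of n, log n is at most a multiple of t while sqrt n is t^2. *)
Lemma log_len_sqrt (K e : R) : 0 <= K -> 0 < e ->
  exists n0, forall n, (n0 <= n)%N -> K * (1 + (up_log 2 n.+1)%:R) <= e * Num.sqrt n%:R.
Proof.
move=> K0 e0.
pose M : R := 1 + 11 * K / e.
have M1 : 1 <= M by rewrite lerDl divr_ge0 ?mulr_ge0// ltW.
exists `|Num.ceil (M ^+ 4)|%N => n nn.
have Mn : M ^+ 4 <= n%:R.
  have /andP[h _] := natceil_itv (exprn_ge0 4 (le_trans ler01 M1)).
  by apply: (le_trans h); rewrite ler_nat.
set t := Num.sqrt (Num.sqrt n%:R : R).
have t2 : t ^+ 2 = Num.sqrt n%:R by rewrite sqr_sqrtr// sqrtr_ge0.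
have t4 : t ^+ 4 = n%:R by rewrite -[4%N]/(2 * 2)%N exprM t2 sqr_sqrtr.
have Mt : M <= t.
  rewrite -(@ler_pXn2r _ 4) ?nnegrE ?sqrtr_ge0 ?(le_trans ler01 M1)//.
  by rewrite t4.
have t0 : 0 < t by apply: lt_le_trans Mt; apply: lt_le_trans M1.
have n_ge1 : (0 < n)%N.
  by rewrite -(ltr0n R); apply: lt_le_trans Mn; rewrite exprn_gt0// (lt_le_trans _ M1).
have lnn : ln (n%:R : R) <= 4 * t.
  rewrite -t4 lnXn// -[leLHS]mulr_natl ler_wpM2l//.
  have := @le_ln1Dx R (t - 1); rewrite (_ : 1 + (t - 1) = t); last by ring.
  by move=> /(_ ltac:(lra)); lra.
have := up_log_le_ln (n_ge1 : (1 < n.+1)%N); rewrite /=.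
set L := (up_log 2 n.+1)%:R => LL.
have L8 : L <= 1 + 8 * t.
  have l2 := ln2_ge.
  have [?|L1] := leP L 1; first by lra.
  have : (L - 1) * (1 / 2) <= (L - 1) * ln 2 by rewrite ler_wpM2l// subr_ge0 ltW.
  lra.
rewrite -t2; apply: (@le_trans _ _ (K * (11 * t))).
  rewrite ler_wpM2l//; have := Mt; have := M1; lra.
rewrite mulrA expr2 mulrA ler_wpM2r ?(ltW t0)//.
have : e * M <= e * t by rewrite ler_wpM2l// ltW.
by rewrite /M mulrDr mulr1 mulrCA divff ?gt_eqF// mulr1; lra.
Qed.

Lemma log_len_large (K : R) : exists n0, forall n, (n0 <= n)%N -> K <= (up_log 2 n.+1)%:R.
Proof.
exists (2 ^ (Num.truncn K).+1)%N => n nn.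
apply: ltW; apply: lt_le_trans (truncnS_gt K) _; rewrite ler_nat.
by rewrite -(leq_exp2l _ _ (isT : (1 < 2)%N)); apply: leq_trans nn (ltnW (up_log_gt n)).
Qed.

Definition msg_count (r : R) (n : nat) : nat := `|Num.ceil (expR (r * Num.sqrt n%:R * ln 2))|%N.

Lemma msg_count_itv r n : expR (r * Num.sqrt n%:R * ln 2) <= (msg_count r n)%:R <
  expR (r * Num.sqrt n%:R * ln 2) + 1.
Proof. exact/natceil_itv/expR_ge0. Qed.

(** Rounding up adds less than 1 to a number that is at least 1, so it less than doubles it and
    costs less than one bit. *)
Lemma msg_count_throughput r : 0 <= r -> has_throughput r (msg_count r).
Proof.
move=> r0 n; have /andP[h1 h2] := msg_count_itv r n.
have l2 : 0 < ln 2 :> R by have := ln2_ge; lra.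
have N0 : 0 < (msg_count r n)%:R :> R by apply: lt_le_trans h1; rewrite expR_gt0.
split; first by rewrite -(ltr0n R).
rewrite /log2 ler_pdivlMr// ltr_pdivrMr//; apply/andP; split.
  by rewrite -ler_expR lnK ?posrE.
rewrite -ltr_expR lnK ?posrE// mulrDl mul1r expRD lnK ?posrE//.
have : 1 <= expR (r * Num.sqrt n%:R * ln 2).
  by rewrite -[leLHS](@expR0 R) ler_expR !mulr_ge0// ltW.
by lra.
Qed.

Lemma msg_len_le r n : 0 <= r -> (up_log 2 (msg_count r n).+1)%:R <= r * Num.sqrt n%:R + 2.
Proof.
move=> r0; have /andP[h1 h2] := msg_count_itv r n.
have [N0 _] := msg_count_throughput r0 n.
have l2 : 0 < ln 2 :> R by have := ln2_ge; lra.
have := @up_log_le_ln (msg_count r n).+1 N0; rewrite /= => H.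
have : ln ((msg_count r n)%:R : R) <= (r * Num.sqrt n%:R + 1) * ln 2.
  have [_ /andP[_ /ltW]] := msg_count_throughput r0 n.
  by rewrite /log2 ler_pdivrMr.
move=> /(le_trans H); rewrite ler_pM2r//; lra.
Qed.

Lemma key_length_ge c n (k : nat) : 0 <= c -> (0 < n)%N ->
  k%:R <= c * Num.sqrt n%:R * log2 (n%:R : R) -> (k <= key_length c n)%N.
Proof.
move=> c0 n0 kc; have l2 : 0 < ln 2 :> R by have := ln2_ge; lra.
have y0 : 0 <= c * Num.sqrt n%:R * log2 (n%:R : R).
  by rewrite mulr_ge0 ?divr_ge0 ?(ltW l2) ?ln_ge0 ?ler1n// mulr_ge0.
have /andP[h _] := natceil_itv y0.
by rewrite -(ler_nat R) (le_trans kc).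
Qed.

Lemma log_len_log2 n : (1 < n)%N -> (up_log 2 n.+1)%:R <= 2 * log2 (n%:R : R).
Proof.
move=> n1; have l2 : 0 < ln 2 :> R by have := ln2_ge; lra.
have := @up_log_le_ln n.+1 (ltnW n1); rewrite /= => H.
have n2 : ln 2 <= ln (n%:R : R) by rewrite ler_ln ?posrE ?ler_nat ?ltr0n// ltnW.
rewrite /log2 mulrA ler_pdivlMr//; lra.
Qed.

End Growth.

(** * Asymptotics of detection and decoding errors *)

Section CovertLimit.
Variable R : realType.

Lemma gaussianQ_half (x : R) : 0 < x -> gaussianQ x < 1 / 2.
Proof.
move=> x0; have := gaussianQ_lt x0.
by have := @gaussianQN R 0; rewrite oppr0; lra.
Qed.

(** [beta_shift] for the tails of length n, whose derivative is a Beta kernel with exponents summing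
    to n - 1; this explains [n.-1]. Thresholds 0 and above n give constant tails. *)
Lemma bernoulli_tail_gap (q h x : R) : 0 < q < 1 -> 0 < h -> h < x ->
  exists n0, forall n, (n0 <= n)%N -> forall s,
  bernoulli_tail n s (q + 2 * h * Num.sqrt (q * (1 - q)) / Num.sqrt n.-1%:R) - bernoulli_tail n s q <=
  1 - 2 * gaussianQ x.
Proof.
move=> q01 h0 hx; have Qx := gaussianQ_half (lt_trans h0 hx).
have [M M0 H] := beta_shift q01 h0 hx.
exists (`|Num.ceil (M ^+ 2)|%N).+1 => n nn s.
have M2 : (M : R) ^+ 2 <= n.-1%:R.
  have /andP[k _] := natceil_itv (exprn_ge0 2 (ltW M0)).
  by apply: (le_trans k); rewrite ler_nat -ltnS (ltn_predK nn).
have Mn : M <= Num.sqrt n.-1%:R by rewrite -[leLHS](ger0_norm (ltW M0)) -sqrtr_sqr ler_sqrt.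
case: s => [|s].
  have E u : bernoulli_tail n 0 u = 1.
    by rewrite /bernoulli_tail; under eq_bigr do rewrite leq0n mulr1; exact: sum_prod_bernoulli.
  by rewrite !E; lra.
case: n nn M2 Mn => // n nn M2 Mn /=; rewrite /= in Mn.
have [sn|ns] := leqP s n; last first.
  have E u : bernoulli_tail n.+1 s.+1 u = 0.
    rewrite /bernoulli_tail big1// => z _; case: leqP; rewrite ?mulr0// => sz.
    by have := leq_trans sz (hamming_weight_le z); rewrite ltnS leqNgt ns.
  by rewrite !E; lra.
apply: (H (Num.sqrt n%:R) s (n - s)%N (n.+1%:R * 'C(n, s)%:R)) => //.
- by rewrite subnKC// sqr_sqrtr.
- by move=> u; exact: is_derive_bernoulli_tail.
- by move=> u; exact: bernoulli_tail_01.
Qed.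

End CovertLimit.

Section ReliabilityLimit.
Variables (R : realType) (n : nat) (q : R).
Hypotheses (n_ge4 : (4 <= n)%N) (q0 : 0 < q) (q_lt : q < 1 / 2).
Local Notation L := (up_log 2 n.+1).

Let n0 : (0 < n)%N. Proof. exact: leq_trans n_ge4. Qed.
Let nR : 0 < n%:R :> R. Proof. by rewrite ltr0n. Qed.
Let sq0 : 0 < Num.sqrt n%:R :> R. Proof. by rewrite sqrtr_gt0. Qed.
Let sqn : Num.sqrt n%:R ^+ 2 = n%:R :> R. Proof. by rewrite sqr_sqrtr// ltW. Qed.

Lemma hamming_weight_xor (x e : bits n) :
  (hamming_weight (xorb_bits x e) <= hamming_weight x + hamming_weight e)%N.
Proof.
rewrite -(ler_nat R) natrD !sum_hamming -big_split/=; apply: ler_sum => i _.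
by rewrite ffunE -natrD ler_nat; case: (x i); case: (e i).
Qed.

(** The input moves the weight by at most K sqrt n. For the noise itself the tilt 1 / sqrt n makes
    the quadratic term 2 q, which the constant 2 absorbs. *)
Lemma atypical_noise (K : R) (x : bits n) : (hamming_weight x)%:R <= K * Num.sqrt n%:R ->
  \sum_e noise_law q e * (~~ (`|(hamming_weight (xorb_bits x e))%:R - n%:R * q| <=
     (2 + K + L%:R) * Num.sqrt n%:R))%R%:R <= 2 * expR (- L%:R).
Proof.
move=> xK; have q0' := q0; have q1' := q_lt; have sq0' := sq0.
have q01 : 0 <= q <= 1 by apply/andP; split; lra.
pose s : R := (Num.sqrt n%:R)^-1.
have s0 : 0 < s by rewrite invr_gt0.
have s2 : s <= 1 / 2.
  have : 2 <= Num.sqrt n%:R :> R.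
    have -> : 2 = Num.sqrt (4%:R) :> R by rewrite -[4%N]/(2 ^ 2)%N natrX sqrtr_sqr ger0_norm.
    by rewrite ler_sqrt// ler_nat.
  by move=> h; rewrite /s mul1r lef_pV2 ?posrE.
have key (v : R) : `|v| <= 1 / 2 -> v ^+ 2 = s ^+ 2 ->
    \sum_(e : bits n) (\prod_i bernoulli_pmf q (e i)) *
    (2 + L%:R <= v * ((hamming_weight e)%:R - n%:R * q))%R%:R <= expR (- L%:R).
  move=> v2 vs; apply: le_trans (bernoulli_deviation n (2 + L%:R) q01 v2) _.
  rewrite ler_expR vs /s exprVn sqn -!mulrA mulKf ?gt_eqF//; lra.
have k1 : `|s| <= 1 / 2 by rewrite ger0_norm// ltW.
have k2 : `|- s| <= 1 / 2 by rewrite normrN.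
have H := lerD (key s k1 erefl) (key (- s) k2 (sqrrN s)).
have {H} : \sum_(e : bits n) noise_law q e * (~~ (`|(hamming_weight (xorb_bits x e))%:R - n%:R * q| <=
     (2 + K + L%:R) * Num.sqrt n%:R))%R%:R <= expR (- L%:R) + expR (- L%:R).
  apply: le_trans H; rewrite -big_split/=; apply: ler_sum => e _.
  rewrite -mulrDr ler_wpM2l ?(noise_law_ge0 (ltW q0))//.
  case: (leP `|(hamming_weight (xorb_bits x e))%:R - n%:R * q| _) => /= h; first by rewrite addr_ge0.
  have h1 : (hamming_weight (xorb_bits x e))%:R <= (hamming_weight x)%:R + (hamming_weight e)%:R :> R.
    by rewrite -natrD ler_nat hamming_weight_xor.
  have h2 : (hamming_weight e)%:R <= (hamming_weight x)%:R + (hamming_weight (xorb_bits x e))%:R :> R.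
    rewrite -natrD ler_nat -[X in (hamming_weight X <= _)%N](xorb_bitsK x).
    exact: hamming_weight_xor.
  have sE (y : R) : (2 + L%:R <= s * y) = ((2 + L%:R) * Num.sqrt n%:R <= y).
    by rewrite /s [_^-1 * y]mulrC ler_pdivlMr.
  rewrite mulNr -mulrN !sE.
  move: h; rewrite lter_normr => /orP[h|h].
    have -> : ((2 + L%:R) * Num.sqrt n%:R <= (hamming_weight e)%:R - n%:R * q)%R by lra.
    by rewrite lerDl.
  have -> : ((2 + L%:R) * Num.sqrt n%:R <= - ((hamming_weight e)%:R - n%:R * q))%R by lra.
  by rewrite lerDr.
by move=> H; apply: le_trans H _; rewrite mulr2n mulrDl !mul1r.
Qed.

(** Three times log n bits per digit make 2^D at least (n + 1)^3, against a numerator of at most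
    n^2. *)
Lemma key_loss_le (m : nat) : (m <= n)%N -> m%:R * (n%:R / 2 ^+ (3 * L)) <= n.+1%:R^-1 :> R.
Proof.
move=> mn; set nu := n.+1%:R; have nu0 : 0 < nu :> R by rewrite ltr0n.
have k1 : nu ^+ 3 <= 2 ^+ (3 * L) :> R.
  rewrite mulnC exprM lerXn2r ?nnegrE ?exprn_ge0 ?(ltW nu0)//.
  by rewrite -natrX ler_nat; exact: up_log_gt.
apply: (@le_trans _ _ (nu * (nu / nu ^+ 3))).
  rewrite ler_pM ?divr_ge0 ?exprn_ge0// ?ler_nat ?(leqW mn)//.
  by rewrite ler_pM ?invr_ge0 ?exprn_ge0// ?ler_nat// lef_pV2 ?posrE ?exprn_gt0.
by rewrite le_eqVlt; apply/orP; left; apply/eqP; field; rewrite gt_eqF.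
Qed.

(** For typical z the normalization is at most exp(K (2 + K + L) g), a power of n. The rate K g + 5
    assumed in the bound on [eps] cancels it and leaves exp(- 5 L) against the fourth power of n +
    1. *)
Lemma reliability_bound (p K d eps : R) N Delta B b l (C : bits b -> bits l)
    (bdec : bits l -> option (bits b)) (n_gt0 : (0 < n)%N) :
  let J := (('I_B * 'I_l)%type : finType) in
  let a : R := (2 + K + L%:R) * Num.sqrt n%:R in
  0 < p -> p < q -> 0 <= K -> 0 <= d -> d < 1 -> (0 < N)%N -> (0 < B)%N -> (N < 2 ^ (B * b))%N ->
  (0 < l)%N ->
  #|J|%:R <= K * Num.sqrt n%:R -> (2 * #|J| <= n)%N -> (#|J| * (3 * L) <= Delta)%N ->
  a * ratio_gap q <= d * n%:R ->
  (forall (z s : bits n) u, `|(hamming_weight z)%:R - n%:R * q| <= a ->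
        (hamming_weight s)%:R <= p * n%:R ->
        \sum_(y : bits l) (\prod_i flip_channel (jam_rate0 R s) (jam_rate1 q z s) (C u i) (y i)) *
          (bdec y != Some u)%:R <= eps) ->
  (forall s : bits n, \sum_(y : bits l) (\prod_i bernoulli_pmf (jam_rate0 R s) (y i)) *
          (bdec y != None)%:R <= eps) ->
  0 <= eps -> eps <= 18 * n.+1%:R ^+ 3 * expR (- (K * ratio_gap q + 5) * L%:R) ->
  forall W t, jamming_strategy p W ->
  decoding_error (hidden_code N Delta (3 * L) B n_gt0 C bdec) q W t <=
    (3 + 18 * expR (2 * K ^+ 2 + K * (2 + K) * ratio_gap q)) / n.+1%:R.
Proof.
move=> J a p0 pq K0 d0 d1 N0 B0 NB l0 mK mn mD ad C1 C2 eps0 epsE W t jamW.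
have g0 := ratio_gap_ge0 p0 pq q_lt.
have nR' := nR; have sq0' := sq0.
set g := ratio_gap q in ad epsE g0 *; set nu := n.+1%:R.
have nu0 : 0 < nu :> R by rewrite ltr0n.
have LL : 0 <= L%:R :> R by [].
have eL : expR (- L%:R) <= nu^-1.
  by rewrite expRN lef_pV2 ?posrE ?expR_gt0//; exact: expR_log_len.
have mn' : (#|J| <= n)%N by apply: leq_trans mn; rewrite leq_pmull.
have n2L : (n < 2 ^ L)%N by exact: up_log_gt.
have nD : (n <= 2 ^ (3 * L))%N.
  by apply: (leq_trans (ltnW n2L)); rewrite leq_exp2l// leq_pmull.
pose typ := [pred z : bits n | `|(hamming_weight z)%:R - n%:R * q| <= a].
pose Lam := expR (K * (2 + K + L%:R) * g).
have := @decoding_error_hidden R n N Delta (3 * L) B b l q C bdec n_gt0 N0 q0 q_lt mn' mD nD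
  p W typ eps Lam (2 * expR (- L%:R)) jamW C1 C2 _ eps0 _ _ _ B0 NB t.
move=> H; apply: le_trans (H _ _ _ _) _; clear H.
- move=> z /= tz; have /andP[h _] := mean_ratio_bounds p0 pq q_lt n_gt0 tz ad.
  by apply: lt_le_trans h; rewrite subr_gt0.
- by rewrite /Lam -[leLHS](@expR0 R) ler_expR !mulr_ge0// !addr_ge0.
- move=> z /= tz k km.
  have ad' : a * g <= (a * g / n%:R) * n%:R by rewrite divfK// gt_eqF.
  have /andP[_ h] := mean_ratio_bounds p0 pq q_lt n_gt0 tz ad'.
  have /andP[h0 _] := mean_ratio_bounds p0 pq q_lt n_gt0 tz ad.
  have m0 : 0 <= mean_ratio q z by apply: le_trans h0; rewrite subr_ge0 ltW.
  have agn : a * g / n%:R = (2 + K + L%:R) * g / Num.sqrt n%:R.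
    by rewrite /a -[X in _ / X = _]sqn; field; rewrite gt_eqF.
  have agn0 : 0 <= a * g / n%:R by rewrite agn divr_ge0 ?(ltW sq0')// mulr_ge0// !addr_ge0.
  apply: (@le_trans _ _ (expR (a * g / n%:R) ^+ k)).
    by rewrite lerXn2r ?nnegrE ?expR_ge0//; apply: le_trans h _; exact: expR_ge1Dx.
  rewrite -expRM_natl ler_expR.
  apply: (@le_trans _ _ (K * Num.sqrt n%:R * (a * g / n%:R))).
    by rewrite ler_wpM2r// (le_trans _ mK)// ler_nat.
  by rewrite agn le_eqVlt; apply/orP; left; apply/eqP; field; rewrite gt_eqF.
- move=> x xm; apply: (@atypical_noise K x); by apply: (le_trans _ mK); rewrite ler_nat.
have h1 : n%:R ^+ #|J| / (n ^_ #|J|)%:R <= expR (2 * K ^+ 2) :> R.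
  apply: le_trans (falling_ratio R mn n_gt0) _; rewrite ler_expR.
  rewrite ler_pdivrMr// -mulrA ler_wpM2l//.
  have -> : K ^+ 2 * n%:R = (K * Num.sqrt n%:R) ^+ 2 by rewrite exprMn sqn.
  by rewrite lerXn2r ?nnegrE ?mulr_ge0.
have h2 : B%:R <= nu.
  rewrite ler_nat; apply: (@leq_trans #|J|); last exact: leqW.
  by rewrite card_prod !card_ord leq_pmulr.
have h3 : Lam * (B%:R * eps) <= 18 * expR (K * (2 + K) * g) / nu.
  apply: (@le_trans _ _ (Lam * (nu * (18 * nu ^+ 3 * expR (- (K * g + 5) * L%:R))))).
    by rewrite ler_wpM2l ?expR_ge0// ler_pM.
  have -> : Lam * (nu * (18 * nu ^+ 3 * expR (- (K * g + 5) * L%:R))) =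
      18 * expR (K * (2 + K) * g) * (nu ^+ 4 * expR (- L%:R) ^+ 5).
    have -> : Lam = expR (K * (2 + K) * g) * expR (K * g * L%:R).
      by rewrite /Lam -expRD; congr expR; ring.
    have -> : - (K * g + 5) * L%:R = - (K * g * L%:R) + 5%:R * (- L%:R) by ring.
    rewrite expRD expRM_natl expRN.
    have e0 : expR (K * g * L%:R) != 0 by rewrite gt_eqF ?expR_gt0.
    by field.
  rewrite ler_wpM2l ?mulr_ge0 ?expR_ge0//.
  have -> : nu^-1 = nu ^+ 4 * nu^-1 ^+ 5.
    by field; rewrite gt_eqF.
  by rewrite ler_wpM2l ?exprn_ge0 ?(ltW nu0)// lerXn2r ?nnegrE ?expR_ge0 ?invr_ge0 ?(ltW nu0).
have h4 : #|J|%:R * (n%:R / 2 ^+ (3 * L)) <= nu^-1 :> R by exact: key_loss_le.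
have h5 : n%:R ^+ #|J| / (n ^_ #|J|)%:R * (Lam * (B%:R * eps)) <=
    expR (2 * K ^+ 2) * (18 * expR (K * (2 + K) * g) / nu).
  by rewrite ler_pM// ?mulr_ge0 ?expR_ge0// divr_ge0// exprn_ge0.
move: h5 h4 eL; rewrite expRD; set U := _ / _ * _; set V := #|_|%:R * _.
move=> h5 h4 eL.
apply: (@le_trans _ _ (2 * nu^-1 + expR (2 * K ^+ 2) * (18 * expR (K * (2 + K) * g) / nu) + nu^-1)).
  by rewrite !lerD// ler_wpM2l.
by rewrite le_eqVlt; apply/orP; left; apply/eqP; ring.
Qed.

End ReliabilityLimit.

(** A mean of at least t2 sqrt n falls to t1 sqrt n only by losing the fraction 1 - t1 / t2; a
    quarter of it is the optimal tilt. *)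
Lemma weight_shortfall (R : realType) n (theta t1 t2 : R) (w0 : nat) : 0 <= theta <= 1 ->
  0 <= t1 -> t1 < t2 -> t2 * Num.sqrt n%:R <= n%:R * theta -> w0%:R <= t1 * Num.sqrt n%:R ->
  \sum_(z : bits n) (\prod_i bernoulli_pmf theta (z i)) * (hamming_weight z < w0)%N%:R <=
  expR (- (2 * ((1 - t1 / t2) / 4) ^+ 2 * (t2 * Num.sqrt n%:R))).
Proof.
move=> th01 t10 t12 nth wt1; have t20 : 0 < t2 by apply: le_lt_trans t12.
set s := (1 - t1 / t2) / 4.
have s0 : 0 <= s by rewrite divr_ge0// subr_ge0 ler_pdivrMr// mul1r ltW.
have s1 : s <= 1 / 4.
  by rewrite /s ler_pM2r ?invr_gt0// gerBl divr_ge0// ltW.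
have s2 : `|- s| <= 1 / 2 by rewrite normrN ger0_norm//; lra.
apply: (@le_trans _ _ (expR (2 * (- s) ^+ 2 * (n%:R * theta) - 4 * s ^+ 2 * (n%:R * theta)))); last first.
  rewrite ler_expR sqrrN.
  have : 2 * s ^+ 2 * (t2 * Num.sqrt n%:R) <= 2 * s ^+ 2 * (n%:R * theta).
    by rewrite ler_wpM2l// mulr_ge0// sqr_ge0.
  lra.
apply: le_trans (bernoulli_deviation n _ th01 s2).
apply: ler_sum => z _; rewrite ler_wpM2l ?prod_bernoulli_ge0// ler_nat.
case: ltnP => // zw.
have : (hamming_weight z)%:R <= t1 / t2 * (n%:R * theta).
  apply: (@le_trans _ _ (t1 * Num.sqrt n%:R)).
    by apply: le_trans wt1; rewrite ler_nat ltnW.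
  have -> : t1 * Num.sqrt n%:R = t1 / t2 * (t2 * Num.sqrt n%:R) by rewrite mulrA divfK ?gt_eqF.
  by rewrite ler_wpM2l// divr_ge0// ltW.
move=> zn; suff -> : (4 * s ^+ 2 * (n%:R * theta) <= - s * ((hamming_weight z)%:R - n%:R * theta))%R by [].
have -> : 4 * s ^+ 2 * (n%:R * theta) = s * ((1 - t1 / t2) * (n%:R * theta)).
  have -> : 1 - t1 / t2 = 4 * s by rewrite /s; lra.
  by ring.
by rewrite mulNr -mulrN ler_wpM2l//; lra.
Qed.

(** Since 2^L <= 4 n, every factor of the costs, exponential tables included, is at most a fixed
    power of 4 n. *)
Lemma cost_bound (n N B kA lA : nat) (L := up_log 2 n.+1) : (0 < n)%N -> (0 < lA)%N ->
  (B * (lA * L) <= n)%N -> (up_log 2 N.+1 <= B * (kA * L))%N ->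
  (encoder_cost n (3 * L) B (kA * L) (lA * L) L <= 11 * (4 * n) ^ (kA + lA + 6))%N /\
  (decoder_cost n N (3 * L) B (kA * L) (lA * L) L <= 11 * (4 * n) ^ (kA + lA + 6))%N.
Proof.
move=> n0 l0 Bl nb; have L0 : (0 < L)%N by rewrite /L up_log_gt0/= ltnS.
pose X := (4 * n)%N; pose M := (X ^ (kA + lA + 6))%N.
have X1 : (0 < X)%N by rewrite /X muln_gt0.
have X4 : (4 <= X)%N by rewrite /X leq_pmulr.
have nX : (n <= X)%N by rewrite /X leq_pmull.
have LX2 : (2 ^ L <= X)%N.
  have := @up_log_gtn 2 n.+1 isT n0; rewrite -/L ltnS => H.
  rewrite -(prednK L0) expnS /X; apply: (@leq_trans (2 * n)); first by rewrite leq_mul2l.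
  by rewrite leq_mul2r orbT.
have LX : (L <= X)%N by apply: leq_trans LX2; rewrite ltnW// ltn_expl.
have pw k : (2 ^ (k * L) <= X ^ k)%N by rewrite mulnC expnM; case: k => // k; rewrite leq_exp2r.
have pw2 : (2 ^ (L + L) <= X ^ 2)%N by rewrite addnn -mul2n pw.
have bX : (kA * L <= X ^ kA)%N by apply: leq_trans (pw kA); rewrite ltnW// ltn_expl.
have BX : (B <= X)%N.
  apply: leq_trans nX; apply: leq_trans Bl; rewrite leq_pmulr// muln_gt0 l0.
  done.
have XM e : (e <= kA + lA + 6)%N -> (X ^ e <= M)%N by move=> H; rewrite leq_pexp2l.
rewrite /encoder_cost /decoder_cost /position_cost card_prod !card_ord.
set m := (B * (lA * L))%N in Bl *.
have mX : (m <= X)%N by apply: leq_trans nX.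
have p1 : (m * (L * (4 * 2 ^ (3 * L))) <= M)%N.
  apply: leq_trans (XM 6%N _); last by rewrite leq_addl.
  rewrite (_ : X ^ 6 = X * (X * (X * X ^ 3)))%N; first exact: leq_mul mX (leq_mul LX (leq_mul X4 (pw 3%N))).
  by rewrite -!expnS.
have p2 : (m * (m * (L * (4 * 2 ^ (L + L)))) <= M)%N.
  apply: leq_trans (XM 6%N _); last by rewrite leq_addl.
  rewrite (_ : X ^ 6 = X * (X * (X * (X * X ^ 2))))%N; first exact: leq_mul mX (leq_mul mX (leq_mul LX (leq_mul X4 pw2))).
  by rewrite -!expnS.
have p3 : (m * n * (4 * 2 ^ (L + L)) <= M)%N.
  apply: leq_trans (XM 5%N _); last by rewrite ltnW// leq_addl.
  rewrite (_ : X ^ 5 = X * X * (X * X ^ 2))%N; first exact: leq_mul (leq_mul mX nX) (leq_mul X4 pw2).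
  by rewrite -mulnA -!expnS.
have p4 : (m * (4 * 2 ^ (kA * L)) <= M)%N.
  apply: leq_trans (XM kA.+2 _); last by lia.
  by rewrite !expnS; exact: leq_mul mX (leq_mul X4 (pw kA)).
have p5 : (X * X <= M)%N by apply: leq_trans (XM 2%N _) => //; lia.
have p6 : (X <= M)%N by apply: leq_trans (XM 1%N _) => //; lia.
have p7 : (B * (4 * 2 ^ (lA * L)) <= M)%N.
  apply: leq_trans (XM lA.+2 _); last by lia.
  by rewrite !expnS; exact: leq_mul BX (leq_mul X4 (pw lA)).
have p8 : (B * (kA * L) * (4 * 2 ^ (lA * L)) <= M)%N.
  apply: leq_trans (XM (kA + lA).+2 _); last by lia.
  rewrite (_ : X ^ (kA + lA).+2 = X * X ^ kA * (X * X ^ lA))%N; first exact: leq_mul (leq_mul BX bX) (leq_mul X4 (pw lA)).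
  by rewrite !expnS expnD; lia.
have p9 : (B * (kA * L) <= M)%N.
  apply: leq_trans (XM kA.+1 _); last by lia.
  by rewrite expnS leq_mul.
have p10 : (n * (m * 1 + m.+1 + 1) <= 2 * M)%N.
  apply: (@leq_trans (X * (2 * X))); last by lia.
  by rewrite leq_mul//; lia.
have p11 : (m * (n * 1 + n.+1) <= M)%N.
  apply: leq_trans p5; rewrite leq_mul//; rewrite /X; lia.
by split; [|have := leq_trans nb p9]; rewrite -/M -/X; lia.
Qed.

(** * Arithmetic of the block structure *)

Section BlockArithmetic.
Variable R : realType.
Implicit Types r y c S L B b : R.

(** Here S is sqrt n, y the ratio l / b and c L the block length l: the whole code has length about
    r y S, and the rounding to full blocks is of order log n. *)
Lemma block_length_bound r y c S L B b : 0 <= y -> 0 <= c -> 0 <= L ->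
  B * b <= r * S + 2 + b -> y * b = c * L -> (2 * y + c) * (1 + L) <= 1 * S ->
  B * (y * b) <= r * y * S + 2 * y + c * L /\ B * (y * b) <= (r * y + 1) * S.
Proof.
move=> y0 c0 L0 Bb yb h.
have h1 : B * (y * b) <= r * y * S + 2 * y + c * L.
  have -> : r * y * S + 2 * y + c * L = y * (r * S + 2 + b) by rewrite -yb; ring.
  by rewrite mulrCA ler_wpM2l.
split=> //; apply: le_trans h1 _; have : 0 <= y * L by rewrite mulr_ge0.
by lra.
Qed.

(** Rounding the weight of each block to an integer costs at most [B] in all, about r S / b, which
    is a small fraction of S because b grows with n. *)
Lemma block_weight_bound r y c t1 d g S L B b l w :
  0 < g -> 0 < S -> 1 <= L -> L <= b -> 0 <= d <= 2 -> 0 <= y -> 0 <= c -> 0 <= B ->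
  g = t1 - r * y * d -> 4 * r / g <= L -> B * b <= r * S + 2 + b ->
  B * l <= r * y * S + 2 * y + c * L -> w <= d * l + 1 ->
  (2 * (2 * y + c) + 3) * (1 + L) <= g / 2 * S -> B * w <= t1 * S.
Proof.
move=> g0 S0 L1 Lb /andP[d0 d2] y0 c0 B0 gE rL Bb Bl wl h.
have b0 : 0 < b by apply: lt_le_trans Lb; apply: lt_le_trans L1.
have BS : B <= g / 4 * S + 3.
  rewrite -(ler_pM2r b0); apply: le_trans Bb _.
  have r1 : r <= g / 4 * L by move: rL; rewrite ler_pdivrMr//; lra.
  have r2 : r * S <= g / 4 * L * S by rewrite ler_wpM2r// ltW.
  have r3 : g / 4 * L * S <= g / 4 * b * S.
    by rewrite ler_wpM2r ?(ltW S0)// ler_wpM2l// ltW// divr_gt0.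
  by have r4 : 1 <= b := le_trans L1 Lb; lra.
apply: (@le_trans _ _ (B * (d * l + 1))); first by rewrite ler_wpM2l.
have u1 : d * (B * l) <= d * (r * y * S + 2 * y + c * L) by rewrite ler_wpM2l.
have u2 : d * (2 * y + c * L) <= 2 * (2 * y + c * L).
  by rewrite ler_wpM2r// addr_ge0 ?mulr_ge0// (le_trans ler01 L1).
have u3 : 0 <= y * L by rewrite mulr_ge0// (le_trans ler01 L1).
have u4 : 0 < g * S by rewrite mulr_gt0.
have u5 : r * y * d * S = t1 * S - g * S by rewrite gE; ring.
by clear wl Lb; lra.
Qed.

Lemma codebook_error_bound n (E c a : R) (L := up_log 2 n.+1) : (5 <= n)%N -> 0 <= c ->
  c + 5 <= E * a ->
  let eps := 6 * (n.+1%:R ^+ 3 + n.+1%:R + 1) * expR (- E * (a * L%:R)) in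
  [/\ 0 <= eps, eps <= 18 * n.+1%:R ^+ 3 * expR (- (c + 5) * L%:R) & eps < 1].
Proof.
move=> n5 c0 cE; set nu : R := n.+1%:R => eps.
have nu1 : 1 <= nu by rewrite ler1n.
have nu0 : 0 < nu by apply: lt_le_trans nu1.
have epsE : eps <= 18 * nu ^+ 3 * expR (- (c + 5) * L%:R).
  rewrite /eps; apply: ler_pM; first by rewrite mulr_ge0// !addr_ge0// ?exprn_ge0// ltW.
  - exact: expR_ge0.
  - have : nu <= nu ^+ 3 by apply: ler_eXnr.
    have : 1 <= nu ^+ 3 by rewrite exprn_ege1.
    by lra.
  - by rewrite ler_expR !mulNr lerN2 mulrA ler_wpM2r.
split=> //; first by rewrite mulr_ge0 ?expR_ge0// mulr_ge0// !addr_ge0// ?exprn_ge0// ltW.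
apply: le_lt_trans epsE _.
have eL : expR (- L%:R) <= nu^-1.
  by rewrite expRN lef_pV2 ?posrE ?expR_gt0//; exact: expR_log_len.
have h : expR (- (c + 5) * L%:R) <= nu^-1 ^+ 5.
  apply: (@le_trans _ _ (expR (- L%:R) ^+ 5)).
    rewrite -expRM_natl ler_expR mulNr mulrN lerN2 ler_wpM2r// lerDr//.
  by rewrite lerXn2r ?nnegrE ?expR_ge0 ?invr_ge0// ltW.
apply: (@le_lt_trans _ _ (18 * nu ^+ 3 * nu^-1 ^+ 5)).
  by rewrite ler_wpM2l// mulr_ge0// exprn_ge0// ltW.
have -> : 18 * nu ^+ 3 * nu^-1 ^+ 5 = 18 / nu ^+ 2 by field; rewrite gt_eqF.
rewrite ltr_pdivrMr ?exprn_gt0// mul1r -natrX ltr_nat.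
by apply: (@leq_trans (6 ^ 2)); rewrite // leq_exp2r.
Qed.

End BlockArithmetic.

(** * Choice of parameters and assembly *)

Section Scheme.
Variables (R : realType) (eps_d p q r rho : R).
Hypotheses (eps_d01 : 0 < eps_d < 1) (p_gt0 : 0 < p) (p_lt_q : p < q) (q_lt : q < 1 / 2).
Hypotheses (rho01 : 0 <= rho <= 1) (r_ge0 : 0 <= r).
Hypothesis r_lt : r < covert_weight q eps_d / rho * mutual_info (bernoulli_pmf rho) (bac p q).

Let sigma : R := Num.sqrt (q * (1 - q)).
Let q0 : 0 < q. Proof. exact: lt_trans p_lt_q. Qed.
Let q01 : 0 < q < 1. Proof. by have h0 := q0; have h1 := q_lt; apply/andP; split; lra. Qed.
Let sigma0 : 0 < sigma.
Proof. by have h0 := q0; have h1 := q_lt; rewrite sqrtr_gt0 mulr_gt0//; lra. Qed.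

(** [kap / lam] is a rational code rate strictly between r rho / t and the mutual information, t
    being [covert_weight]. It leaves room between the weight v needed at that rate and t, where t1
    and t2 sit at one and two thirds; [delta] costs at most a sixth. *)
Lemma scheme_parameters : exists (kap lam : nat) (t1 t2 delta h x : R),
  [/\ [/\ (0 < kap)%N, (0 < lam)%N, kap%:R / lam%:R * ln 2 < nat_info p q rho & 0 < delta <= 1],
      [/\ 0 <= t1, t1 < t2, 0 < h & h < x], 2 * h * sigma = t2 * (1 - 2 * q),
      1 - 2 * gaussianQ x < eps_d & r * (lam%:R / kap%:R) * (rho + delta) < t1].
Proof.
have h0 := q0; have h1 := q_lt; have hs := sigma0; have he := eps_d01; have hr := r_ge0.
have /andP[rho0 rho1] := rho01.
have l2 : 0 < ln 2 :> R by have := @ln2_ge R; lra.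
have H := r_lt; set I := mutual_info _ _ in H; set x0 : R := gaussianQinv ((1 - eps_d) / 2).
have tE : covert_weight q eps_d = 2 * sigma / (1 - 2 * q) * x0 by [].
rewrite tE in H.
have c0 : 0 < 2 * sigma / (1 - 2 * q) by rewrite divr_gt0 ?mulr_gt0//; lra.
set cc := 2 * sigma / _ in c0 H tE.
have Qx0 : gaussianQ x0 = (1 - eps_d) / 2.
  rewrite /x0 /gaussianQinv; case: xgetP => [y _ //|ne].
  (* Without a preimage [xget] returns 0, and the upper bound on r would be 0. *)
  exfalso; move: H; rewrite /x0 /gaussianQinv; case: xgetP => [y _ /ne//|_].
  by rewrite mulr0 !mul0r ltNge r_ge0.
have x0_gt0 : 0 < x0.
  rewrite ltNge; apply/negP => /gaussianQ_anti; rewrite Qx0.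
  by have := @gaussianQN R 0; rewrite oppr0; move: he => /andP[]; lra.
(* Division by 0 yields 0, so rho = 0 would again force r < 0. *)
have rho_gt0 : 0 < rho.
  rewrite lt_neqAle rho0 andbT; apply/eqP => E; move: H.
  by rewrite -E invr0 mulr0 mul0r ltNge r_ge0.
set t := cc * x0 in H tE; have t0 : 0 < t by rewrite mulr_gt0.
have Ir : r * rho / t < I.
  rewrite ltr_pdivrMr// [I * t]mulrC -ltr_pdivlMr// mulrAC; exact: H.
set y := r * rho / t in Ir; have y0 : 0 <= y by rewrite divr_ge0 ?(ltW t0)// mulr_ge0.
pose lam := (Num.truncn (1 / (I - y))).+1.
have lamR : 0 < lam%:R :> R by rewrite ltr0n.
pose kap := (Num.truncn (y * lam%:R)).+1.
have kapR : 0 < kap%:R :> R by rewrite ltr0n.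
have k1 : y * lam%:R < kap%:R by exact: truncnS_gt.
have k2 : kap%:R < I * lam%:R.
  have : 1 < lam%:R * (I - y) by rewrite -ltr_pdivrMr ?subr_gt0//; exact: truncnS_gt.
  have /andP[k3 _] := truncn_itv (mulr_ge0 y0 (ltW lamR)).
  rewrite /kap -natr1; lra.
pose v := r * (lam%:R / kap%:R) * rho.
have v0 : 0 <= v by rewrite !mulr_ge0// divr_ge0// ltW.
have vt : v < t.
  have : r * rho * lam%:R < kap%:R * t.
    by move: k1; rewrite /y mulrAC ltr_pdivrMr.
  have -> : v = r * rho * lam%:R / kap%:R by rewrite /v; field; rewrite gt_eqF.
  by rewrite ltr_pdivrMr// [t * _]mulrC.
pose u := r * (lam%:R / kap%:R).
have u0 : 0 <= u by rewrite mulr_ge0// divr_ge0// ltW.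
pose delta := Num.min 1 ((t - v) / (6 * (u + 1))).
have d0 : 0 < delta by rewrite lt_min ltr01 divr_gt0 ?mulr_gt0//; lra.
have ud : u * delta <= (t - v) / 6.
  apply: (@le_trans _ _ (u * ((t - v) / (6 * (u + 1))))).
    by rewrite ler_wpM2l// ge_min lexx orbT.
  have -> : u * ((t - v) / (6 * (u + 1))) = (t - v) / 6 * (u / (u + 1)) by field; rewrite gt_eqF//; lra.
  rewrite -[leRHS]mulr1 ler_wpM2l//; first by lra.
  rewrite ler_pdivrMr; lra.
pose t2 := v + 2 * (t - v) / 3.
pose h := t2 * (1 - 2 * q) / (2 * sigma).
have t2t : t2 < t by rewrite /t2; lra.
have t20 : 0 < t2 by rewrite /t2; lra.
have hx0 : h < x0.
  rewrite /h ltr_pdivrMr ?mulr_gt0//.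
  have -> : x0 * (2 * sigma) = t * (1 - 2 * q) by rewrite /t /cc; field; rewrite gt_eqF//; lra.
  by rewrite ltr_pM2r//; lra.
have h_gt0 : 0 < h by rewrite divr_gt0 ?mulr_gt0//; lra.
exists kap, lam, (v + (t - v) / 3), t2, delta, h, ((h + x0) / 2).
split; [split|split| | |] => //.
- rewrite nat_infoE -[mutual_info _ _]/I ltr_pM2r// ltr_pdivrMr//.
- by rewrite d0 ge_min lexx.
- by lra.
- by rewrite /t2; lra.
- by lra.
- by rewrite /h; field; rewrite gt_eqF.
- have : gaussianQ x0 < gaussianQ ((h + x0) / 2) by apply: gaussianQ_lt; lra.
  by rewrite Qx0; lra.
- by rewrite -/u mulrDr -/(u * rho) -/v; lra.
Qed.


Lemma jammed_sup_le n N Delta (C : jam_code n N Delta) (b : R) :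
  (forall W t, jamming_strategy p W -> decoding_error C q W t <= b) ->
  error_probability C p q <= 2 * b.
Proof.
move=> H; apply: ge_sup => [|_ [W jamW <-]]; last first.
  by have := H W true jamW; have := H W false jamW; lra.
have h0 := p_gt0.
(* Not jamming at all is a strategy, so the supremum is over a nonempty set. *)
eexists; exists (fun _ s => (s == [ffun=> false])%:R) => //; split=> [//|z|z s].
  by rewrite (bigD1 [ffun=> false])//= eqxx big1 ?addr0// => s /negbTE->.
have [->|ne] := eqVneq s [ffun=> false]; last by rewrite eqxx.
by rewrite sum_hamming big1 ?mulr_ge0// ?ltW// => i _; rewrite ffunE.
Qed.

Lemma codes_exist : exists (c K : R) (e n0 : nat), 0 < c /\ forall n, (n0 <= n)%N ->
  exists C : jam_code n (msg_count r n) (key_length c n),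
  [/\ 1 - eps_d <= detection_error C q,
      error_probability C p q <= K / n.+1%:R &
      exists cenc cdec, [/\ computes_encoder cenc C, computes_decoder cdec C,
        (circuit_size cenc <= 11 * (4 * n) ^ e)%N & (circuit_size cdec <= 11 * (4 * n) ^ e)%N]].
Proof.
have hq0 := q0; have hq1 := q_lt; have hs := sigma0; have hr := r_ge0.
have /andP[rho0 rho1] := rho01.
have [kap [lam [t1 [t2 [delta [h [x]]]]]]] := scheme_parameters.
case=> [[kap0 lam0 RI /andP[delta0 delta1]] [t10 t12 h0 hx] hE Qx rt1].
have kapR : 0 < kap%:R :> R by rewrite ltr0n.
have lamR : 0 < lam%:R :> R by rewrite ltr0n.
have lamR1 : 1 <= lam%:R :> R by rewrite ler1n.
have t20 : 0 < t2 by apply: le_lt_trans t12.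
have [E [d [E0 d0 d1 Hcode]]] := jam_resistant_codebook p_gt0 p_lt_q q_lt rho01
  (ltac:(by rewrite delta0) : 0 < delta <= 1) RI.
have g0 := ratio_gap_ge0 p_gt0 p_lt_q q_lt; set gap := ratio_gap q in g0.
have [y yE] : exists y : R, y = lam%:R / kap%:R by eexists.
have y0 : 0 <= y by rewrite yE divr_ge0.
have [K KE] : exists K, K = r * y + 1 by eexists.
have K0 : 0 <= K by rewrite KE addr_ge0 ?mulr_ge0.
have K_gt0 : 0 < K by rewrite KE ltr_pwDr// mulr_ge0.
(* [A] multiplies both block lengths, which leaves the rate alone and raises the error exponent to
   what [reliability_bound] asks for. *)
have [A A_gt0 AE] : exists2 A, (0 < A)%N & K * gap + 5 <= E * A%:R.
  exists (Num.truncn ((K * gap + 5) / E)).+1 => //.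
  by rewrite [E * _]mulrC -ler_pdivrMr//; apply/ltW/truncnS_gt.
have AR : 0 < A%:R :> R by rewrite ltr0n.
have [g gE] : exists g, g = t1 - r * y * (rho + delta) by eexists.
have gg0 : 0 < g by rewrite gE subr_gt0 yE.
have [kappa kappaE] : exists k, k = 2 * ((1 - t1 / t2) / 4) ^+ 2 * t2 by eexists.
have kappa0 : 0 < kappa.
  by rewrite kappaE mulr_gt0// mulr_gt0// exprn_gt0// divr_gt0// subr_gt0 ltr_pdivrMr// mul1r.
have [e eE] : exists e, e = eps_d - (1 - 2 * gaussianQ x) by eexists.
have e0 : 0 < e by rewrite eE subr_gt0.
have c0 : 0 <= A%:R * lam%:R :> R by rewrite mulr_ge0.
have c1 : 0 <= 2 * y + A%:R * lam%:R by apply: addr_ge0 => //; exact: mulr_ge0.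
(* All logarithmic terms are made negligible against sqrt n: in the code length, the total weight,
   twice the code length against n, the typical deviation and the shortfall exponent. *)
have [n1 H1] := @log_len_sqrt R (2 * y + A%:R * lam%:R) 1 c1 ltr01.
have [n2 H2] := @log_len_sqrt R (2 * (2 * y + A%:R * lam%:R) + 3) (g / 2)
  (addr_ge0 (mulr_ge0 (ler0n _ 2) c1) (ler0n _ 3)) (ltac:(by rewrite divr_gt0)).
have [n3 H3] := @log_len_sqrt R (2 * K) 1 (ltac:(by apply: mulr_ge0)) ltr01.
have [n4 H4] := @log_len_sqrt R ((2 + K) * gap) d (ltac:(by apply: mulr_ge0 => //; rewrite addr_ge0)) d0.
have [n5 H5] := @log_len_sqrt R (2 / e) kappa (ltac:(by apply: divr_ge0 => //; exact: ltW)) kappa0.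
have [n6 H6] := @log_len_large R (4 * r / g).
have [n7 H7] := bernoulli_tail_gap q01 h0 hx.
pose n8 := (`|Num.ceil (t2 ^+ 2)|%N + 5)%N.
pose n9 := `|Num.ceil (2 / e)|%N.
(* The key has 3 L bits for each of at most K sqrt n code bits, and L is at most 2 log n. *)
exists (6 * K), (2 * (3 + 18 * expR (2 * K ^+ 2 + K * (2 + K) * gap))), (A * kap + A * lam + 6)%N.
exists (maxn n1 (maxn n2 (maxn n3 (maxn n4 (maxn n5 (maxn n6 (maxn n7 (maxn n8 n9)))))))).
split; first by rewrite mulr_gt0.
move=> n; rewrite !geq_max => /and5P[/H1 {}H1 /H2 {}H2 /H3 {}H3 /H4 {}H4 /and5P[/H5 {}H5 /H6 {}H6 /H7 {}H7 nn8 nn9]].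
have n5' : (5 <= n)%N by apply: leq_trans nn8; rewrite leq_addl.
have n_gt0 : (0 < n)%N by apply: leq_trans n5'.
set L := up_log 2 n.+1 in H1 H2 H3 H4 H5 H6 *.
have L0 : (0 < L)%N by rewrite /L up_log_gt0/= ltnS.
have LR0 : 0 <= L%:R :> R by [].
have LR1 : 1 <= L%:R :> R by rewrite ler1n.
set S := Num.sqrt n%:R in H1 H2 H3 H4 H5 *.
have nR : 0 < n%:R :> R by rewrite ltr0n.
have S0 : 0 < S by rewrite sqrtr_gt0.
have SS : S ^+ 2 = n%:R by rewrite sqr_sqrtr// ltW.
have nu0 : 0 < n.+1%:R :> R by rewrite ltr0n.
pose N := msg_count r n.
have [N0 _] := msg_count_throughput r_ge0 n.
pose b := (A * kap * L)%N; pose l := (A * lam * L)%N.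
have b0 : (0 < b)%N by rewrite !muln_gt0 A_gt0 kap0 L0.
have l0 : (0 < l)%N by rewrite !muln_gt0 A_gt0 lam0 L0.
set nb := up_log 2 N.+1.
have nbS : nb%:R <= r * S + 2 :> R by exact: msg_len_le.
(* One block beyond the quotient, so that the blocks hold all [nb] message bits. *)
pose B := (nb %/ b).+1.
have B0 : (0 < B)%N by [].
have nbB : (nb <= B * b)%N by rewrite /B ltnW// ltn_ceil.
have NB : (N < 2 ^ (B * b))%N.
  by apply: leq_trans (up_log_gt N) _; rewrite leq_exp2l.
have Bb : (B * b <= nb + b)%N by rewrite /B mulSn addnC leq_add2r leq_divM.
have lE : l%:R = y * b%:R :> R by rewrite /l /b yE !natrM; field; rewrite gt_eqF.
have BbR : B%:R * b%:R <= r * S + 2 + b%:R :> R.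
  by rewrite -natrM; apply: (@le_trans _ _ (nb + b)%:R); rewrite ?ler_nat// natrD lerD2r.
have yb : y * b%:R = A%:R * lam%:R * L%:R by rewrite -lE /l !natrM.
have [] := block_length_bound y0 c0 LR0 BbR yb H1; rewrite -lE -natrM -KE => mR mK.
have m2 : (2 * (B * l) <= n)%N.
  rewrite -(ler_nat R) natrM; apply: (@le_trans _ _ (2 * (K * S))); first by rewrite ler_wpM2l.
  rewrite -SS expr2 mulrA ler_wpM2r ?(ltW S0)//.
  rewrite -[leRHS]mul1r; apply: le_trans H3.
  by rewrite ler_peMr ?lerDl// mulr_ge0.
have mn : (B * l <= n)%N by apply: leq_trans m2; rewrite leq_pmull.
have mD : (B * l * (3 * L) <= key_length (6 * K) n)%N.
  apply: key_length_ge => //; first by rewrite mulr_ge0.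
  have LL : L%:R <= 2 * log2 (n%:R : R) by apply: log_len_log2; apply: leq_trans n5'.
  rewrite natrM; apply: (@le_trans _ _ (K * S * (3 * (2 * log2 (n%:R : R))))).
    by rewrite ler_pM// natrM ler_wpM2l.
  by rewrite le_eqVlt; apply/orP; left; apply/eqP; rewrite /S; ring.
pose a := (2 + K + L%:R) * S.
have ad : a * gap <= d * n%:R.
  rewrite /a -SS expr2 mulrA mulrAC ler_wpM2r ?(ltW S0)//.
  apply: le_trans H4; rewrite -subr_ge0.
  have -> : (2 + K) * gap * (1 + L%:R) - (2 + K + L%:R) * gap = (1 + K) * gap * L%:R by ring.
  by rewrite !mulr_ge0// addr_ge0.
have bR : (b%:R : R) * ln 2 <= (kap%:R / lam%:R * ln 2) * l%:R.
  rewrite /b /l !natrM le_eqVlt; apply/orP; left; apply/eqP; field; rewrite gt_eqF//.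
pose w := `|Num.ceil ((rho + delta) * l%:R)|%N.
have rd0 : 0 <= (rho + delta) * l%:R by rewrite mulr_ge0// addr_ge0// ltW.
have /andP[w1 w2] := natceil_itv rd0; rewrite -/w in w1 w2.
have AE' : K * gap + 5 <= E * (A * lam)%:R.
  by apply: le_trans AE _; rewrite natrM mulrA ler_peMr// mulr_ge0 ?ltW.
have [eps0 epsE eps_lt1] := codebook_error_bound n5' (mulr_ge0 K0 g0) AE'.
rewrite -natrM -/l in eps0 epsE eps_lt1; set eps := 6 * _ * _ in eps0 epsE eps_lt1.
have [C [bdec [C1 C2 C3]]] := Hcode n l b w a n_gt0 ad bR w1 eps_lt1.
have Jn : (#|('I_B * 'I_l)%type : finType| <= n)%N by rewrite card_prod !card_ord.
have JD : (#|('I_B * 'I_l)%type : finType| * (3 * L) <= key_length (6 * K) n)%N.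
  by rewrite card_prod !card_ord.
have nL : (n < 2 ^ L)%N by exact: up_log_gt.
have nD : (n <= 2 ^ (3 * L))%N.
  by apply: (leq_trans (ltnW nL)); rewrite leq_exp2l// leq_pmull.
exists (hidden_code N (key_length (6 * K) n) (3 * L) B n_gt0 C bdec); split.
- pose m1 : R := Num.sqrt n.-1%:R.
  have m1_gt0 : 0 < m1.
    by rewrite sqrtr_gt0 ltr0n -ltnS prednK// (leq_trans _ n5').
  have t2m : t2 <= m1.
    rewrite -[leLHS](ger0_norm (ltW t20)) -sqrtr_sqr ler_sqrt//.
    have /andP[h1 _] := natceil_itv (sqr_ge0 t2).
    by apply: le_trans h1 _; rewrite ler_nat -ltnS prednK//; apply: leq_trans nn8; rewrite /n8 addnS ltnS leq_addr.
  have m1S : m1 <= S by rewrite ler_sqrt// ler_nat leq_pred.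
  have th01 : 0 <= t2 / m1 <= 1.
    by rewrite (divr_ge0 (ltW t20) (ltW m1_gt0))/= ler_pdivrMr// mul1r.
  have nth : t2 * S <= n%:R * (t2 / m1).
    have -> : n%:R * (t2 / m1) = t2 * (S ^+ 2 / m1) by rewrite SS; ring.
    rewrite ler_wpM2l ?(ltW t20)// ler_pdivlMr// expr2 ler_wpM2l//; exact: ltW.
  have tails s : bernoulli_tail n s (q + t2 / m1 * (1 - 2 * q)) - bernoulli_tail n s q <= 1 - 2 * gaussianQ x.
    by have := H7 s; rewrite hE -/m1 [t2 * _ / m1]mulrAC.
  have bL : L%:R <= b%:R :> R by rewrite ler_nat /b leq_pmull// muln_gt0 A_gt0.
  have rd2 : 0 <= rho + delta <= 2.
    by rewrite addr_ge0 ?(ltW delta0)//= -[2]/(1 + 1) lerD.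
  have Bw : (B * w)%:R <= t1 * S.
    rewrite -yE in rt1; rewrite natrM in mR; rewrite natrM.
    exact: (block_weight_bound gg0 S0 LR1 bL rd2 y0 c0 (ler0n _ B) gE H6 BbR mR (ltW w2) H2).
  have := detection_error_hidden bdec n_gt0 N0 q0 q_lt Jn JD nD C3 th01 tails.
  apply: le_trans.
  have v1 := weight_shortfall th01 t10 t12 nth Bw.
  have v2 : (#|('I_B * 'I_l)%type : finType|)%:R * (n%:R / 2 ^+ (3 * L)) <= n.+1%:R^-1 :> R.
    exact: key_loss_le.
  have v3 : n.+1%:R^-1 <= e / 2 :> R.
    have /andP[h1 _] := natceil_itv (ltac:(by apply: divr_ge0 => //; exact: ltW) : 0 <= 2 / e).
    rewrite -[leRHS]invrK lef_pV2 ?posrE ?invr_gt0 ?divr_gt0// invf_div.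
    by apply: le_trans h1 _; rewrite ler_nat; apply: leq_trans nn9 _.
  have v4 : expR (- (kappa * S)) <= e / 2.
    rewrite expRN -[leRHS]invrK lef_pV2 ?posrE ?invr_gt0 ?divr_gt0 ?expR_gt0// invf_div.
    apply: le_trans (expR_ge1Dx _); apply: ler_wpDl => //; apply: le_trans H5.
    by rewrite ler_peMr ?lerDl// divr_ge0// ltW.
  rewrite mulrA -kappaE in v1.
  (* The slack [e] is shared between the weight shortfall and the bias of the positions. *)
  have epsE' : eps_d = 1 - 2 * gaussianQ x + e / 2 + e / 2 by rewrite eE; field.
  rewrite lerD2l lerN2 [leRHS]epsE'; apply: lerD; last exact: le_trans v2 v3.
  by rewrite lerD2l; exact: le_trans v1 v4.
- rewrite -mulrA; apply: jammed_sup_le => W t jamW.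
  apply: (@reliability_bound R n q _ q0 q_lt p K d eps N (key_length (6 * K) n) B b l C bdec n_gt0) => //.
  all: rewrite ?card_prod ?card_ord//; try exact: ltW.
  exact: ltnW.
- have [cenc [ce1 ce2]] := encoder_circuit N (key_length (6 * K) n) (3 * L) n_gt0 nL C bdec Jn.
  have [cdec [cd1 cd2]] := decoder_circuit (key_length (6 * K) n) (3 * L) n_gt0 B0 NB nL C bdec Jn.
  have Al0 : (0 < A * lam)%N by rewrite muln_gt0 A_gt0.
  have [k1 k2] := cost_bound n_gt0 Al0 mn nbB.
  by exists cenc, cdec; split=> //; [exact: leq_trans k1|exact: leq_trans k2].
Qed.

End Scheme.

(** * Passage to the limit *)

Lemma limn_einf_ge (R : realType) (u : nat -> \bar R) (a : \bar R) (n0 : nat) :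
  (forall n, (n0 <= n)%N -> (a <= u n)%E) -> (a <= limn_einf u)%E.
Proof.
move=> H; rewrite limn_einf_lim; apply: lime_ge.
  exact: is_cvg_einfs.
near=> n; apply: le_ereal_inf_tmp => _ [k /= nk <-]; apply: H; apply: leq_trans nk.
near: n; exact: nbhs_infty_ge.
Unshelve. all: by end_near.
Qed.

Lemma limn_esup_inv (R : realType) (K : R) : limn_esup (fun n => (K / n.+1%:R)%:E) = 0%E.
Proof.
have H : ((fun n => (K / n.+1%:R)%:E) @ \oo --> 0%E)%classic.
  apply/fine_cvgP; split; first by apply: nearW.
  rewrite -[0%R](mulr0 K); apply: cvgM; first exact: cvg_cst.
  exact: cvg_harmonic.
by rewrite is_cvg_limn_esupE; [apply/cvg_lim|apply/cvg_ex; exists 0%E].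
Qed.

Local Open Scope classical_set_scope.
Local Open Scope ring_scope.

Theorem theorem4 (R : realType) (eps_d p q r rho : R)
    (eps_d01 : 0 < eps_d < 1) (p_gt0 : 0 < p) (p_lt_q : p < q) (q_lt : q < 1 / 2)
    (rho01 : 0 <= rho <= 1)
    (rho_max : mutual_info (bernoulli_pmf rho) (bac p q) = bac_capacity p q)
    (r_ge0 : 0 <= r)
    (r_lt : r < covert_weight q eps_d / rho * bac_capacity p q) :
  exists (c : R) (N : nat -> nat)
      (C : forall n : nat, jam_code n (N n) (key_length c n)),
    [/\ 0 < c,
        has_throughput r N,
        covert C q eps_d,
        exists eps : nat -> R,
          (\forall n \near \oo, error_probability (C n) p q <= eps n) /\
          limn_esup (fun n => (eps n)%:E) = 0%E
      & poly_complexity C].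
Proof.
rewrite -rho_max in r_lt.
have [c [K [e [n0 [c0 H]]]]] := codes_exist eps_d01 p_gt0 p_lt_q q_lt rho01 r_ge0 r_lt.
have D n : exists C : jam_code n (msg_count r n) (key_length c n), (n0 <= n)%N ->
  [/\ 1 - eps_d <= detection_error C q,
      error_probability C p q <= K / n.+1%:R &
      exists cenc cdec, [/\ computes_encoder cenc C, computes_decoder cdec C,
        (circuit_size cenc <= 11 * (4 * n) ^ e)%N & (circuit_size cdec <= 11 * (4 * n) ^ e)%N]].
  have [/H[C HC]|nn] := leqP n0 n; first by exists C.
  (* Below the threshold length any code will do, as the three properties are asymptotic. *)
  by exists (@Code n _ _ (fun _ _ _ => [ffun=> false]) (fun _ _ => ord0) (fun _ _ => erefl)).
exists c, (msg_count r), (fun n => sval (cid (D n))).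
have HC n := svalP (cid (D n)).
split=> //; first exact: msg_count_throughput.
- by apply: (@limn_einf_ge _ _ _ n0) => n /HC[]; rewrite lee_fin.
- exists (fun n => K / n.+1%:R); split; last exact: limn_esup_inv.
  by exists n0 => // n /HC[].
- exists ((11 * 4 ^ e)%N *: 'X^e); exists n0 => // n /HC[_ _ [cenc [cdec [h1 h2 h3 h4]]]].
  by exists cenc, cdec; rewrite hornerZ hornerXn natrXE natrME -mulnA -expnMn.
Qed.
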